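(* Let $n\ge 2$, $m\in\mathbb N$. There is a nonzero polynomial $\mathcal R$ with integer coefficients in the $nm$ coordinates of $(v_1,\dots,v_m)$ such that for every $S=\{v_1,\dots,v_m\}\subset\mathbb Z^n$ with $\mathcal R(v_1,\dots,v_m)\ne0$ the graph $\Gamma_S$ has the following properties (the special component $S$ itself being excluded): (1) Every connected component of $\Gamma_S$ has as vertices points which are affinely independent, hence at most $n+1$ vertices. (2) There are finitely many components containing red edges. (3) The connected components of $\Gamma_S$ consisting only of black edges are divided into a finite number of families. Each family is indexed by an abstract marked graph with $k+1$ vertices, $k\le n$ (i.e. whose maximal trees have $k$ edges), and it depends on the elements of an $(n-k)$-dimensional sublattice: the roots of the components of the family lie in a coset of a sublattice of $\mathbb Z^n$ of rank $n-k$.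
   Context: The graph $\Gamma_S$ has vertex set $\mathbb Z^n$. For $i\ne j$ and $h,k\in\mathbb Z^n$: $k$ and $h$ are joined by a black edge oriented from $k$ to $h$ and marked $(i,j)$ if $h-k=v_j-v_i$ and $|h|^2-|k|^2=|v_j|^2-|v_i|^2$; they are joined by a red (non-oriented) edge marked $(i,j)$ if $h+k=v_i+v_j$ and $|h|^2+|k|^2=|v_i|^2+|v_j|^2$. For generic $S$ the set $S=\{v_1,\dots,v_m\}$ is itself a connected component, called the special component. An abstract marked graph is a connected graph without repeated edges, each edge being colored red or black and carrying a marking $(i,j)$, $1\le i\neq j\le m$, with the opposite orientation corresponding to the exchanged marking $(j,i)$. The abstract marked graph of a component is the component with its colors and markings (forgetting the positions of the vertices); in each abstract graph a vertex (root) is fixed, and the root of a component is the corresponding vertex in $\mathbb Z^n$. *)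

(* Defs.v *)
From mathcomp Require Import all_boot all_order all_algebra.
From mathcomp Require Import classical_sets cardinality.
From mathcomp Require Import mpoly.

Set Implicit Arguments.
Unset Strict Implicit.
Unset Printing Implicit Defensive.

Import GRing.Theory Num.Theory.
Local Open Scope ring_scope.
Local Open Scope classical_set_scope.

Inductive color := Black | Red.

Section EdgeSystems.
Variables (m : nat) (T : Type) (E : color -> T -> T -> 'I_m -> 'I_m -> bool).

Definition joined : rel T :=
  fun x y => [exists i, exists j, E Black x y i j || E Red x y i j].

Definition linked (x y : T) : Prop :=
  exists2 p : seq T, path joined x p & last x p = y.

End EdgeSystems.

(* [mg_edge Black x y i j] is a black edge oriented from x to y and marked
   (i,j); read backwards it is marked (j,i).  A red edge has no orientation, so
   for it the markings (i,j) and (j,i) are the same. *)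
Record marked_graph (m : nat) := MarkedGraph {
  mg_k : nat;
  mg_edge : color -> 'I_mg_k.+1 -> 'I_mg_k.+1 -> 'I_m -> 'I_m -> bool;
  mg_marking : forall c x y i j, mg_edge c x y i j -> i != j;
  mg_loopless : forall c x y i j, mg_edge c x y i j -> x != y;
  mg_reverse : forall c x y i j, mg_edge c x y i j = mg_edge c y x j i;
  mg_red_unoriented : forall x y i j, mg_edge Red x y i j = mg_edge Red y x i j;
  mg_no_repeat : forall c c' x y i j i' j',
    mg_edge c x y i j -> mg_edge c' x y i' j' ->
    c = c' /\ ((i', j') = (i, j) \/ (c = Red /\ (i', j') = (j, i)));
  mg_connected : forall x y, linked mg_edge x y
}.

Section Lattice.
Variable n : nat.
Implicit Types (h k c : 'rV[int]_n) (C L : set 'rV[int]_n).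

Definition sqnorm h : int := \sum_(t < n) h 0 t ^+ 2.

Definition affinely_independent C : Prop :=
  forall (r : nat) (p : 'I_r -> 'rV[int]_n) (a : 'I_r -> rat),
    injective p -> (forall t, C (p t)) ->
    \sum_t a t = 0 -> \sum_t a t *: map_mx intr (p t) = 0 :> 'rV[rat]_n ->
    forall t, a t = 0.

Definition sublattice_of_rank (r : nat) L : Prop :=
  exists2 B : 'M[int]_(r, n), row_free (map_mx intr B : 'M[rat]_(r, n))
                            & L = [set a *m B | a in [set: 'rV[int]_r]].

Definition coset c L : set 'rV[int]_n := [set c + l | l in L].

End Lattice.

Section GammaS.
Variables (n m : nat) (v : 'I_m -> 'rV[int]_n).
Implicit Types (h k : 'rV[int]_n) (C : set 'rV[int]_n).

Definition coordinates : 'I_(m * n) -> int := mxvec (\matrix_(i < m) v i) 0.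

Definition gamma_edge (c : color) k h (i j : 'I_m) : bool :=
  (i != j) &&
  match c with
  | Black => (h - k == v j - v i) &&
             (sqnorm h - sqnorm k == sqnorm (v j) - sqnorm (v i))
  | Red => (h + k == v i + v j) &&
           (sqnorm h + sqnorm k == sqnorm (v i) + sqnorm (v j))
  end.

Definition component C : Prop := exists h, C = [set k | linked gamma_edge h k].

Definition nonspecial_component C : Prop := component C /\ C <> range v.

Definition has_red_edge C : Prop :=
  exists k h i j, [/\ C k, C h & gamma_edge Red k h i j].

Definition black_component C : Prop :=
  nonspecial_component C /\ ~ has_red_edge C.

(* [phi] identifies [G] with the abstract marked graph of the component [C];
   the root of [C] is then [phi r], where [r] is the root of [G]. *)
Definition realizes (G : marked_graph m) C (phi : 'I_(mg_k G).+1 -> 'rV[int]_n)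
    : Prop :=
  [/\ injective phi, range phi = C &
      forall c x y i j, mg_edge c x y i j = gamma_edge c (phi x) (phi y) i j].

(* The root fixed in each abstract graph is an arbitrary vertex; the condition
   is required for every choice [r] of it. *)
Definition black_families : Prop :=
  exists (N : nat) (F : 'I_N -> marked_graph m),
    (forall C, black_component C ->
       exists! t, exists phi, @realizes (F t) C phi) /\
    (forall t, (mg_k (F t) <= n)%N /\
       forall r : 'I_(mg_k (F t)).+1,
       exists L c, sublattice_of_rank (n - mg_k (F t)) L /\
         forall C phi, black_component C -> @realizes (F t) C phi ->
           coset c L (phi r)).

End GammaS.

(* Main.v *)
Require Import Defs.
From mathcomp Require Import all_boot all_order all_algebra.
From mathcomp Require Import zify ring lra.

(* A vertex reached from [x] along edges is [x + sum_i z_i v_i] or its opposite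
   for an integer vector [z] whose coordinates sum to 0 or -2, and its norm is
   then determined by [z] and [x]. Adding vertices one at a time to an affinely
   independent part of a component, the first affine dependence would occur
   after at most [n + 2] vertices, so only finitely many configurations [z] have
   to be excluded, each by a nonzero polynomial in the [v_i]. If an affine
   relation of the vectors [z] has a nonzero mixed second moment
   [sum d z_i z_j], then the norms impose a nontrivial polynomial equation.
   Otherwise a combinatorial argument on spanning trees shows that the vectors
   [z] are affinely independent. The dependence of the points is then expressed
   by a determinant, and this determinant vanishes identically only if some
   vertex of the component is one of the [v_i].

   It follows that a component is an affinely independent set. A red edge puts
   its ends on a fixed sphere, whence finiteness. For a component with black
   edges only, the graph prescribes the differences [y - r] to the root [r] and
   the values [(r, y - r)], so that the roots of a family lie in a coset of the
   integral kernel of the [k] independent vectors [y - r]. *)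

Set Implicit Arguments.
Unset Strict Implicit.
Unset Printing Implicit Defensive.

Import Order.TTheory GRing.Theory Num.Theory.
Local Open Scope ring_scope.

(** * Finite configurations of integer vectors *)

(** An affine relation among the vectors [z] makes the points dependent for every choice of the
    [v_i], so no determinant in the positions can exclude it; this is why relations among the [z]
    need a treatment of their own. In a minimal configuration the relation is unique up to scaling,
    so every function orthogonal to it is affine in the coordinates, with a gradient read off from
    the diagonal second moments. A nonzero diagonal moment forces a coordinate to take three values,
    hence to change at least twice along any spanning tree, while a dimension count allows only two
    changes in all beyond this minimum. Every leaf edge changes two coordinates of larger degree,
    which pins the tree down until it contradicts itself.

    For the determinants, identical vanishing is exploited at parameters of rank one, where all
    [v_i] lie on a line and the quadratic forms become explicit in one number per [v_i]. The
    Cauchy-Schwarz inequality used with two layers needs independent rows, which such parameters do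
    not give; it is obtained there as a limit. *)

Section EdgeLists.
Variable U : finType.
Implicit Types (F : seq (U * U)) (P Q : {set U}).

Definition crossing P (e : U * U) := (e.1 \in P) != (e.2 \in P).
Definition cut_size F P := count (crossing P) F.
Definition proper_part P := (P != set0) && (P != [set: U]).
Definition link F x y := ((x, y) \in F) || ((y, x) \in F).

(** Trees are never defined: a spanning tree of the quotient of [U] by [rho] is a list of edges that
    crosses every proper part saturated for [rho] and has one edge fewer than there are classes. For
    [rho = id] it is a spanning tree of [U]. *)
Definition spans (X : eqType) (rho : U -> X) F :=
  forall P, (forall x y, rho x = rho y -> (x \in P) = (y \in P)) ->
    proper_part P -> (0 < cut_size F P)%N.

Lemma cut_sizeC F P : cut_size F (~: P) = cut_size F P.
Proof.
by apply: eq_count => e; rewrite /crossing !inE; case: (_ \in P); case: (_ \in P).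
Qed.

Lemma linkC F x y : link F x y = link F y x.
Proof. by rewrite /link orbC. Qed.

Lemma cut_link F P : (0 < cut_size F P)%N ->
  exists x y, [/\ x \in P, y \notin P & link F x y].
Proof.
rewrite -has_count => /hasP[[x y] xyF]; rewrite /crossing /=.
case xP: (x \in P); case yP: (y \in P) => // _.
  by exists x, y; rewrite xP yP /link xyF.
by exists y, x; rewrite xP yP /link xyF orbT.
Qed.

Lemma link_cut F P x y : x \in P -> y \notin P -> link F x y ->
  (0 < cut_size F P)%N.
Proof.
move=> xP yP /orP[] h; rewrite -has_count; apply/hasP;
  [exists (x, y)|exists (y, x)] => //; by rewrite /crossing /= xP (negPf yP).
Qed.

Lemma count1_uniq (T : eqType) (p : pred T) (s : seq T) a b :
  count p s = 1%N -> a \in s -> p a -> b \in s -> p b -> a = b.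
Proof.
rewrite -size_filter => h as_ pa bs pb.
have: a \in filter p s by rewrite mem_filter pa.
have: b \in filter p s by rewrite mem_filter pb.
by case: (filter p s) h => [|c [|]] //= _; rewrite !inE => /eqP-> /eqP->.
Qed.

Lemma cut1_uniq F P x y x' y' : cut_size F P = 1%N ->
  x \in P -> y \notin P -> link F x y ->
  x' \in P -> y' \notin P -> link F x' y' -> x = x' /\ y = y'.
Proof.
move=> h xP yP + x'P y'P.
have aux a b c d : (a, b) \in F -> (c, d) \in F ->
    crossing P (a, b) -> crossing P (c, d) -> a = c /\ b = d.
  by move=> ab cd cab ccd; case: (count1_uniq h ab cab cd ccd).
have nP a b : a \in P -> b \notin P -> crossing P (a, b) /\ crossing P (b, a).
  by move=> aP bP; rewrite /crossing /= aP (negPf bP).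
have [c1 c2] := nP _ _ xP yP; have [c3 c4] := nP _ _ x'P y'P.
move=> /orP[] l1 /orP[] l2.
- exact: aux l1 l2 c1 c3.
- by have [e1 e2] := aux _ _ _ _ l1 l2 c1 c4; rewrite e1 (negPf y'P) in xP.
- by have [e1 e2] := aux _ _ _ _ l1 l2 c2 c3; rewrite e1 x'P in yP.
- by have [-> ->] := aux _ _ _ _ l1 l2 c2 c4.
Qed.

(** Prim's construction: [Y] is the set of classes already reached, and a new class is attached by
    an edge leaving the preimage of [Y]. The invariant speaks only of saturated parts that separate
    two points over [Y]. *)
Lemma spanning (adj : rel U) (X : finType) (rho : U -> X) (x0 : U) :
  (forall P, proper_part P ->
     exists x y, [/\ x \in P, y \notin P & adj x y]) ->
  exists F, [/\ (size F).+1 = #|[set rho x | x in [set: U]]|,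
    all (fun e => adj e.1 e.2) F & spans rho F].
Proof.
move=> conn; set R := [set _ | _ in _].
have x0R : rho x0 \in R by apply: imset_f; rewrite inE.
suff aux k : (k < #|R|)%N -> exists F (Y : {set X}),
    [/\ size F = k, all (fun e => adj e.1 e.2) F, Y \subset R, #|Y| = k.+1 &
     forall P, (forall x y, rho x = rho y -> (x \in P) = (y \in P)) ->
      forall x y, rho x \in Y -> rho y \in Y -> x \in P -> y \notin P ->
      (0 < cut_size F P)%N].
  have R0 : (0 < #|R|)%N by apply/card_gt0P; exists (rho x0).
  have [|F [Y [sF aF YR cY sp]]] := aux #|R|.-1; first by rewrite prednK.
  exists F; split=> //; first by rewrite sF prednK.
  have eY : Y = R by apply/eqP; rewrite eqEcard YR cY prednK /=.
  move=> P satP /andP[/set0Pn[x xP]]; rewrite -subTset => /subsetPn[y _ yP].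
  have inR a : rho a \in R by apply: imset_f; rewrite inE.
  by apply: (sp P satP x y) => //; rewrite eY.
elim: k => [_|k IH lt].
  exists [::], [set rho x0]; split=> //; first by rewrite sub1set.
    by rewrite cards1.
  move=> P satP x y; rewrite !inE => /eqP e1 /eqP e2 xP.
  by rewrite -(satP x y) ?xP // e1 e2.
have [F [Y [sF aF YR cY sp]]] := IH (ltnW lt).
have [|x [y [xP yP xy]]] := conn (rho @^-1: Y).
  apply/andP; split.
    have /card_gt0P[r rY] : (0 < #|Y|)%N by rewrite cY.
    have /imsetP[x _ e] : r \in R by apply: (subsetP YR).
    by apply/set0Pn; exists x; rewrite inE -e.
  apply: contraTneq lt => e; rewrite -leqNgt -cY.
  apply: subset_leq_card; apply/subsetP => r /imsetP[x _ ->].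
  by have : x \in [set: U] by []; rewrite -e inE.
rewrite !inE in xP yP.
exists ((x, y) :: F), (rho y |: Y); split => /=; rewrite ?sF ?xy //.
- rewrite subUset sub1set YR andbT; apply: imset_f; by rewrite inE.
- by rewrite cardsU1 yP cY.
move=> P satP a b; rewrite /cut_size /= /crossing /= !in_setU1.
case xPP: (x \in P); case yPP: (y \in P) => //=.
- move=> ha hb aP bP.
  have {}hb : rho b \in Y.
    by case/orP: hb => // /eqP/satP; rewrite yPP (negPf bP).
  exact: (sp P satP x b).
- move=> ha hb aP bP.
  have {}ha : rho a \in Y.
    by case/orP: ha => // /eqP/satP; rewrite yPP aP.
  exact: (sp P satP a x _ _ _ (negbT xPP)).
Qed.

(** Handshake identity: [cut_size F [set t]] is the degree of the vertex [t]. *)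
Lemma sum_cut1 F : all (fun e => e.1 != e.2) F ->
  \sum_t cut_size F [set t] = (size F).*2.
Proof.
elim: F => [_|e F IH /= /andP[ne /IH h]].
  by rewrite big1.
rewrite (eq_bigr (fun t => crossing [set t] e + cut_size F [set t])%N) //.
rewrite big_split /= h doubleS.
suff -> : (\sum_i crossing [set i] e = 2)%N by [].
rewrite (bigD1 e.1) //= (bigD1 e.2) 1?eq_sym //= big1 => [|t /andP[n1 n2]].
  by rewrite /crossing !inE !eqxx ![e.2 == e.1]eq_sym (negPf ne).
by rewrite /crossing !inE ![_ == t]eq_sym (negPf n1) (negPf n2).
Qed.

Lemma proper_part1 t : (1 < #|U|)%N -> proper_part [set t].
Proof.
move=> U1; apply/andP; split; first by apply/set0Pn; exists t; rewrite inE.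
by apply: contraTneq U1 => e; rewrite -cardsT -e cards1.
Qed.

(** The degrees are positive and sum to [2 * (#|U| - 1)], so at least two of them equal 1. *)
Lemma two_leaves F : all (fun e => e.1 != e.2) F -> (size F).+1 = #|U| ->
  spans id F -> (1 < #|U|)%N ->
  exists t t', [/\ t != t', cut_size F [set t] = 1%N & cut_size F [set t'] = 1%N].
Proof.
move=> ne sF sp U1; pose L := [set t | cut_size F [set t] == 1%N].
have cut0 t : (0 < cut_size F [set t])%N.
  by apply: sp; [move=> x y -> | apply: proper_part1].
have : (\sum_(t : U) 2 <= \sum_(t : U) (cut_size F [set t] + (t \in L)))%N.
  by apply: leq_sum => t _; rewrite inE; case: (cut_size F _) (cut0 t) => [|[|]].
have eL : (\sum_(t : U) (t \in L) = #|L|)%N.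
  by rewrite -sum1_card [RHS]big_mkcond; apply: eq_bigr => t _; case: (t \in L).
rewrite big_split /= sum_cut1 // eL sum_nat_const => h.
have : (1 < #|L|)%N by move: h sF; move: #|U| (size F) #|L| => a b c; lia.
case/card_gt1P => t [t' [tL t'L tt']]; exists t, t'; split=> //.
  by move: tL; rewrite inE => /eqP.
by move: t'L; rewrite inE => /eqP.
Qed.

End EdgeLists.

Lemma unit_step0 (a b c : int) : `|a - b|%N = 1%N -> (a - b) * (c - b) = 0 -> c = b.
Proof. by move=> h /eqP; rewrite mulf_eq0 => /orP[]/eqP; lia. Qed.

Lemma unit_step2 (a b c : int) : `|a - b|%N = 1%N -> (a - b) * (c - b) = 2 ->
  `|b - c|%N = 2%N.
Proof.
move=> h; have [-> |->] : a - b = 1 \/ a - b = -1 by lia.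
  by lia.
by lia.
Qed.

Lemma pair_eq (T : finType) (x y x' y' : T) : [set x; y] = [set x'; y'] -> x != y ->
  (x = x' /\ y = y') \/ (x = y' /\ y = x').
Proof.
move=> /setP e xy; have := e x; have := e y; rewrite !inE !eqxx orbT /=.
by move=> /esym/orP[]/eqP ey /esym/orP[]/eqP ex; rewrite ex ey ?eqxx in xy *; [|right|left|].
Qed.

(** * Minimal affine relations with diagonal second moments *)

Section Moments.
Variables (U I : finType) (z : U -> I -> int).
Implicit Types (x y : U) (A P : {set U}) (d : U -> rat) (i j : I).

Definition changed x y := [set i | z x i != z y i].
Definition adjacent x y :=
  (#|changed x y| == 2%N) && [forall i, (`|z x i - z y i| <= 1)%N].
Definition connected A := forall P, P \subset A -> P != set0 -> P != A ->
  exists x y, [/\ x \in P, y \in A :\: P & adjacent x y].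
Definition affine_relation d :=
  \sum_x d x = 0 /\ forall i, \sum_x d x * (z x i)%:~R = 0.
(** The case left over by the norm equations: with respect to every relation, the matrix of second
    moments is diagonal. *)
Definition diagonal_moments := forall d, affine_relation d ->
  forall i j, i != j -> \sum_x d x * (z x i)%:~R * (z x j)%:~R = 0.

Lemma adjacentC x y : adjacent x y = adjacent y x.
Proof.
rewrite /adjacent; congr (_ && _).
  by rewrite /changed; under eq_finset do rewrite eq_sym.
by apply: eq_forallb => i; rewrite distnC.
Qed.

Lemma adjacent_neq x y : adjacent x y -> x != y.
Proof.
case/andP => h _; apply: contraTneq h => ->.
by rewrite /changed; under eq_finset do rewrite eqxx; rewrite cards0.
Qed.

Lemma adjacent_le1 x y i : adjacent x y -> (`|z x i - z y i| <= 1)%N.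
Proof. by case/andP => _ /forallP. Qed.

Hypothesis z_inj : forall x y, (forall i, z x i = z y i) -> x = y.
Hypothesis z_conn : connected [set: U].
Hypothesis z_diag : diagonal_moments.
Hypothesis z_min : forall A, connected A -> A != [set: U] ->
  forall d, affine_relation d -> (forall x, x \notin A -> d x = 0) ->
  forall x, d x = 0.
Variable d : U -> rat.
Hypothesis d_rel : affine_relation d.
Hypothesis d_neq0 : exists x, d x != 0.

Lemma card_gt1 : (1 < #|U|)%N.
Proof.
rewrite ltnNge; apply/negP => /card_le1P h; have [x dx] := d_neq0.
case: d_rel => s0 _; move: s0; rewrite (bigD1 x) //= big1 ?addr0.
  by move/eqP; rewrite (negPf dx).
by move=> y; have := h x isT y; rewrite !inE => <-.
Qed.

Lemma ex_spanning : exists F, [/\ (size F).+1 = #|U|,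
  all (fun e => adjacent e.1 e.2) F & spans id F].
Proof.
have [x0 _] := d_neq0.
have [|F [sF aF sp]] := @spanning U adjacent U id x0.
  move=> P /andP[P0 PT]; have [x [y [xP yP xy]]] := z_conn (subsetT P) P0 PT.
  by exists x, y; rewrite !inE andbT in yP.
by exists F; split; rewrite // sF imset_id cardsT.
Qed.

(** An edge leaving [P] can reach [t] only from its neighbour [s']. If [s'] lies in [P], the
    argument is applied to the complement of [P] in [[set~ t]] instead. *)
Lemma leaf_connected F t : all (fun e => adjacent e.1 e.2) F -> spans id F ->
  cut_size F [set t] = 1%N -> connected ([set~ t]).
Proof.
move=> aF sp lt P sPt P0 PA.
have link_adj x y : link F x y -> adjacent x y.
  by case/orP => /(allP aF) //=; rewrite adjacentC.
have tP : t \notin P by apply/negP => /(subsetP sPt); rewrite !inE eqxx.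
have [s [s' [st snt ts]]] : exists x y, [/\ x \in [set t], y \notin [set t] & link F x y].
  by apply: cut_link; rewrite lt.
move: st; rewrite inE => /eqP e; subst s.
have cut (Q : {set U}) x y : Q \subset [set~ t] -> s' \notin Q -> x \in Q -> y \notin Q ->
    link F x y -> y \in [set~ t] :\: Q.
  move=> sQ s'Q xQ yQ xy; rewrite !inE yQ /=; apply: contraNneq s'Q => yt.
  have xt : x \notin [set t] by have := subsetP sQ _ xQ; rewrite !inE.
  move: xy; rewrite yt linkC => tx.
  by have [_ ->] := cut1_uniq lt (set11 t) snt ts (set11 t) xt tx.
have spQ (Q : {set U}) : Q != set0 -> t \notin Q ->
    exists x y, [/\ x \in Q, y \notin Q & link F x y].
  move=> Q0 tQ; apply: cut_link; apply: sp; first by move=> x y ->.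
  by rewrite /proper_part Q0; apply: contraNneq tQ => ->.
case s'P: (s' \in P); last first.
  have [x [y [xP yP xy]]] := spQ P P0 tP.
  by exists x, y; split; [| apply: (cut P x) => //; rewrite s'P | apply: link_adj].
pose Q := [set~ t] :\: P.
have sQ : Q \subset [set~ t] by apply: subsetDl.
have Q0 : Q != set0.
  by apply: contra PA => /eqP h; rewrite eqEsubset sPt -setD_eq0 -/Q h eqxx.
have s'Q : s' \notin Q by rewrite !inE s'P.
have [||x [y [xQ yQ xy]]] := spQ Q => //; first by rewrite !inE eqxx andbF.
exists y, x; split; [|by []|by rewrite adjacentC; apply: link_adj].
have := cut Q x y sQ s'Q xQ yQ xy; rewrite !inE => /andP[_ yt].
by move: yQ; rewrite !inE yt andbT negbK.
Qed.

(** Subtracting a multiple of [d] makes the relation vanish at a leaf; what remains lives on a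
    proper connected subset and is zero by minimality. Minimality also gives [d t != 0] at the
    leaf. *)
Lemma relation_unique d' : affine_relation d' -> exists c, forall x, d' x = c * d x.
Proof.
move=> [s0 s1]; have [F [sF aF sp]] := ex_spanning.
have ne : all (fun e => e.1 != e.2) F.
  by apply: sub_all aF => e; apply: adjacent_neq.
have [t [_ [_ ct _]]] := two_leaves ne sF sp card_gt1.
have conn := leaf_connected aF sp ct.
have An : [set~ t] != [set: U].
  by apply/eqP => /setP/(_ t); rewrite !inE eqxx.
have dt : d t != 0.
  apply/eqP => dt; have [x /eqP[]] := d_neq0.
  apply: (z_min conn An d_rel) => y; rewrite !inE negbK => /eqP->; exact: dt.
exists (d' t / d t) => x; apply/eqP; rewrite -subr_eq0; apply/eqP.
pose d2 x := d' x - d' t / d t * d x.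
apply: (z_min (d := d2) conn An).
  have [r0 r1] := d_rel; split.
    by rewrite /d2 big_split /= sumrN -big_distrr /= s0 r0 mulr0 subr0.
  move=> i; rewrite /d2; under eq_bigr do rewrite mulrBl -[_ * d _ * _]mulrA.
  by rewrite big_split /= sumrN -big_distrr /= s1 r1 mulr0 subr0.
by move=> y; rewrite !inE negbK => /eqP->; rewrite /d2 divfK // subrr.
Qed.

Lemma no_small_support A : connected A -> A != [set: U] ->
  exists2 x, x \notin A & d x != 0.
Proof.
move=> cA nA; apply/exists_inP; apply: contraT; rewrite negb_exists_in.
move=> /forall_inP h; have [x /eqP[]] := d_neq0.
by apply: (z_min cA nA d_rel) => y yA; apply/eqP; rewrite -[_ == _]negbK h.
Qed.

(* Since the relation [d] is unique up to scaling, every function orthogonal to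
   [d] is affine in the coordinates of [z], and by [z_diag] its [i]-th
   coefficient is its pairing with [z_i] divided by [2 * half_moment i]. *)
Definition half_moment i := 2^-1 * \sum_x d x * (z x i)%:~R ^+ 2.

(** Linear duality: a row lies in the row space of [M] as soon as the cokernel of [M] kills it, and
    the columns of the cokernel are relations, hence multiples of [d]. The index [None] stands for
    the constant function. *)
Lemma functions_are_affine (phi : U -> rat) : \sum_x d x * phi x = 0 ->
  exists G0 (G : I -> rat), forall x, phi x = G0 + \sum_i G i * (z x i)%:~R.
Proof.
move=> h.
pose col (k : option I) x := if k is Some i then (z x i)%:~R else 1 : rat.
pose M := \matrix_(k < #|{: option I}|, x < #|U|) col (enum_val k) (enum_val x).
pose f := \row_(x < #|U|) phi (enum_val x).
have : (f <= M)%MS.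
  rewrite submxE; move: (cokermx M) (mulmx_coker M) => C hC.
  apply/eqP/matrixP => r k; rewrite !mxE ord1.
  pose d' x := C (enum_rank x) k.
  have hM (k' : option I) : \sum_x d' x * col k' x = 0.
    have := congr1 (fun B : 'M_(_, _) => B (enum_rank k') k) hC.
    rewrite !mxE => E; rewrite -[RHS]E.
    rewrite [RHS](reindex enum_rank (onW_bij _ (enum_rank_bij _))).
    by apply: eq_bigr => x _; rewrite !mxE !enum_rankK mulrC.
  have [|c hc] := @relation_unique d'.
    split; last by move=> i; exact: (hM (Some i)).
    by rewrite -[RHS](hM None); apply: eq_bigr => x _; rewrite mulr1.
  rewrite (reindex enum_rank (onW_bij _ (enum_rank_bij _))) /=.
  transitivity (c * \sum_x d x * phi x); last by rewrite h mulr0.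
  rewrite big_distrr; apply: eq_bigr => x _ /=.
  have -> : C (enum_rank x) k = c * d x by exact: hc.
  by rewrite mxE enum_rankK; ring.
case/submxP => B hB; exists (B 0 (enum_rank None)), (fun i => B 0 (enum_rank (Some i))).
move=> x; have := congr1 (fun B : 'rV_(_) => B 0 (enum_rank x)) hB.
rewrite !mxE enum_rankK => ->.
rewrite (reindex enum_rank (onW_bij _ (enum_rank_bij _))) /=.
rewrite (bigD1 None) //= !mxE !enum_rankK mulr1; congr (_ + _).
rewrite (reindex_omap Some id) /= => [|[]//].
rewrite (eq_bigl predT) => [|i]; last by rewrite /= eqxx.
by apply: eq_bigr => i _; rewrite !mxE !enum_rankK.
Qed.

Lemma moment_pairing (phi : U -> rat) : \sum_x d x * phi x = 0 ->
  exists G0 (G : I -> rat), (forall x, phi x = G0 + \sum_i G i * (z x i)%:~R) /\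
    forall i, \sum_x d x * (z x i)%:~R * phi x = 2 * half_moment i * G i.
Proof.
move=> h; have [G0 [G hG]] := functions_are_affine h; exists G0, G; split=> // l.
have [s0 s1] := d_rel.
under eq_bigr do rewrite hG mulrDr.
rewrite big_split /= -mulr_suml s1 mul0r add0r.
under eq_bigr do rewrite mulr_sumr.
rewrite exchange_big (bigD1 l) //= [X in _ + X]big1 => [|k kl].
  rewrite addr0 /half_moment mulrA mulfV // mul1r mulr_suml.
  by apply: eq_bigr => x _; rewrite expr2; ring.
transitivity (G k * \sum_x d x * (z x l)%:~R * (z x k)%:~R).
  by rewrite big_distrr; apply: eq_bigr => x _ /=; ring.
by rewrite (z_diag d_rel) 1?eq_sym // mulr0.
Qed.

Lemma sum_delta (f : U -> rat) q : \sum_x f x * (x == q)%:R = f q.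
Proof.
rewrite (bigD1 q) //= eqxx mulr1 big1 ?addr0 // => x /negPf->; by rewrite mulr0.
Qed.

(** Weighted by [d], its pairing with a function [f] is [f q - f p]; in particular it is orthogonal
    to [d]. *)
Definition dipole q p x : rat := (x == q)%:R / d q - (x == p)%:R / d p.

Lemma dipole_gradient q p : d q != 0 -> d p != 0 ->
  exists G : I -> rat,
    (forall x y, dipole q p x - dipole q p y =
       \sum_i G i * ((z x i)%:~R - (z y i)%:~R)) /\
    forall i, 2 * half_moment i * G i = (z q i)%:~R - (z p i)%:~R.
Proof.
move=> dq dp.
have sd (f : U -> rat) : \sum_x d x * f x * dipole q p x = f q - f p.
  rewrite /dipole; under eq_bigr do rewrite mulrBr !mulrA.
  rewrite big_split /= sumrN -!big_distrl /= !(sum_delta (fun x => d x * f x)).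
  by rewrite ![d _ * _]mulrC !mulfK.
have h0 : \sum_x d x * dipole q p x = 0.
  by rewrite -[RHS](subrr 1) -(sd (fun=> 1)); apply: eq_bigr => x _; rewrite mulr1.
have [G0 [G [hG hu]]] := moment_pairing h0; exists G; split.
  move=> x y; rewrite !hG opprD addrACA subrr add0r -sumrB.
  by apply: eq_bigr => i _; rewrite mulrBr.
by move=> i; rewrite -hu (sd (fun x => (z x i)%:~R)).
Qed.

Lemma half_moment0_const i x y : half_moment i = 0 -> d x != 0 -> d y != 0 ->
  z x i = z y i.
Proof.
move=> ui dx dy; have [G [_ h]] := dipole_gradient dx dy.
by apply/eqP; move: (h i); rewrite ui mulr0 mul0r => /esym/eqP; rewrite subr_eq0 eqr_int.
Qed.

(** If only [a] and [b] occurred on the support, the product of [z_i - a] and [z_i - b] would have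
    pairing 0 with [d]; but this pairing is [2 * half_moment i], because [d] kills affine
    functions. *)
Lemma half_moment_values i (a b : int) : half_moment i != 0 ->
  exists x, [/\ d x != 0, z x i != a & z x i != b].
Proof.
move=> ui.
suff /existsP[x /and3P h] : [exists x, [&& d x != 0, z x i != a & z x i != b]].
  by exists x.
apply: contraT; rewrite negb_exists => /forallP h.
case/eqP: ui; have [s0 s1] := d_rel.
suff: \sum_x d x * ((z x i)%:~R - a%:~R) * ((z x i)%:~R - b%:~R) = 0.
  rewrite (eq_bigr (fun x => d x * (z x i)%:~R ^+ 2 -
     (a%:~R + b%:~R) * (d x * (z x i)%:~R) + a%:~R * b%:~R * d x)); last first.
    by move=> x _; ring.
  rewrite big_split big_split /= sumrN -!big_distrr /= s0 s1 !mulr0 subr0 addr0.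
  by rewrite /half_moment => ->; rewrite mulr0.
apply: big1 => x _; have := h x.
case: eqP => [->|_]; first by rewrite !mul0r.
case: eqP => [->|_]; first by rewrite subrr mulr0 mul0r.
by case: eqP => [->|//]; rewrite subrr mulr0.
Qed.

Definition support := [set x | d x != 0].
Definition used := [set i | [exists x, exists y, z x i != z y i]].
Definition essential := [set i | half_moment i != 0].

(** The relations form the kernel of a matrix with one column for the constants and one for each
    used coordinate, and this kernel has dimension at most 1. *)
Lemma card_used : (#|U| <= #|used| + 2)%N.
Proof.
pose r := #|used|.
pose M : 'M[rat]_(#|U|, 1 + r) := \matrix_(x, k)
  match split k with inl _ => 1 | inr k => (z (enum_val x) (enum_val k))%:~R end.
pose D := \row_(x < #|U|) d (enum_val x).
have : (kermx M <= D)%MS.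
  apply/row_subP => k; set R := row k _.
  have hR : R *m M = 0 by rewrite -row_mul mulmx_ker row0.
  pose d' x := R 0 (enum_rank x).
  have hk (k' : 'I_(1 + r)) : \sum_x d' x *
      match split k' with inl _ => 1 | inr k => (z x (enum_val k))%:~R end = 0.
    have := congr1 (fun B : 'M_(_, _) => B 0 k') hR; rewrite [LHS]mxE [RHS]mxE => E.
    rewrite -[RHS]E [RHS](reindex enum_rank (onW_bij _ (enum_rank_bij _))).
    by apply: eq_bigr => x _; rewrite [M _ _]mxE enum_rankK.
  have r0 : \sum_x d' x = 0.
    rewrite -[RHS](hk (lshift r 0)); apply: eq_bigr => x _.
    by rewrite (unsplitK (inl 0)) mulr1.
  have [|c hc] := @relation_unique d'.
    split=> // i; case iu: (i \in used).
      rewrite -[RHS](hk (rshift 1 (enum_rank_in iu i))); apply: eq_bigr => x _.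
      by rewrite (unsplitK (inr _)) enum_rankK_in.
    have [x0 _] := d_neq0.
    under eq_bigr => x _.
      rewrite (_ : z x i = z x0 i); last first.
        apply/eqP; apply: contraFT iu => h; rewrite inE.
        by apply/existsP; exists x; apply/existsP; exists x0.
    over.
    by rewrite -big_distrl /= r0 mul0r.
  apply/submxP; exists c%:M; apply/rowP => x.
  have := hc (enum_val x); rewrite /d' enum_valK => ->.
  by rewrite mul_scalar_mx !mxE.
move/mxrankS; rewrite mxrank_ker => h.
have := leq_trans h (rank_leq_row D); have := rank_leq_col M.
move: (\rank M); rewrite /r; move: #|U| #|used| => a b c; lia.
Qed.

(** On the support, the constant and the essential coordinates are linearly independent: pairing
    through [d] is diagonal with nonzero entries on the essential ones. All these functions are
    orthogonal to the nonzero vector [d], which costs one more dimension. *)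
Lemma card_essential : (#|essential| + 2 <= #|support|)%N.
Proof.
set r := #|essential|; set s := #|support|.
pose M : 'M[rat]_(1 + r, s) := \matrix_(k, x)
  match split k with inl _ => 1 | inr k => (z (enum_val x) (enum_val k))%:~R end.
pose D := \col_(x < s) d (enum_val x).
have [s0 s1] := d_rel; have [x0 dx0] := d_neq0.
have sumS (f : U -> rat) : (\sum_(x < s) d (enum_val x) * f (enum_val x) = \sum_x d x * f x).
  rewrite [RHS](bigID (mem support)) /= [X in _ + X]big1 ?addr0.
    by rewrite [RHS]big_enum_val.
  by move=> x; rewrite inE negbK => /eqP->; rewrite mul0r.
have MD : M *m D = 0.
  apply/matrixP => k l; rewrite !mxE.
  under eq_bigr do rewrite !mxE mulrC.
  case: (split k) => k'.
    rewrite (sumS (fun=> 1)); under eq_bigr do rewrite mulr1; exact: s0.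
  by rewrite (sumS (fun x => (z x (enum_val k'))%:~R)) s1.
have rD : \rank D = 1%N.
  apply/eqP; rewrite eqn_leq rank_leq_col lt0n mxrank_eq0.
  have x0S : x0 \in support by rewrite inE.
  apply: contra dx0 => /eqP/colP/(_ (enum_rank_in x0S x0)).
  by rewrite !mxE enum_rankK_in // => ->.
have rM : \rank M = (1 + r)%N.
  apply/eqP; rewrite -[_ == _]/(row_free M) -kermx_eq0; apply/rowV0P => B.
  move/sub_kermxP => BM.
  pose f x : rat := B 0 (lshift r 0) + \sum_(k < r) B 0 (rshift 1 k) * (z x (enum_val k))%:~R.
  have f0 (x : 'I_s) : f (enum_val x) = 0.
    have := congr1 (fun C : 'M_(_, _) => C 0 x) BM.
    rewrite [LHS]mxE [RHS]mxE big_split_ord /= big_ord1 !mxE (unsplitK (inl 0)) mulr1.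
    move=> <-; congr (_ + _); apply: eq_bigr => k _.
    by rewrite !mxE (unsplitK (inr _)).
  have fS x : d x * f x = 0.
    have [->|dx] := eqVneq (d x) 0; first by rewrite mul0r.
    have xS : x \in support by rewrite inE.
    by rewrite -(enum_rankK_in xS xS) f0 mulr0.
  have Br k : B 0 (rshift 1 k) = 0.
    have: \sum_x d x * f x * (z x (enum_val k))%:~R = 0.
      by apply: big1 => x _; rewrite fS mul0r.
    rewrite /f; under eq_bigr do rewrite mulrDr mulrDl mulr_sumr mulr_suml.
    rewrite big_split /= exchange_big /=.
    rewrite (bigD1 k) //= [X in _ + (_ + X)]big1 => [|l lk].
      have -> : \sum_x d x * B 0 (lshift r 0) * (z x (enum_val k))%:~R = 0.
        under eq_bigr do rewrite mulrAC.
        by rewrite -big_distrl /= s1 mul0r.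
      rewrite add0r addr0.
      rewrite (eq_bigr (fun x => B 0 (rshift 1 k) *
        (d x * (z x (enum_val k))%:~R ^+ 2))) => [|x _]; last by ring.
      rewrite -big_distrr /= => /eqP; rewrite mulf_eq0 => /orP[/eqP //|/eqP h].
      have := enum_valP k; rewrite inE /half_moment h mulr0 eqxx //.
    rewrite (eq_bigr (fun x => B 0 (rshift 1 l) *
        (d x * (z x (enum_val l))%:~R * (z x (enum_val k))%:~R))) => [|x _]; last by ring.
    by rewrite -big_distrr /= (z_diag d_rel) ?mulr0 // (inj_eq enum_val_inj).
  apply/rowP => k; rewrite mxE -[k]splitK; case: (split k) => k' /=; last exact: Br.
  have : f x0 = 0.
    by have := fS x0 => /eqP; rewrite mulf_eq0 (negPf dx0) => /eqP.
  rewrite /f big1 => [|l _]; last by rewrite Br mul0r.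
  by rewrite addr0 ord1.
have := mulmx0_rank_max MD; rewrite rM rD; lia.
Qed.

Hypothesis z_even : forall x, exists k, \sum_i z x i = 2 * k.
Hypothesis z_no2 : forall x y i, changed x y = [set i] ->
  (`|z x i - z y i| != 2)%N.

(** The distance is even by [z_even]. Distance 2 means either adjacency or one coordinate changed by
    2, which [z_no2] forbids. *)
Lemma dist_far x y : x != y -> ~~ adjacent x y ->
  (4 <= \sum_i `|z x i - z y i|)%N.
Proof.
move=> xy nadj; set D := (\sum_i _)%N.
have [k hk] : exists k, D%:Z = 2 * k.
  have [kx ex] := z_even x; have [ky ey] := z_even y.
  exists (kx - ky + \sum_i (if z x i < z y i then z y i - z x i else 0)).
  rewrite mulrDr mulrBr -ex -ey -sumrB mulr_sumr -big_split /=.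
  rewrite /D (big_morph Posz PoszD (erefl _)); apply: eq_bigr => i _.
  by case: ltP => h; lia.
have D0 : D != 0%N.
  apply: contra xy; rewrite sum_nat_eq0 => /forallP h; apply/eqP/z_inj => i.
  by have := h i; rewrite absz_eq0 subr_eq0 => /eqP.
have D2 : D != 2%N.
  apply/eqP => eD; case: (altP (@forallP _ (fun i => `|z x i - z y i| <= 1)%N)) => [hi|h].
    case/negP: nadj; rewrite /adjacent; apply/andP; split; last exact/forallP.
    rewrite -eD /D -sum1_card big_mkcond /=; apply/eqP/eq_bigr => i _.
    rewrite inE; have := hi i; case: eqP => [->|/eqP]; first by rewrite subrr.
    by rewrite -subr_eq0 -absz_eq0; case: (`|_|%N) => [|[|]].
  case/forallPn: h => i; rewrite -ltnNge => hi.
  move: eD; rewrite /D (bigD1 i) //= => eD.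
  have h2 : (`|z x i - z y i| = 2)%N by lia.
  have h0 : (\sum_(j | j != i) `|z x j - z y j| = 0)%N by lia.
  suff /z_no2 : changed x y = [set i] by rewrite h2.
  apply/setP => j; rewrite !inE; have [->|ji] := eqVneq j i.
    by apply/negP => /eqP e; move: h2; rewrite e subrr.
  apply/negbTE; rewrite negbK -subr_eq0 -absz_eq0.
  by move/eqP: h0; rewrite sum_nat_eq0 => /forall_inP/(_ j ji).
lia.
Qed.

Definition essential_dist x y := (\sum_(i in essential) `|z x i - z y i|)%N.

Lemma essential_distC x y : essential_dist x y = essential_dist y x.
Proof. by apply: eq_bigr => i _; rewrite distnC. Qed.

Lemma essential_dist_tri y x w :
  (essential_dist x w <= essential_dist x y + essential_dist y w)%N.
Proof. by rewrite -big_split; apply: leq_sum => i _; apply: leqD_dist. Qed.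

(** Inessential coordinates are constant on the support, so there the essential distance is the full
    distance. *)
Lemma support_far x y : x \in support -> y \in support -> x != y ->
  ~~ adjacent x y -> (4 <= essential_dist x y)%N.
Proof.
rewrite !inE => dx dy xy nadj; have := dist_far xy nadj.
rewrite (bigID (mem essential)) /= [X in (_ + X)%N]big1 ?addn0 // => i.
by rewrite inE negbK => /eqP ui; rewrite (half_moment0_const ui dx dy) subrr.
Qed.

Lemma essential_used : essential \subset used.
Proof.
apply/subsetP => i; rewrite !inE => ui; have [x0 _] := d_neq0.
have [x [_ h _]] := half_moment_values (z x0 i) 0 ui.
by apply/existsP; exists x; apply/existsP; exists x0.
Qed.

Lemma changed_used x y : changed x y \subset used.
Proof.
apply/subsetP => i; rewrite !inE => h.
by apply/existsP; exists x; apply/existsP; exists y.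
Qed.

(** * Adjacency clusters of the support *)

Definition support_adj x y := [&& x \in support, y \in support & adjacent x y].
(** Points outside the support are isolated for [support_adj], so each of them is a class of its
    own. *)
Definition cluster := fingraph.root support_adj.
Definition clusters := [set cluster x | x in support].

Lemma cluster_sym : connect_sym support_adj.
Proof.
apply: sym_connect_sym => x y.
by rewrite /support_adj adjacentC; case: (x \in _); case: (y \in _).
Qed.

Lemma cluster_connect x y : (cluster x == cluster y) = connect support_adj x y.
Proof. exact: root_connect cluster_sym _ _. Qed.

Lemma cluster_eq x y : cluster x = cluster y ->
  x = y \/ x \in support /\ y \in support.
Proof.
have aux a b : connect support_adj a b -> a = b \/ a \in support.
  case/connectP => -[|w p] /=; first by left.
  by case/andP => /and3P[]; right.
move=> /eqP; rewrite cluster_connect => xy.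
have [|xS] := aux _ _ xy; first by left.
rewrite cluster_sym in xy.
by have [->|yS] := aux _ _ xy; [left | right].
Qed.

Definition saturated P := forall x y, cluster x = cluster y -> (x \in P) = (y \in P).

Lemma saturated_closed P :
  (forall x y, x \in P -> x \in support -> y \in support ->
     adjacent x y -> y \in P) -> saturated P.
Proof.
move=> h x y /eqP; rewrite cluster_connect; apply: closed_connect => a b.
case/and3P => aS bS ab; apply/idP/idP => [aP|bP]; first exact: (h a).
by apply: (h b) => //; rewrite adjacentC.
Qed.

Lemma ex_cluster_spanning : exists F,
  [/\ (size F).+1 = (#|clusters| + #|~: support|)%N,
    all (fun e => adjacent e.1 e.2) F & spans cluster F].
Proof.
have [x0 _] := d_neq0.
have [|F [sF aF sp]] := @spanning U adjacent U cluster x0.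
  move=> P /andP[P0 PT]; have [x [y [xP yP xy]]] := z_conn (subsetT P) P0 PT.
  by exists x, y; rewrite !inE andbT in yP.
exists F; split=> //; rewrite sF -[[set: U]](setUCr support) imsetU cardsU.
have e : [set cluster x | x in ~: support] = ~: support.
  have fix_ x : x \notin support -> cluster x = x.
    move=> xS; have e : cluster (cluster x) = cluster x := root_root cluster_sym x.
    by case: (cluster_eq e) => [//|[_]]; rewrite (negPf xS).
  apply/setP => x; apply/imsetP/idP => [[y]|].
    by rewrite inE => yS ->; rewrite fix_ // inE.
  by rewrite inE => xS; exists x; [rewrite inE | rewrite fix_].
rewrite e (_ : _ :&: _ = set0) ?cards0 ?subn0 //.
apply/setP => x; rewrite !inE; apply/negbTE/negP => /andP[/imsetP[y yS ->]].
have : cluster (cluster y) = cluster y by apply: (root_root cluster_sym).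
case/cluster_eq => [->|[h _]]; last by move: h; rewrite inE => ->.
by move: yS; rewrite inE => ->.
Qed.

(** Let [R] be the set where the coordinate leaves its common value on the support. If only one edge
    crossed [R], its complement would be a proper connected set containing the support, against
    minimality. *)
Lemma two_changes F i : all (fun e => adjacent e.1 e.2) F -> spans cluster F ->
  i \in used -> half_moment i = 0 ->
  (2 <= count (fun e => z e.1 i != z e.2 i) F)%N.
Proof.
move=> aF sp iu ui; have [x0 dx0] := d_neq0.
pose R := [set x | z x i != z x0 i].
have RS x : x \in R -> d x = 0.
  by rewrite inE => h; apply/eqP; apply: contraNT h => dx; rewrite (half_moment0_const ui dx dx0).
have RnS x : x \in R -> x \notin support by move=> /RS h; rewrite inE h eqxx.
have x0R : x0 \notin R by rewrite inE eqxx.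
have link_adj x y : link F x y -> adjacent x y.
  by case/orP => /(allP aF) //=; rewrite adjacentC.
apply: (@leq_trans (cut_size F R)); last first.
  apply: sub_count => e; rewrite /crossing !inE.
  by apply: contra => /eqP ->.
have satR : saturated R.
  move=> x y /cluster_eq[->//|[xS yS]].
  by rewrite !(contraTF (@RnS _)) // ?xS ?yS.
have pR : proper_part R.
  apply/andP; split; last by apply: contraNneq x0R => ->.
  move: iu; rewrite inE => /existsP[x /existsP[y xy]].
  apply/set0Pn; have [e|] := eqVneq (z x i) (z x0 i); last by exists x; rewrite inE.
  by exists y; rewrite inE -e eq_sym.
have := sp R satR pR; rewrite leq_eqVlt => /orP[/eqP c1|//]; exfalso.
have [a [b [aR bR ab]]] : exists a b, [/\ a \in R, b \notin R & link F a b].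
  by apply: cut_link; rewrite -c1.
pose A := ~: R.
have nA : A != [set: U] by apply: contraTneq aR => e; rewrite -[R]setCK -/A e !inE.
suff cA : connected A.
  by have [x + dx] := no_small_support cA nA; rewrite inE negbK => /RS/eqP; rewrite (negPf dx).
have bA : b \in A by rewrite inE.
(* A part of [A] avoiding [b] cannot be left through the only edge into [R], since that edge starts
   at [b]. Parts containing [b] are treated through their complements in [A]. *)
have half P : P \subset A -> P != set0 -> b \notin P -> exists x y,
    [/\ x \in P, y \in A :\: P & adjacent x y].
  move=> PA P0 bP.
  case: (boolP [exists x in P, exists y in A :\: P, adjacent x y]).
    by case/exists_inP => x xP /exists_inP[y yP xy]; exists x, y.
  move=> h; have nxt x y : x \in P -> y \in A -> adjacent x y -> y \in P.
    move=> xP yA xy; apply: contraNT h => yP; apply/exists_inP; exists x => //.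
    by apply/exists_inP; exists y => //; rewrite inE yP.
  have satP : saturated P.
    apply: saturated_closed => x y xP _ yS; apply: nxt => //.
    by rewrite inE; apply: contraTN yS; apply: RnS.
  have pP : proper_part P by rewrite /proper_part P0; apply: contraNneq bP => ->.
  have [x [y [xP yP xy]]] := cut_link (sp P satP pP).
  case yR: (y \in R); last first.
    by case/negP: yP; apply: nxt xP _ (link_adj _ _ xy); rewrite inE yR.
  have xR : x \notin R by have := subsetP PA _ xP; rewrite inE.
  rewrite linkC in xy.
  by have [_ e] := cut1_uniq (esym c1) aR bR ab yR xR xy; rewrite e xP in bP.
move=> P PA P0 PnA; case: (boolP (b \in P)) => [bP|]; last exact: half.
have [|||x [y [xQ yQ xy]]] := half (A :\: P).
- exact: subsetDl.
- by apply: contra PnA => /eqP h; rewrite eqEsubset PA -setD_eq0 h eqxx.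
- by rewrite inE bP.
exists y, x; split=> //; last by rewrite adjacentC.
by move: yQ; rewrite !inE; case: (y \in P) => //=; case: (z y i == _).
Qed.

Lemma cluster_far x y : x \in support -> y \in support ->
  cluster x != cluster y -> (4 <= essential_dist x y)%N.
Proof.
move=> xS yS xy; apply: support_far => //; first by apply: contraNneq xy => ->.
apply: contra xy => xy; rewrite cluster_connect; apply: connect1.
by rewrite /support_adj xS yS.
Qed.

Definition cluster_ball r a := [set x | [exists s,
  [&& s \in support, cluster s == a & (essential_dist x s <= r)%N]]].

Lemma cluster_ballP r a x : reflect
  (exists s, [/\ s \in support, cluster s = a & (essential_dist x s <= r)%N])
  (x \in cluster_ball r a).
Proof.
rewrite inE; apply: (iffP existsP) => -[s].
  by case/and3P => sS /eqP sa sr; exists s.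
by case=> sS sa sr; exists s; rewrite sS sa eqxx.
Qed.

Lemma cluster_ball_support r a x : (r <= 1)%N -> x \in support ->
  (x \in cluster_ball r a) = (cluster x == a).
Proof.
move=> r1 xS; apply/cluster_ballP/eqP => [[s [sS <- sr]]|<-].
  apply/eqP; apply: contraLR sr => /(cluster_far xS sS); lia.
by exists x; split=> //; rewrite /essential_dist big1 // => i _; rewrite subrr.
Qed.

Lemma cluster_ball_saturated r a : (r <= 1)%N -> saturated (cluster_ball r a).
Proof.
move=> r1 x y e; case: (cluster_eq e) => [->//|[xS yS]].
by rewrite !cluster_ball_support ?e.
Qed.

Lemma cluster_ball_uniq a b x :
  x \in cluster_ball 1 a -> x \in cluster_ball 1 b -> a = b.
Proof.
case/cluster_ballP => s [sS <- xs] /cluster_ballP[t [tS <- xt]].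
apply/eqP; apply: contraLR xs => /(cluster_far sS tS).
have := essential_dist_tri x s t; rewrite [essential_dist s x]essential_distC; lia.
Qed.

(** Each crossing costs one unit of essential length: the two balls of a cluster are nested with
    radii 0 and 1, and passing from a ball of radius [r] around one cluster to a ball of radius [r']
    around another takes length at least [4 - r - r']. Balls of radius 1 around different clusters
    being disjoint, at most two clusters are concerned. *)
Lemma cluster_ball_crossings x y :
  (\sum_(a in clusters) (crossing (cluster_ball 0 a) (x, y) +
      crossing (cluster_ball 1 a) (x, y)) <= essential_dist x y)%N.
Proof.
set D := essential_dist x y; pose c a :=
  (crossing (cluster_ball 0 a) (x, y) + crossing (cluster_ball 1 a) (x, y))%N.
have b01 a w : w \in cluster_ball 0 a -> w \in cluster_ball 1 a.
  by move=> /cluster_ballP[s [sS sa s0]]; apply/cluster_ballP; exists s; split=> //; lia.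
have triS w w' r a k : (essential_dist w w' <= k)%N -> w \in cluster_ball r a ->
    w' \in cluster_ball (r + k) a.
  move=> wk /cluster_ballP[s [sS sa sr]]; apply/cluster_ballP; exists s; split=> //.
  have := essential_dist_tri w w' s; rewrite [essential_dist w' w]essential_distC; lia.
have Dyx : essential_dist y x = D by apply: essential_distC.
have far a b r r' : a != b -> x \in cluster_ball r a -> y \in cluster_ball r' b ->
    (4 <= D + r + r')%N.
  move=> ab /cluster_ballP[s [sS sa sr]] /cluster_ballP[t [tS tb tr]].
  have := cluster_far sS tS; rewrite sa tb => /(_ ab).
  have := essential_dist_tri x s t; have := essential_dist_tri y x t.
  rewrite [essential_dist s x]essential_distC -/D; lia.
have c0 a : x \notin cluster_ball 1 a -> y \notin cluster_ball 1 a -> c a = 0%N.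
  move=> xa ya; have x0 := contra (@b01 a x) xa; have y0 := contra (@b01 a y) ya.
  by rewrite /c /crossing /= (negPf x0) (negPf y0) (negPf xa) (negPf ya).
have cD a : (c a <= D)%N.
  case: (ltnP 1 D) => D1; first by rewrite (leq_trans _ D1) // /c; do 2!case: crossing.
  have h w w' r : essential_dist w w' = D -> w \in cluster_ball r a ->
      w' \in cluster_ball (r + D) a by move=> e; apply: triS; rewrite e.
  move: D1 (h x y 0%N erefl) (h y x 0%N Dyx) (h x y 1%N erefl) (h y x 1%N Dyx) (b01 a x) (b01 a y).
  rewrite /c /crossing /=; case: (D) => [|[|//]] _ /=;
  case: (x \in cluster_ball 0 a); case: (y \in cluster_ball 0 a);
  case: (x \in cluster_ball 1 a); case: (y \in cluster_ball 1 a) => //= h1 h2 h3 h4 h5 h6;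
  rewrite ?(h1 isT) ?(h2 isT) //; try (by have := h1 isT); try (by have := h2 isT);
  try (by have := h3 isT); try (by have := h4 isT); try (by have := h5 isT); try (by have := h6 isT).
have c2 a b : a != b -> x \in cluster_ball 1 a -> y \in cluster_ball 1 b ->
    (c a + c b <= D)%N.
  move=> ab xa yb.
  have xb : x \in cluster_ball 1 b = false.
    by apply: contra_neqF ab => xb; apply: cluster_ball_uniq xa xb.
  have ya : y \in cluster_ball 1 a = false.
    by apply: contra_neqF ab => ya; apply: cluster_ball_uniq ya yb.
  have xb0 : x \in cluster_ball 0 b = false by apply: contraFF xb; apply: b01.
  have ya0 : y \in cluster_ball 0 a = false by apply: contraFF ya; apply: b01.
  have := far _ _ 1%N 1%N ab xa yb; have := far _ _ 0%N 1%N ab; have := far _ _ 1%N 0%N ab.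
  have := far _ _ 0%N 0%N ab.
  rewrite /c /crossing /= xa yb xb ya xb0 ya0.
  case: (x \in cluster_ball 0 a); case: (y \in cluster_ball 0 b) => /= h1 h2 h3 h4;
    [have := h1 isT isT | have := h3 isT isT | have := h2 isT isT |]; lia.
apply: (@leq_trans (\sum_a c a)).
  by rewrite [leqRHS](bigID (mem clusters)) /= leq_addr.
case: (pickP (fun a => x \in cluster_ball 1 a)) => [a xa|nx];
case: (pickP (fun b => y \in cluster_ball 1 b)) => [b yb|ny].
- have [eab|ab] := eqVneq a b.
    rewrite (bigD1 a) //= big1 ?addn0 // => k ka; apply: c0; apply: contraNN ka => h.
      by apply/eqP; apply: cluster_ball_uniq h xa.
    by rewrite eab; apply/eqP; apply: cluster_ball_uniq h yb.
  rewrite (bigD1 a) //= (bigD1 b) 1?eq_sym //= big1 ?addn0 => [|k /andP[ka kb]].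
    exact: c2.
  apply: c0; [apply: contraNN ka | apply: contraNN kb] => h; apply/eqP;
    [exact: cluster_ball_uniq h xa | exact: cluster_ball_uniq h yb].
- rewrite (bigD1 a) //= big1 ?addn0 // => k ka; apply: c0; last by rewrite ny.
  by apply: contraNN ka => h; apply/eqP; apply: cluster_ball_uniq h xa.
- rewrite (bigD1 b) //= big1 ?addn0 // => k kb; apply: c0; first by rewrite nx.
  by apply: contraNN kb => h; apply/eqP; apply: cluster_ball_uniq h yb.
by rewrite big1 // => k _; apply: c0; rewrite ?nx ?ny.
Qed.

(** With at most one cluster, the support would itself be a proper connected set carrying [d]. *)
Lemma two_clusters : support != [set: U] -> (1 < #|clusters|)%N.
Proof.
move=> nS; rewrite ltnNge; apply/negP => c1.
have cS : connected support.
  move=> P PS P0 PnS.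
  case: (boolP [exists x in P, exists y in support :\: P, adjacent x y]).
    by case/exists_inP => x xP /exists_inP[y yP xy]; exists x, y.
  move=> h; have satP : saturated P.
    apply: saturated_closed => x y xP _ yS xy; apply: contraNT h => yP.
    by apply/exists_inP; exists x => //; apply/exists_inP; exists y; rewrite // inE yP.
  case/set0Pn: P0 => x xP; case/negP: PnS; rewrite eqEsubset PS.
  apply/subsetP => y yS; rewrite -(satP x y) //.
  move: c1 => /card_le1_eqP; apply; apply: imset_f => //; exact: (subsetP PS).
by have [x + dx] := no_small_support cS nS; rewrite inE dx.
Qed.

Lemma adjacent_essential x y : adjacent x y ->
  (essential_dist x y = #|changed x y :&: essential|)%N.
Proof.
move=> xy; rewrite -sum1_card /essential_dist big_mkcond [RHS]big_mkcond.
apply: eq_bigr => i _; rewrite !inE; have := adjacent_le1 i xy.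
case: (z x i =P z y i) => [->|/eqP h] /=; first by rewrite subrr; case: (_ == _).
by rewrite -subr_eq0 -absz_eq0 in h; case: (`|_|%N) h => [|[|]] //; case: (_ == _).
Qed.

Lemma adjacent_split x y : adjacent x y ->
  (essential_dist x y + #|changed x y :&: (used :\: essential)| = 2)%N.
Proof.
move=> xy; rewrite (adjacent_essential xy); have /andP[/eqP <- _] := xy.
rewrite -(cardsID essential (changed x y)); congr (_ + _)%N.
by rewrite setIDA (setIidPl (changed_used x y)).
Qed.

(* Otherwise the adjacency clusters of the support number at least two.  Each
   inessential coordinate changes twice along a spanning tree of the clusters,
   which leaves few changes of essential coordinates, while the disjoint balls
   of radius 0 and 1 around the clusters must all be crossed. *)
Lemma support_full : support = [set: U].
Proof.
apply/eqP; apply: contraT => nS; have c1 := two_clusters nS.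
have [F [sF aF sp]] := ex_cluster_spanning.
pose L := used :\: essential.
have upper : (\sum_(e <- F) essential_dist e.1 e.2 + 2 * #|L| <= 2 * size F)%N.
  have -> : (2 * size F = \sum_(e <- F) (essential_dist e.1 e.2 + #|changed e.1 e.2 :&: L|))%N.
    elim: (F) aF => [|e F' IH] /=; first by rewrite big_nil.
    by case/andP=> /adjacent_split h /IH e2; rewrite big_cons /L h mulnS e2.
  rewrite big_split /= leq_add2l.
  have -> : (\sum_(e <- F) #|changed e.1 e.2 :&: L| =
             \sum_(i in L) \sum_(e <- F) (z e.1 i != z e.2 i))%N.
    rewrite [RHS]exchange_big /=; apply: eq_bigr => e _.
    rewrite -sum1_card big_mkcond [RHS]big_mkcond; apply: eq_bigr => i _.
    by rewrite in_setI andbC; case: (i \in L); rewrite //= inE; case: (_ == _).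
  rewrite mulnC -sum_nat_const; apply: leq_sum => i.
  rewrite !inE negbK => /andP[/eqP ui iu].
  have := two_changes aF sp _ ui; rewrite inE => /(_ iu).
  by rewrite -sum1_count big_mkcond /=; under eq_bigr do rewrite -mulnbl ?muln1 //.
have lower : (2 * #|clusters| <= \sum_(e <- F) essential_dist e.1 e.2)%N.
  apply: (@leq_trans (\sum_(e <- F) \sum_(a in clusters)
      (crossing (cluster_ball 0 a) e + crossing (cluster_ball 1 a) e))).
    rewrite exchange_big /= mulnC -sum_nat_const; apply: leq_sum => a aC.
    have cut r : (r <= 1)%N -> (1 <= \sum_(e <- F) crossing (cluster_ball r a) e)%N.
      move=> r1; rewrite -[leqRHS]/(\sum_(e <- F) _)%N.
      have <- : cut_size F (cluster_ball r a) = (\sum_(e <- F) crossing (cluster_ball r a) e)%N.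
        by rewrite /cut_size; elim: (F) => [|e F' IH]; rewrite ?big_nil // big_cons -IH.
      apply: sp; first exact: cluster_ball_saturated.
      apply/andP; split.
        case/imsetP: aC => s sS ->; apply/set0Pn; exists s.
        by rewrite cluster_ball_support.
      case/card_gt1P: c1 => b [b' [/imsetP[s sS ->] /imsetP[s' sS' ->] ss']].
      apply/eqP => e; case/negP: ss'.
      have : s \in [set: U] by []. have : s' \in [set: U] by [].
      by rewrite -e !cluster_ball_support // => /eqP -> /eqP ->.
    by rewrite big_split /=; apply: (leq_add (cut 0%N _) (cut 1%N _)).
  by apply: leq_sum => -[x y] _; apply: cluster_ball_crossings.
(* [upper] and [lower] give [#|L| < #|~: support|], whereas [card_used] and [card_essential]
   together give [#|~: support| <= #|L|]. *)
have e1 : (#|used| = #|essential| + #|L|)%N.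
  by rewrite -(cardsID essential used) (setIidPr essential_used).
have := card_used; have := card_essential; have := cardsC support.
move: upper lower sF e1; set D := (\sum_(e <- F) _)%N.
by move: (size F) D #|L| #|used| #|essential| #|clusters| #|support| #|~: support| #|U|; lia.
Qed.

Lemma d_all x : d x != 0.
Proof. by have : x \in [set: U] by []; rewrite -support_full inE. Qed.

Lemma used_half_moment i : i \in used -> half_moment i != 0.
Proof.
rewrite inE => /existsP[x /existsP[y xy]]; apply: contra xy => /eqP ui.
by apply/eqP; apply: (half_moment0_const ui); apply: d_all.
Qed.

(** * Spanning trees and the degrees of the coordinates *)

Section Tree.
Variable F : seq (U * U).
Hypothesis sF : (size F).+1 = #|U|.
Hypothesis aF : all (fun e => adjacent e.1 e.2) F.
Hypothesis spF : spans id F.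

Definition degree i := count (fun e => z e.1 i != z e.2 i) F.

Lemma link_adjacent x y : link F x y -> adjacent x y.
Proof. by case/orP => /(allP aF) //=; rewrite adjacentC. Qed.

Lemma exit_edge P x y : x \in P -> y \notin P ->
  exists a b, [/\ a \in P, b \notin P & link F a b].
Proof.
move=> xP yP; apply/cut_link/spF => [u v ->//|]; apply/andP; split.
  by apply/set0Pn; exists x.
by apply: contraNneq yP => ->.
Qed.

Lemma cut_sizeE P : cut_size F P = (\sum_(e <- F) crossing P e)%N.
Proof. by rewrite /cut_size; elim: (F) => [|e F' IH]; rewrite ?big_nil // big_cons -IH. Qed.

Lemma degreeE i : degree i = (\sum_(e <- F) (z e.1 i != z e.2 i))%N.
Proof. by rewrite /degree; elim: (F) => [|e F' IH]; rewrite ?big_nil // big_cons -IH. Qed.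

Definition level i (c : int) := [set x | z x i == c].
Definition below i (c : int) := [set x | z x i <= c].

(** Along an edge the coordinate changes by at most 1, so the edge crosses at most one of the
    sublevel sets. *)
Lemma degree_below i (s : seq int) : uniq s ->
  (\sum_(c <- s) cut_size F (below i c) <= degree i)%N.
Proof.
move=> us; under eq_bigr do rewrite cut_sizeE.
rewrite exchange_big degreeE /=; elim: F aF => [|e F' IH] /=; first by rewrite !big_nil.
case/andP=> /(adjacent_le1 i) le1 /IH h; rewrite !big_cons leq_add // {IH h}.
pose c := Num.min (z e.1 i) (z e.2 i).
have hc c' : crossing (below i c') e -> c' = c /\ z e.1 i != z e.2 i.
  by rewrite /crossing !inE /c; move: (z e.1 i) (z e.2 i) le1 => a b; lia.
have [e12|n12] := eqVneq (z e.1 i) (z e.2 i).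
  by rewrite big1 // => c' _; apply/eqP; rewrite eqb0; apply/negP => /hc[_]; rewrite e12 eqxx.
apply: (@leq_trans (\sum_(c' <- s) (c' == c))%N).
  by apply: leq_sum => c' _; case X: crossing => //; case/hc: X => -> _; rewrite eqxx.
have <- : count (pred1 c) s = (\sum_(c' <- s) (c' == c))%N.
  by elim: (s) => [|a s' IH]; rewrite ?big_nil // big_cons -IH.
by rewrite count_uniq_mem // leq_b1.
Qed.

Lemma below_cut i c x y : z x i <= c -> c < z y i -> (0 < cut_size F (below i c))%N.
Proof.
move=> xc cy; have [||a [b [aP bP ab]]] := @exit_edge (below i c) x y.
- by rewrite inE.
- by rewrite inE -ltNge.
exact: link_cut aP bP ab.
Qed.

(** With [c] and [c + 1] as the only values, the half moment would vanish. *)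
Lemma levels i : i \in used -> exists c, [/\ (exists x, z x i = c),
  exists y, c + 2 <= z y i & forall x, c <= z x i].
Proof.
move=> /used_half_moment ui; have [x0 _] := d_neq0.
have [x _ xmin] := @Order.TotalTheory.arg_minP _ _ U x0 xpredT (z^~ i) isT.
exists (z x i); split; [by exists x | | by move=> y; apply: xmin].
have [y [_ y1 y2]] := half_moment_values (z x i) (z x i + 1) ui.
by exists y; have := xmin y isT; lia.
Qed.

Lemma degree_ge2 i : i \in used -> (2 <= degree i)%N.
Proof.
case/levels => c [[x xc] [y yc] h].
have := @degree_below i [:: c; c + 1]; rewrite !big_cons big_nil addn0 /= inE.
have h1 : (0 < cut_size F (below i c))%N by apply: (@below_cut _ _ x y); lia.
have h2 : (0 < cut_size F (below i (c + 1)))%N by apply: (@below_cut _ _ x y); lia.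
have -> : (c != c + 1) && true by lia.
by move=> /(_ isT); lia.
Qed.

(** A value above [c + 2] would give three sublevel sets that are crossed, more than the degree
    allows; with two of them, each is crossed exactly once. *)
Lemma degree2_levels i : i \in used -> degree i = 2%N -> exists c,
  [/\ forall x, c <= z x i <= c + 2, cut_size F (level i c) = 1%N &
   cut_size F (level i (c + 2)) = 1%N].
Proof.
move=> iu d2; have [c [[x xc] [y yc] h]] := levels iu; exists c.
have le x' : z x' i <= c + 2.
  rewrite leNgt; apply/negP => x'c.
  have := @degree_below i [:: c; c + 1; c + 2]; rewrite !big_cons big_nil addn0 /= !inE.
  have -> : ~~ ((c == c + 1) || (c == c + 2)) && ((c + 1 != c + 2) && true) by lia.
  have h1 : (0 < cut_size F (below i c))%N by apply: (@below_cut _ _ x x'); lia.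
  have h2 : (0 < cut_size F (below i (c + 1)))%N by apply: (@below_cut _ _ x x'); lia.
  have h3 : (0 < cut_size F (below i (c + 2)))%N by apply: (@below_cut _ _ x x'); lia.
  by move=> /(_ isT); lia.
have := @degree_below i [:: c; c + 1]; rewrite !big_cons big_nil addn0 /= inE.
have -> : (c != c + 1) && true by lia.
have h1 : (0 < cut_size F (below i c))%N by apply: (@below_cut _ _ x y); lia.
have h2 : (0 < cut_size F (below i (c + 1)))%N by apply: (@below_cut _ _ x y); lia.
have -> : level i c = below i c.
  by apply/setP => x'; rewrite !inE; have := h x'; have := le x'; lia.
have -> : level i (c + 2) = ~: below i (c + 1).
  by apply/setP => x'; rewrite !inE; have := h x'; have := le x'; lia.
rewrite cut_sizeC => /(_ isT) h3; split; [|lia|lia].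
by move=> x'; apply/andP.
Qed.

Lemma cut1_nonempty P : cut_size F P = 1%N -> exists x, x \in P.
Proof. by move=> h; case: (@cut_link U F P) => [|x [_ [xP _ _]]]; [rewrite h | exists x]. Qed.

Lemma level_ends i x0 y0 (D : {set U}) c : link F x0 y0 ->
  x0 \in D -> y0 \notin D -> cut_size F D = 1%N ->
  (forall x, x \in D -> z x i = z x0 i) -> z y0 i != z x0 i ->
  z x0 i = c -> cut_size F (level i c) = 1%N -> D = level i c.
Proof.
move=> l0 x0D y0D cD hD y0x0 ec cl; apply/setP => x; rewrite inE.
apply/idP/eqP => [/hD ->//|xc]; apply: contraT => xD.
have := @exit_edge (level i c :\: D) x x0; rewrite !inE xD xc eqxx x0D /=.
case=> // a [b []]; rewrite !inE => /andP[aD /eqP ac] bX ab.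
have [bc|bc] := eqVneq (z b i) c.
  move: bX; rewrite bc eqxx andbT negbK => bD; rewrite linkC in ab.
  have [_ e] := cut1_uniq cD x0D y0D l0 bD aD ab.
  by move: y0x0; rewrite e ac ec eqxx.
have [||||e _] := @cut1_uniq _ _ _ x0 y0 a b cl _ _ l0 _ _ ab.
- by rewrite inE ec.
- by rewrite inE -ec.
- by rewrite inE ac.
- by rewrite inE.
by rewrite -e x0D in aD.
Qed.

(** The coordinate counted from [x0] and oriented along the edge, so that [y0] has depth 1 whenever
    the edge changes the coordinate. *)
Definition depth i x0 y0 x := (z y0 i - z x0 i) * (z x i - z x0 i).

(** [D] has to be one of the two extreme levels. If [x0] were on the middle level, [y0] would lie on
    an extreme one, and no edge could leave the union of that level with [D]. *)
Lemma end_level i x0 y0 (D : {set U}) : i \in used -> degree i = 2%N ->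
  link F x0 y0 -> x0 \in D -> y0 \notin D -> cut_size F D = 1%N ->
  (forall x, x \in D -> z x i = z x0 i) -> z y0 i != z x0 i ->
  [/\ forall x, 0 <= depth i x0 y0 x <= 2,
      forall x, (x \in D) = (depth i x0 y0 x == 0) &
      cut_size F [set x | depth i x0 y0 x == 2] = 1%N].
Proof.
move=> iu d2 l0 x0D y0D cD hD y0x0.
have [c [h c0 c2]] := degree2_levels iu d2.
have := adjacent_le1 i (link_adjacent l0) => le1.
have [x0c|x0c] := eqVneq (z x0 i) c.
  have y0c : z y0 i = c + 1 by have := h y0; lia.
  have eD := level_ends l0 x0D y0D cD hD y0x0 x0c c0.
  have ed x : depth i x0 y0 x = z x i - c by rewrite /depth y0c x0c; lia.
  split=> [x|x|]; rewrite ?ed; first by have := h x; lia.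
    by rewrite eD inE subr_eq0.
  by rewrite -c2; congr cut_size; apply/setP => x; rewrite !inE ed; lia.
have [x0c2|x0c2] := eqVneq (z x0 i) (c + 2).
  have y0c : z y0 i = c + 1 by have := h y0; lia.
  have eD := level_ends l0 x0D y0D cD hD y0x0 x0c2 c2.
  have ed x : depth i x0 y0 x = c + 2 - z x i by rewrite /depth y0c x0c2; lia.
  split=> [x|x|]; rewrite ?ed; first by have := h x; lia.
    by rewrite eD inE; lia.
  by rewrite -c0; congr cut_size; apply/setP => x; rewrite !inE ed; lia.
exfalso; have [x1 x1c] := cut1_nonempty c0; have [x2 x2c] := cut1_nonempty c2.
rewrite !inE in x1c x2c.
have x0c1 : z x0 i = c + 1 by have := h x0; lia.
pose c' := z y0 i.
have c'e : c' = c \/ c' = c + 2 by rewrite /c'; have := h y0; lia.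
have cl : cut_size F (level i c') = 1%N by case: c'e => ->.
have [x3 x3c] : exists x3, z x3 i != c' /\ z x3 i != c + 1.
  by case: c'e => ->; [exists x2 | exists x1]; lia.
have := @exit_edge (D :|: level i c') x0 x3; rewrite !inE x0D /=.
case=> //; first by rewrite negb_or; apply/andP; split; [apply/negP => /hD|]; lia.
move=> a [b []]; rewrite !inE negb_or => /orP[aD|/eqP ac] /andP[bD bc] ab.
  have [_ e] := cut1_uniq cD x0D y0D l0 aD bD ab.
  by rewrite -e eqxx in bc.
rewrite linkC in l0.
have [||||_ e] := @cut1_uniq _ _ _ y0 x0 a b cl _ _ l0 _ _ ab.
- by rewrite inE.
- by rewrite inE; lia.
- by rewrite inE ac.
- by rewrite inE.
by rewrite -e x0D in bD.
Qed.

Lemma depth_sums i x0 y0 : `|z y0 i - z x0 i|%N = 1%N ->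
  [/\ \sum_x d x = 0, \sum_x d x * (depth i x0 y0 x)%:~R = 0 &
      \sum_x d x * (depth i x0 y0 x)%:~R ^+ 2 = 2 * half_moment i].
Proof.
move=> h1; have [s0 s1] := d_rel; set a := z y0 i - z x0 i in h1 *.
have a2 : a%:~R ^+ 2 = 1 :> rat.
  by rewrite -rmorphXn /= (_ : a ^+ 2 = 1) //; rewrite expr2; lia.
pose b : rat := (z x0 i)%:~R.
have de x : (depth i x0 y0 x)%:~R = a%:~R * ((z x i)%:~R - b) :> rat.
  by rewrite -rmorphB -rmorphM.
split=> //.
  under eq_bigr do rewrite de mulrCA mulrBr.
  by rewrite -big_distrr /= sumrB s1 -big_distrl /= s0 mul0r subr0 mulr0.
under eq_bigr => x _ do rewrite de exprMn a2 mul1r sqrrB mulrDr mulrBr mulrnAr mulrA.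
rewrite big_split sumrB /= -!big_distrl /= s0 mul0r addr0.
rewrite (_ : \sum_x _ *+ 2 = 0) ?subr0.
  rewrite /half_moment mulrA mulfV // mul1r.
  by apply: eq_bigr => x _; rewrite expr2 mulrA.
rewrite (eq_bigr (fun x => d x * (z x i)%:~R * (2 * b))) => [|x _]; last by ring.
by rewrite -big_distrl /= s1 mul0r.
Qed.

(** The polynomials [(w - 1) (w - 2)] and [w (w - 1)] pick out the depths 0 and 2 with the value 2.
    Since [d] kills affine functions, only their leading term contributes. *)
Lemma depth_masses i x0 y0 : `|z y0 i - z x0 i|%N = 1%N ->
  (forall x, 0 <= depth i x0 y0 x <= 2) ->
  \sum_(x | depth i x0 y0 x == 0) d x = half_moment i /\
  \sum_(x | depth i x0 y0 x == 2) d x = half_moment i.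
Proof.
move=> /depth_sums[s0 s1 s2] h.
have aux (c : int) (p : rat -> rat) : (forall k : int, 0 <= k <= 2 -> p k%:~R = 2 * (k == c)%:R) ->
    \sum_(x | depth i x0 y0 x == c) d x = 2^-1 * \sum_x d x * p (depth i x0 y0 x)%:~R.
  move=> hp; rewrite big_mkcond big_distrr; apply: eq_bigr => x _ /=.
  rewrite hp //; case: (_ == c); first by rewrite mulr1; field.
  by rewrite !mulr0.
split.
  rewrite (aux 0 (fun w : rat => w ^+ 2 - 3 * w + 2)).
    rewrite (eq_bigr (fun x => d x * (depth i x0 y0 x)%:~R ^+ 2 -
      3 * (d x * (depth i x0 y0 x)%:~R) + 2 * d x)) => [|x _]; last by ring.
    rewrite big_split sumrB /= -!big_distrr /= s0 s1 s2.
    by field.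
  by move=> k; case: k => [[|[|[|]]]|] //= _; field.
rewrite (aux 2 (fun w : rat => w ^+ 2 - w)).
  under eq_bigr => x _ do rewrite mulrBr.
  by rewrite sumrB s1 s2; field.
by move=> k; case: k => [[|[|[|]]]|] //= _; field.
Qed.

(** If neither set contained the other, all four corners would be nonempty. Leaving the two corners
    inside [P] forces the only edge across [Q] to lie inside [P]; leaving the two corners outside
    [P] forces the same edge to lie outside. *)
Lemma cut1_laminar (P Q : {set U}) : cut_size F P = 1%N -> cut_size F Q = 1%N ->
  P :&: Q != set0 -> P :|: Q != [set: U] -> P \subset Q \/ Q \subset P.
Proof.
move=> cP cQ /set0Pn[c cPQ] PQT.
have /existsP[o oPQ] : [exists o, o \notin P :|: Q].
  apply: contraNT PQT; rewrite negb_exists => /forallP h.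
  by apply/eqP/setP => o; rewrite in_setT; apply/negPn/h.
case: (boolP (P \subset Q)) => [|/subsetPn[a aP aQ]]; first by left.
case: (boolP (Q \subset P)) => [|/subsetPn[b bQ bP]]; first by right.
move: cPQ oPQ; rewrite !inE negb_or => /andP[cP' cQ'] /andP[oP oQ].
have [pa [qa [paP qaP lP]]] := exit_edge aP bP.
have [pb [qb [pbQ qbQ lQ]]] := exit_edge bQ aQ.
have uP p q : p \in P -> q \notin P -> link F p q -> pa = p /\ qa = q.
  by move=> pP qP; apply: cut1_uniq cP paP qaP lP pP qP.
have uQ p q : p \in Q -> q \notin Q -> link F p q -> pb = p /\ qb = q.
  by move=> pQ qQ; apply: cut1_uniq cQ pbQ qbQ lQ pQ qQ.
have h1 : pa \in Q \/ (pb \in P) && (qb \in P).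
  have [||p [q []]] := @exit_edge (P :&: Q) c a; rewrite ?inE ?cP' ?(negPf aQ) ?andbF //.
  move=> /andP[pP pQ]; case qP: (q \in P) => qQ lpq.
    by right; have [-> ->] := uQ _ _ pQ qQ lpq; rewrite pP.
  by left; have [-> _] := uP _ _ pP (negbT qP) lpq.
have h2 : pa \notin Q \/ (pb \in P) && (qb \in P).
  have [||p [q []]] := @exit_edge (P :\: Q) a c; rewrite ?inE ?aP ?cQ' ?aQ //.
  move=> /andP[pQ pP]; case qP: (q \in P); rewrite ?andbT ?negbK => qQ lpq.
    by right; rewrite linkC in lpq; have [-> ->] := uQ _ _ qQ pQ lpq; rewrite pP qP.
  by left; have [-> _] := uP _ _ pP (negbT qP) lpq.
have h3 : qa \in Q \/ (pb \notin P) && (qb \notin P).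
  have [||p [q []]] := @exit_edge (Q :\: P) b c; rewrite ?inE ?bQ ?bP ?cP' //.
  move=> /andP[pP pQ]; case qP: (q \in P) => /= qQ lpq.
    by left; rewrite linkC in lpq; have [_ ->] := uP _ _ qP pP lpq.
  by right; have [-> ->] := uQ _ _ pQ qQ lpq; rewrite pP qP.
have h4 : qa \notin Q \/ (pb \notin P) && (qb \notin P).
  have [||p [q []]] := @exit_edge (~: (P :|: Q)) o c; rewrite ?inE ?cP' ?(negPf oP) ?oQ //.
  rewrite negb_or => /andP[pP pQ]; case qP: (q \in P) => /= qQ lpq.
    by left; rewrite linkC in lpq; have [_ ->] := uP _ _ qP pP lpq.
  right; rewrite linkC in lpq; rewrite negbK in qQ.
  by have [-> ->] := uQ _ _ qQ pQ lpq; rewrite pP qP.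
have [paQ|paQ] := boolP (pa \in Q); have [qaQ|qaQ] := boolP (qa \in Q);
  move: h1 h2 h3 h4; rewrite ?paQ ?qaQ ?(negPf paQ) ?(negPf qaQ);
  case: (pb \in P); case: (qb \in P) => -[] // _ [] // _ [] // _ [] //.
Qed.

Lemma depth_pair i l x0 y0 : i != l ->
  \sum_x d x * (depth i x0 y0 x)%:~R * (depth l x0 y0 x)%:~R = 0.
Proof.
move=> il; have [s0 s1] := d_rel.
pose a : rat := (z y0 i - z x0 i)%:~R; pose b : rat := (z y0 l - z x0 l)%:~R.
pose c : rat := (z x0 i)%:~R; pose e : rat := (z x0 l)%:~R.
rewrite (eq_bigr (fun x => a * b * (d x * (z x i)%:~R * (z x l)%:~R)
   - a * b * e * (d x * (z x i)%:~R) - a * b * c * (d x * (z x l)%:~R)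
   + a * b * c * e * d x)) => [|x _]; last first.
  by rewrite /depth !rmorphM !(rmorphB _ (z x _)) /= -/a -/b -/c -/e; ring.
by rewrite big_split !sumrB /= -!big_distrr /= s0 !s1 (z_diag d_rel) //; ring.
Qed.

(* The vanishing mixed moment gives the intersection of the two sets of depth 2
   the mass [- half_moment i], but these sets are nested and have mass
   [half_moment i]. *)
Lemma no_joint_end i l x0 y0 (D : {set U}) : i != l -> i \in used -> l \in used ->
  degree i = 2%N -> degree l = 2%N ->
  link F x0 y0 -> x0 \in D -> y0 \notin D -> cut_size F D = 1%N ->
  (forall x, x \in D -> z x i = z x0 i) -> (forall x, x \in D -> z x l = z x0 l) ->
  z y0 i != z x0 i -> z y0 l != z x0 l -> False.
Proof.
move=> il iu lu di dl l0 x0D y0D cD hi hl ni nl.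
have [ri Di ci] := end_level iu di l0 x0D y0D cD hi ni.
have [rl Dl cl] := end_level lu dl l0 x0D y0D cD hl nl.
have unit_ k : z y0 k != z x0 k -> `|z y0 k - z x0 k|%N = 1%N.
  move=> nk; have := adjacent_le1 k (link_adjacent l0); lia.
have [mi0 mi2] := depth_masses (unit_ i ni) ri.
have [ml0 ml2] := depth_masses (unit_ l nl) rl.
have eD : \sum_(x | depth i x0 y0 x == 0) d x = \sum_(x | depth l x0 y0 x == 0) d x.
  by apply: eq_bigl => x; rewrite -Di -Dl.
have u0 := used_half_moment iu; have eu : half_moment l = half_moment i by rewrite -mi0 -ml0 eD.
have := depth_pair x0 y0 il.
set A := [set x | depth i x0 y0 x == 2] in ci; set B := [set x | depth l x0 y0 x == 2] in cl.
(* The two depths vanish together, so only the pairs (0,0), (1,1), (1,2), (2,1) and (2,2) occur, and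
   on each of them the product equals this combination of indicators. *)
have -> : \sum_x d x * (depth i x0 y0 x)%:~R * (depth l x0 y0 x)%:~R =
    \sum_x d x - \sum_(x | depth i x0 y0 x == 0) d x + \sum_(x | depth i x0 y0 x == 2) d x
    + \sum_(x | depth l x0 y0 x == 2) d x + \sum_(x in A :&: B) d x.
  rewrite ![\sum_(x | _ == _) _]big_mkcond [\sum_(x in _) _]big_mkcond.
  rewrite -sumrB -!big_split; apply: eq_bigr => x _ /=.
  rewrite !inE; have := Di x; rewrite Dl; have := ri x; have := rl x.
  move: (depth i x0 y0 x) (depth l x0 y0 x).
  by case=> [[|[|[|]]]|] // [[|[|[|]]]|] //= _ _ //= _; field.
have [s0 _] := d_rel; rewrite s0 mi0 mi2 ml2 eu => h.
have hAB : \sum_(x in A :&: B) d x = - half_moment i.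
  by move: h; set S := \sum_(x in _) _; lra.
have AB0 : A :&: B != set0.
  apply: contraNneq u0 => e; rewrite -oppr_eq0 -hAB e big1 // => x; by rewrite inE.
have ABT : A :|: B != [set: U].
  apply/eqP => /setP/(_ x0); rewrite !inE /depth !subrr !mulr0 //.
have : \sum_(x in A :&: B) d x = half_moment i.
  case: (cut1_laminar ci cl AB0 ABT) => [/setIidPl ->|/setIidPr ->].
    by rewrite -mi2; apply: eq_bigl => x; rewrite inE.
  by rewrite -eu -ml2; apply: eq_bigl => x; rewrite inE.
rewrite hAB => /eqP; rewrite -subr_eq0 -opprD oppr_eq0 -mulr2n mulrn_eq0 /=.
by rewrite (negPf u0).
Qed.

Lemma depth_le1 i x0 y0 x y : link F x0 y0 -> link F x y ->
  (`|depth i x0 y0 x - depth i x0 y0 y| <= 1)%N.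
Proof.
move=> /link_adjacent/(adjacent_le1 i) h0 /link_adjacent/(adjacent_le1 i) h.
have -> : depth i x0 y0 x - depth i x0 y0 y = (z y0 i - z x0 i) * (z x i - z y i).
  by rewrite /depth; ring.
by rewrite abszM distnC (leq_mul h0 h).
Qed.

Lemma depth_neq i x0 y0 x y : depth i x0 y0 x != depth i x0 y0 y -> i \in changed x y.
Proof. by rewrite inE; apply: contra => /eqP e; rewrite /depth e. Qed.

(* The pairing of the dipole between [q] and the leaf [t] with the coordinates
   is known, which makes [depth j] an affine function of [depth i] off [s]. *)
Lemma leaf_no_degree2 i j t s : i != j -> cut_size F [set t] = 1%N -> link F t s ->
  changed t s = [set i; j] -> degree i = 2%N -> False.
Proof.
move=> ij ct lts cts di.
have ts : t != s := adjacent_neq (link_adjacent lts).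
have used_of k : k \in changed t s -> k \in used.
  by apply: (subsetP (changed_used t s)).
have ich : i \in changed t s by rewrite cts !inE eqxx.
have jch : j \in changed t s by rewrite cts !inE eqxx orbT.
have iu := used_of _ ich; have ju := used_of _ jch.
have unit_ k : k \in changed t s -> `|z s k - z t k|%N = 1%N.
  rewrite inE => h; have := adjacent_le1 k (link_adjacent lts); lia.
have sqr1 (a : int) : `|a|%N = 1%N -> a * a = 1 by lia.
have st : s \notin [set t] by rewrite inE eq_sym.
have zt x : x \in [set t] -> z x i = z t i by rewrite inE => /eqP->.
have nsi : z s i != z t i by move: ich; rewrite inE eq_sym.
have [ry Dy cy] := end_level iu di lts (set11 t) st ct zt nsi.
have [m0 m2] := depth_masses (unit_ i ich) ry.
pose y := depth i t s; pose Y := depth j t s.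
have ys : y s = 1 by rewrite /y /depth sqr1 // unit_.
have Ys : Y s = 1 by rewrite /Y /depth sqr1 // unit_.
have yt x : (x == t) = (y x == 0) by rewrite -Dy inE.
have pick1 w : \sum_(x | x == w) d x = d w by rewrite big_pred1_eq.
have dt : d t = half_moment i.
  by rewrite -m0 -(pick1 t); apply: eq_bigl => x; rewrite [LHS]yt.
have ui := used_half_moment iu; have uj := used_half_moment ju.
(* The increment of the dipole between [t] and [s], computed once from its definition and once from
   its gradient, to which only [i] and [j] contribute. *)
have gram q : q != t -> (q == s)%:R / d s + 1 / d t =
    (y q)%:~R / (2 * half_moment i) + (Y q)%:~R / (2 * half_moment j).
  move=> qt; have [G [hG hu]] := dipole_gradient (d_all q) (d_all t).
  have := hG s t; have -> : dipole q t s - dipole q t t = (q == s)%:R / d s + 1 / d t.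
    rewrite /dipole eqxx (eq_sym s t) (negPf ts) (eq_sym t q) (negPf qt) (eq_sym s q).
    rewrite !mul0r subr0 sub0r opprK; congr (_ + _).
    by case: (eqVneq q s) => [->//|_]; rewrite !mul0r.
  rewrite (bigD1 i) //= (bigD1 j) 1?eq_sym //= [X in _ + (_ + X)]big1 ?addr0; last first.
    move=> k /andP[ki kj]; have : k \notin changed t s by rewrite cts !inE negb_or ki kj.
    by rewrite inE negbK => /eqP ->; rewrite subrr mulr0.
  have eG k : half_moment k != 0 ->
      G k * ((z s k)%:~R - (z t k)%:~R) = (depth k t s q)%:~R / (2 * half_moment k).
    move=> uk; rewrite /depth rmorphM !rmorphB /= -hu.
    by field; rewrite uk.
  by rewrite !eG.
have Yval q : q != t -> q != s -> (Y q)%:~R = half_moment j / half_moment i * (2 - (y q)%:~R).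
  move=> qt qs; have := gram q qt; rewrite (negPf qs) mul0r add0r dt => h.
  have -> : (Y q)%:~R = (Y q)%:~R / (2 * half_moment j) * (2 * half_moment j).
    by rewrite divfK // mulf_neq0.
  have -> : (Y q)%:~R / (2 * half_moment j) =
     1 / half_moment i - (y q)%:~R / (2 * half_moment i) by rewrite h; ring.
  by field; rewrite ui.
have ds : 1 / d s = 1 / (2 * half_moment j) - 1 / (2 * half_moment i).
  have st' : s != t by rewrite eq_sym.
  have := gram s st'; rewrite eqxx ys Ys dt /= => h.
  have -> : 1 / d s = 1%:~R / (2 * half_moment i) + 1%:~R / (2 * half_moment j)
    - 1 / half_moment i by rewrite -h; ring.
  by field; rewrite ui uj.
(* By [Yval] such a [b] has the same [j]-th coordinate as [t], so it differs from [t] in [i] alone,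
   by 2. *)
have far b : link F s b -> y b = 2 -> False.
  move=> lsb yb; have bt : b != t by rewrite yt yb.
  have bs : b != s by apply/eqP => e; move: yb; rewrite e ys.
  have Yb : Y b = 0.
    apply/eqP; rewrite -(intr_eq0 rat); apply/eqP.
    by rewrite Yval // yb /= subrr mulr0.
  have csb : changed s b = [set i; j].
    apply/esym/eqP; rewrite eqEcard subUset !sub1set.
    rewrite (@depth_neq i t s) -/y ?ys ?yb // (@depth_neq j t s) -/Y ?Ys ?Yb //=.
    have /andP[/eqP -> _] := link_adjacent lsb; by rewrite cards2 ij.
  have zbj : z b j = z t j.
    exact: unit_step0 (unit_ j jch) Yb.
  have ctb : changed t b = [set i].
    apply/setP => k; rewrite !inE; have [->|ki] := eqVneq k i.
      apply/negP => /eqP e; have := yb; rewrite /y /depth e subrr mulr0 //.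
    have [->|kj] := eqVneq k j; first by rewrite zbj eqxx.
    have : k \notin changed t s by rewrite cts !inE negb_or ki kj.
    have : k \notin changed s b by rewrite csb !inE negb_or ki kj.
    by rewrite !inE !negbK => /eqP -> /eqP ->; rewrite eqxx.
  have /negP := z_no2 ctb; apply; apply/eqP; exact: unit_step2 (unit_ i ich) yb.
(* Otherwise [s] alone would carry the mass [- (2 * half_moment i)] of depth 1, and [ds] would give
   [1 / (2 * half_moment j) = 0]. *)
have [q [qs yq]] : exists q, q != s /\ y q = 1.
  suff /existsP[q /andP[qs /eqP yq]] : [exists q, (q != s) && (y q == 1)] by exists q.
  apply: contraT; rewrite negb_exists => /forallP h.
  have [s0 _] := d_rel.
  have m1 : d s = - (2 * half_moment i).
    have : \sum_x d x = \sum_(x | y x == 0) d x + \sum_(x | y x == 2) d x + d s.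
      rewrite -(pick1 s) ![\sum_(x | _ == _) _]big_mkcond -!big_split.
      apply: eq_bigr => x _ /=; have := h x; have := ry x; rewrite -/(y x).
      have [->|xs] := eqVneq x s; first by rewrite ys /= => _ _; ring.
      by case: (y x) => [[|[|[|]]]|] //= _ _; ring.
    rewrite s0 m0 m2 => e; lra.
  move: ds; rewrite m1 => e; case/negP: uj; apply/eqP.
  have : 1 / (2 * half_moment j) = 0.
    have -> : 1 / (2 * half_moment j) = 1 / - (2 * half_moment i) + 1 / (2 * half_moment i).
      by rewrite e; ring.
    by field; rewrite ui.
  move/eqP; rewrite div1r invr_eq0 mulf_eq0 /= => /eqP //.
have n1 : half_moment j / half_moment i != 1.
  apply/eqP => e; have {}e : half_moment j = half_moment i.
    by rewrite -[LHS](divfK ui) e mul1r.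
  by have /eqP := ds; rewrite e subrr div1r invr_eq0 (negPf (d_all s)).
have n0 : half_moment j / half_moment i != 0 by rewrite mulf_neq0 // invr_eq0.
have level1 b : b != s -> y b = 1 -> (Y b)%:~R = half_moment j / half_moment i.
  move=> bs yb; rewrite Yval ?yt ?yb //.
  by rewrite /= (_ : 2 - 1 = 1) ?mulr1.
have Yq2 b : b != s -> y b = 1 -> link F s b -> Y b = 2.
  move=> bs yb lsb; have := depth_le1 j lts lsb; rewrite -/(Y _) -/(Y _) Ys.
  have e := level1 b bs yb.
  have Y0 : Y b != 0 by apply: contraNneq n0 => h; rewrite -e h.
  have Y1 : Y b != 1 by apply: contraNneq n1 => h; rewrite -e h.
  by move: (Y b) Y0 Y1; clear=> c; lia.
have [||a [b [aP bP ab]]] := @exit_edge [set t; s] t q.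
- by rewrite !inE eqxx.
- by rewrite !inE negb_or qs yt yq.
have as_ : a = s.
  move: aP bP; rewrite !inE => /orP[/eqP e|/eqP//]; rewrite negb_or => /andP[bt bs].
  rewrite e in ab; have bnt : b \notin [set t] by rewrite inE.
  by have [_ e2] := cut1_uniq ct (set11 t) st lts (set11 t) bnt ab; rewrite e2 eqxx in bs.
subst a; move: bP; rewrite !inE negb_or => /andP[bt bs].
have yb : y b = 1.
  have := ry b; rewrite -/(y b); move: bt; rewrite yt.
  by case E: (y b) => [[|[|[|]]]|] //; case: (far b ab E).
(* Hence, apart from [s], the depth in [j] is 2 where the depth in [i] is 1, and 0 where it is 2. An
   edge leaving the level of depth 2 would change the depth in [j] by 2. *)
have nu2 : half_moment j / half_moment i = 2 by rewrite -(level1 b bs yb) Yq2.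
have [|a' [b' [a'P b'P ab']]] := @cut_link U F [set x | y x == 2].
  by rewrite cy.
move: a'P b'P; rewrite !inE => /eqP ya' yb'.
have a't : a' != t by rewrite yt ya'.
have a's : a' != s by apply/eqP => e; move: ya'; rewrite e ys.
have Ya' : Y a' = 0.
  by apply/eqP; rewrite -(intr_eq0 rat); apply/eqP; rewrite Yval // ya' subrr mulr0.
have yb1 : y b' = 1.
  have := depth_le1 i lts ab'; rewrite -/(y _) -/(y _) ya'; have := ry b'; rewrite -/(y _).
  by move: (y b') yb'; clear=> c; lia.
have [e|b's] := eqVneq b' s.
  by apply: (far a') => //; rewrite linkC -e.
have := depth_le1 j lts ab'; rewrite -/(Y _) -/(Y _) Ya'.
have -> // : Y b' = 2.
by apply/eqP; rewrite -(eqr_int rat); apply/eqP; rewrite level1 ?nu2.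
Qed.

(** Unordered edges are encoded by the sets of their two ends, so that distinct keys come from
    distinct entries of [F]. *)
Lemma degree_keys i (ks : seq {set U}) : uniq ks ->
  (forall k, k \in ks -> exists x y, [/\ k = [set x; y], link F x y & i \in changed x y]) ->
  (size ks <= degree i)%N.
Proof.
move=> uk hk; rewrite /degree -size_filter.
rewrite -(size_map (fun e : U * U => [set e.1; e.2])); apply: uniq_leq_size => // k.
move/hk => [x [y [-> lxy ixy]]]; apply/mapP.
case/orP: lxy => xyF; [exists (x, y) | exists (y, x)] => //=; last by rewrite setUC.
  by rewrite mem_filter xyF andbT; rewrite inE in ixy.
by rewrite mem_filter xyF andbT /= eq_sym; rewrite inE in ixy.
Qed.

Lemma sum_degree : (\sum_(i in used) degree i = 2 * size F)%N.
Proof.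
under eq_bigr do rewrite degreeE.
rewrite exchange_big /=; elim: F aF => [|e F' IH] /=; first by rewrite big_nil.
case/andP=> /andP[/eqP ce _] /IH h; rewrite big_cons h mulnS -ce; congr (_ + _)%N.
rewrite -sum1_card big_mkcond [RHS]big_mkcond; apply: eq_bigr => i _.
case iu: (i \in used); first by rewrite inE; case: (_ == _).
by case ic: (i \in changed _ _) => //; rewrite (subsetP (changed_used _ _) _ ic) in iu.
Qed.

(** The degrees are at least 2 and sum to [2 * size F], while [size F <= #|used| + 1] by
    [card_used]; their total excess over 2 is therefore at most 2. *)
Lemma two_big_degrees i j : i != j -> i \in used -> j \in used ->
  (2 < degree i)%N -> (2 < degree j)%N -> [/\ degree i = 3%N, degree j = 3%N &
    forall l, l \in used -> l != i -> l != j -> degree l = 2%N].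
Proof.
move=> ij iu ju di dj; have h0 : (\sum_(l in used) (degree l - 2) <= 2)%N.
  have e : (\sum_(l in used) degree l = \sum_(l in used) (degree l - 2) + 2 * #|used|)%N.
    rewrite mulnC -sum_nat_const -big_split; apply: eq_bigr => l lu /=.
    by rewrite subnK // degree_ge2.
  have := card_used; rewrite -sF; move: e; rewrite sum_degree.
  by move: (size F) (\sum_(l in _) _)%N #|used|; lia.
rewrite (bigD1 i) //= (bigD1 j) /= in h0; last by rewrite ju eq_sym.
split; [lia|lia|] => l lu li lj.
rewrite (bigD1 l) /= in h0; last by rewrite lu li.
have := degree_ge2 lu; lia.
Qed.

Lemma leaf_link t : cut_size F [set t] = 1%N -> exists s, [/\ t != s, link F t s &
  forall x, link F t x -> x = s].
Proof.
move=> ct; have [|a [s [+ st ts]]] := @cut_link U F [set t]; first by rewrite ct.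
rewrite inE => /eqP e; rewrite e in ts; exists s; split=> //.
  exact: adjacent_neq (link_adjacent ts).
move=> x tx; have xt : x \notin [set t].
  by rewrite inE eq_sym; apply: adjacent_neq (link_adjacent tx).
by have [_ ->] := cut1_uniq ct (set11 t) st ts (set11 t) xt tx.
Qed.

Lemma leaf_big t s : cut_size F [set t] = 1%N -> link F t s ->
  exists i j, [/\ changed t s = [set i; j], i != j,
    i \in used, j \in used & (2 < degree i)%N /\ (2 < degree j)%N].
Proof.
move=> ct ts; have /andP[/cards2P[i [j [ij e]]] _] := link_adjacent ts.
have iu : i \in used by apply: (subsetP (changed_used t s)); rewrite e !inE eqxx.
have ju : j \in used by apply: (subsetP (changed_used t s)); rewrite e !inE eqxx orbT.
exists i, j; split=> //; split.
  have := degree_ge2 iu; rewrite leq_eqVlt => /orP[/eqP di|//].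
  by case: (leaf_no_degree2 ij ct ts e (esym di)).
have := degree_ge2 ju; rewrite leq_eqVlt => /orP[/eqP dj|//].
by case: (@leaf_no_degree2 j i t s) => //; rewrite 1?eq_sym // setUC.
Qed.

(** There are three consecutive values, so an edge changing the coordinate leaves one of the extreme
    levels, and these are cut off by a single edge. *)
Lemma degree2_cut a x y : a \in used -> degree a = 2%N -> link F x y ->
  a \in changed x y ->
  exists D : {set U}, cut_size F D = 1%N /\ (x \in D) != (y \in D).
Proof.
move=> au da lxy; rewrite inE => axy; have [c [h c0 c2]] := degree2_levels au da.
have := adjacent_le1 a (link_adjacent lxy); have := h x; have := h y => hy hx le1.
have [|e] := boolP ((z x a == c) || (z y a == c)).
  by exists (level a c); rewrite c0 !inE; split=> //; lia.
by exists (level a (c + 2)); rewrite c2 !inE; split=> //; lia.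
Qed.

(* A smallest side [D] of a cut by a single link outside [{J, K}] would carry
   constant values of both coordinates changed by that link. *)
Lemma only_pair J K : (forall l, l \in used -> l != J -> l != K -> degree l = 2%N) ->
  (forall x y, link F x y -> (J \in changed x y) || (K \in changed x y) ->
     changed x y = [set J; K]) ->
  forall x y, link F x y -> changed x y = [set J; K].
Proof.
move=> d2 hJK x0 y0 l0; apply/eqP; apply: contraT => n0.
have deg2 x y a : link F x y -> changed x y != [set J; K] -> a \in changed x y ->
    a \in used /\ degree a = 2%N.
  move=> lxy nxy axy; have au := subsetP (changed_used x y) _ axy.
  split=> //; apply: d2 => //; apply: contra nxy => /eqP e;
    by rewrite e in axy; rewrite (hJK _ _ lxy) // axy ?orbT.
pose good (D : {set U}) := (cut_size F D == 1%N) && [exists x in D, exists y in ~: D,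
  link F x y && (changed x y != [set J; K])].
have goodP D x y : cut_size F D = 1%N -> link F x y -> changed x y != [set J; K] ->
    (x \in D) != (y \in D) -> good D.
  move=> cD lxy nxy xyD; rewrite /good cD eqxx /=.
  case xD: (x \in D) xyD => yD.
    apply/exists_inP; exists x => //; apply/exists_inP; exists y; last by rewrite lxy.
    by rewrite inE; case: (y \in D) yD.
  apply/exists_inP; exists y; first by case: (y \in D) yD.
  apply/exists_inP; exists x; first by rewrite inE xD.
  by rewrite linkC lxy /changed; under eq_finset do rewrite eq_sym.
have ex_changed x y : link F x y -> exists a b, [/\ changed x y = [set a; b] & a != b].
  by move=> /link_adjacent/andP[/cards2P[a [b [ab e]]] _]; exists a, b.
have [D0 [cD0 D0xy]] : exists D : {set U}, cut_size F D = 1%N /\ (x0 \in D) != (y0 \in D).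
  have [a [b [e ab]]] := ex_changed _ _ l0.
  have ach : a \in changed x0 y0 by rewrite e !inE eqxx.
  by have [au da] := deg2 _ _ _ l0 n0 ach; apply: degree2_cut au da l0 ach.
have gD0 := goodP _ _ _ cD0 l0 n0 D0xy.
have [D /andP[/eqP cD /exists_inP[x xD /exists_inP[y yD /andP[lxy nxy]]]] minD] :=
  @arg_minnP _ D0 good (fun D => #|D|) gD0.
rewrite inE in yD.
have inner a : a \in changed x y -> forall w, w \in D -> z w a = z x a.
  move=> axy; have [au da] := deg2 _ _ _ lxy nxy axy.
  move=> w wD; apply/eqP; apply: contraT => wa.
  have [||p [q []]] := @exit_edge [set w in D | z w a != z x a] w x.
  - by rewrite inE wD.
  - by rewrite inE eqxx andbF.
  rewrite !inE => /andP[pD pa] qP lpq; case qD: (q \in D); last first.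
    have [e _] := cut1_uniq cD xD yD lxy pD (negbT qD) lpq.
    by rewrite e eqxx in pa.
  move: qP; rewrite qD /= negbK => /eqP qa.
  have apq : a \in changed p q by rewrite inE qa.
  have npq : changed p q != [set J; K].
    apply: contra nxy => /eqP e; rewrite e in apq; rewrite (hJK _ _ lxy) //.
    by case/set2P: apq => <-; rewrite axy ?orbT.
  (* Both [p] and [q] lie in [D], so by laminarity the single-edge cut [D1] separating them has a
     side strictly inside [D], against the choice of [D]. *)
  have [D1 [cD1 D1pq]] := degree2_cut au da lpq apq.
  have smaller (D2 : {set U}) : cut_size F D2 = 1%N -> (p \in D2) != (q \in D2) -> D2 \subset D -> False.
    move=> c2 pq2 s2; have := minD _ (goodP _ _ _ c2 lpq npq pq2).
    rewrite leqNgt => /negP; apply; apply: proper_card; rewrite properEneq s2 andbT.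
    by apply: contra pq2 => /eqP ->; rewrite pD qD.
  have [T|nT] := eqVneq (D :|: D1) [set: U].
    case: (@smaller (~: D1)); rewrite ?cut_sizeC //.
      by rewrite !inE; move: D1pq; case: (p \in D1); case: (q \in D1).
    apply/subsetP => w'; rewrite inE => w'1; have : w' \in [set: U] by [].
    by rewrite -T inE (negPf w'1) orbF.
  have n00 : D :&: D1 != set0.
    apply/set0Pn; move: D1pq; case pD1: (p \in D1) => D1q.
      by exists p; rewrite inE pD.
    by exists q; rewrite inE qD; case: (q \in D1) D1q.
  case: (cut1_laminar cD cD1 n00 nT) => [/subsetP s1|s1].
    by move: D1pq; rewrite !s1.
  by case: (smaller _ cD1 D1pq s1).
have [a [b [e ab]]] := ex_changed _ _ lxy.
have ach : a \in changed x y by rewrite e !inE eqxx.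
have bch : b \in changed x y by rewrite e !inE eqxx orbT.
have [au da] := deg2 _ _ _ lxy nxy ach; have [bu db] := deg2 _ _ _ lxy nxy bch.
exfalso; apply: (no_joint_end ab au bu da db lxy xD yD cD (inner a ach) (inner b bch)).
  by move: ach; rewrite inE eq_sym.
by move: bch; rewrite inE eq_sym.
Qed.

(** Two edges at a common vertex that change [J] and [K] with different relative signs would lead to
    points differing by 2 in one coordinate only. So the relative sign [sg] is constant, [z_K]
    equals [sg * z_J] up to a constant, and the mixed moment is [sg] times a nonzero second
    moment. *)
Lemma not_only_pair J K : J != K -> J \in used ->
  (forall x y, link F x y -> changed x y = [set J; K]) -> False.
Proof.
move=> JK Ju hJK; have KJ : K != J by rewrite eq_sym.
have unit_ x y k : link F x y -> k \in [set J; K] -> `|z y k - z x k|%N = 1%N.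
  move=> lxy; rewrite -(hJK x y lxy) inE => h.
  have := adjacent_le1 k (link_adjacent lxy); lia.
have Jin : J \in [set J; K] by rewrite !inE eqxx.
have Kin : K \in [set J; K] by rewrite !inE eqxx orbT.
have other x y k : link F x y -> k != J -> k != K -> z y k = z x k.
  move=> lxy kJ kK; have : k \notin changed x y by rewrite hJK // !inE negb_or kJ.
  by rewrite inE negbK => /eqP.
have [x0 _] := d_neq0.
have [t nt] : exists t, t != x0.
  have := card_gt1 => /card_gt1P[a [b [_ _ ab]]].
  by have [e|] := eqVneq a x0; [exists b; rewrite -e eq_sym | exists a].
have [||p0 [q0 [_ _ l0]]] := @exit_edge [set t] t x0; rewrite ?inE ?eqxx 1?eq_sym //.
pose sg := (z q0 K - z p0 K) * (z q0 J - z p0 J).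
have sg2 : sg * sg = 1 by have := unit_ _ _ _ l0 Jin; have := unit_ _ _ _ l0 Kin; rewrite /sg; lia.
pose plus x y := z y K - z x K == sg * (z y J - z x J).
have sg1 : sg = 1 \/ sg = -1 by lia.
pose P := [set x | [exists y, link F x y && plus x y]].
have p0P : p0 \in P.
  rewrite inE; apply/existsP; exists q0; rewrite l0 /plus /sg -mulrA.
  have := unit_ _ _ _ l0 Jin; move: (z q0 J - z p0 J) => a ha.
  by rewrite (_ : a * a = 1) ?mulr1 //; lia.
have all_plus x y : x \in P -> link F x y -> plus x y.
  rewrite inE => /existsP[x' /andP[lx' px']] lxy; apply: contraT => nplus.
  have h1 := unit_ _ _ _ lx' Jin; have h2 := unit_ _ _ _ lx' Kin.
  have h3 := unit_ _ _ _ lxy Jin; have h4 := unit_ _ _ _ lxy Kin.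
  have oth k : k != J -> k != K -> z x' k = z y k.
    by move=> kJ kK; rewrite (other _ _ _ lx' kJ kK) (other _ _ _ lxy kJ kK).
  move: nplus px'; rewrite /plus => np pp.
  have [eJ|nJ] := eqVneq (z x' J) (z y J).
    have ch : changed x' y = [set K].
      apply/setP => k; rewrite !inE; have [->|kK] := eqVneq k K.
        by clear -h1 h2 h3 h4 np pp eJ sg1; case: sg1 pp np => ->; lia.
      by have [->|kJ] := eqVneq k J; [rewrite eJ eqxx | rewrite oth ?eqxx].
    by have := z_no2 ch; clear -h1 h2 h3 h4 np pp eJ sg1; case: sg1 pp np => ->; lia.
  have eK : z x' K = z y K by clear -h1 h2 h3 h4 np pp nJ sg1; case: sg1 pp np => ->; lia.
  have ch : changed x' y = [set J].
    apply/setP => k; rewrite !inE; have [->|kJ] := eqVneq k J; first by rewrite nJ.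
    by have [->|kK] := eqVneq k K; [rewrite eK eqxx | rewrite oth ?eqxx].
  by have := z_no2 ch; clear -h1 h3 nJ; lia.
have PT x : x \in P.
  apply: contraT => xP; have [a [b [aP bP ab]]] := exit_edge p0P xP.
  case/negP: bP; rewrite inE; apply/existsP; exists a; rewrite linkC ab /=.
  by have := all_plus _ _ aP ab; rewrite /plus; clear -sg1; case: sg1 => ->; lia.
pose c := z p0 K - sg * z p0 J.
have zK x : z x K = sg * z x J + c.
  apply/eqP; apply: contraT => xc.
  have [||a [b []]] := @exit_edge [set x | z x K == sg * z x J + c] p0 x.
  - by rewrite inE /c; apply/eqP; ring.
  - by rewrite inE.
  rewrite !inE => /eqP ea nb ab; case/negP: nb.
  by have := all_plus _ _ (PT a) ab; rewrite /plus; clear -sg1 ea; case: sg1 ea => ->; lia.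
have := z_diag d_rel JK; have [s0 s1] := d_rel.
rewrite (eq_bigr (fun x => sg%:~R * (d x * (z x J)%:~R ^+ 2) + c%:~R * (d x * (z x J)%:~R)))
  => [|x _]; last by rewrite zK rmorphD rmorphM /=; ring.
rewrite big_split /= -!big_distrr /= s1 mulr0 addr0 => /eqP.
rewrite mulf_eq0 intr_eq0 => /orP[/eqP e|/eqP e]; first by rewrite e in sg2.
by have := used_half_moment Ju; rewrite /half_moment e mulr0 eqxx.
Qed.

Lemma sum_cut_in P : (\sum_(x in P) cut_size F [set x] =
  cut_size F P + 2 * count (fun e => (e.1 \in P) && (e.2 \in P)) F)%N.
Proof.
elim: F aF => [|e F' IH] /=; first by rewrite big1.
case/andP=> /adjacent_neq ne /IH h.
rewrite (eq_bigr (fun x => crossing [set x] e + cut_size F' [set x])%N) //.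
rewrite big_split /= h /cut_size /= -/(cut_size F' P).
suff -> : (\sum_(x in P) crossing [set x] e =
    crossing P e + 2 * ((e.1 \in P) && (e.2 \in P)))%N by lia.
have c1 x : crossing [set x] e = ((x == e.1) + (x == e.2))%N :> nat.
  rewrite /crossing !inE ![_ == x]eq_sym; have [->|_] := eqVneq x e.1; last by case: (x == _).
  by rewrite (negPf ne).
under eq_bigr do rewrite c1.
have c2 a : (\sum_(x in P) (x == a) = (a \in P))%N.
  case aP: (a \in P); last by rewrite big1 // => x xP; case: eqP => // e'; rewrite -e' xP in aP.
  by rewrite (bigD1 a) //= eqxx big1 ?addn0 // => x /andP[_ /negPf->].
by rewrite big_split /= !c2 /crossing; case: (_ \in P); case: (_ \in P).
Qed.

Lemma leaf_pair_cut t s : cut_size F [set t] = 1%N -> cut_size F [set s] = 2%N ->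
  link F t s -> (2 < #|U|)%N -> cut_size F [set t; s] = 1%N.
Proof.
move=> ct cs lts U3; have ts : t != s := adjacent_neq (link_adjacent lts).
have := sum_cut_in [set t; s]; rewrite big_setU1 ?inE //= big_set1 ct cs.
have : (0 < cut_size F [set t; s])%N.
  apply: spF => [x y ->//|]; apply/andP; split; first by apply/set0Pn; exists t; rewrite !inE eqxx.
  by apply: contraTneq U3 => e; rewrite -cardsT -e cards2 ts.
suff : (0 < count (fun e => (e.1 \in [set t; s]) && (e.2 \in [set t; s])) F)%N by lia.
rewrite -has_count; apply/hasP.
by case/orP: lts => h; [exists (t, s) | exists (s, t)]; rewrite // !inE /= !eqxx ?orbT.
Qed.

(* The moment of [depth l - 2] against [z_K - z_K(s)] vanishes, but [t] is the
   only vertex contributing to it. *)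
Lemma mixed_ends J K t s b t' s' b' : J != K -> K \in used -> t != t' -> t != s' -> s != t' -> s != s' ->
  (forall l, l \in used -> l != J -> l != K -> degree l = 2%N) ->
  (forall x y, link F x y -> K \in changed x y ->
     [set x; y] \in [:: [set t; s]; [set t'; s']; [set s'; b']]) ->
  (forall x, x != t -> x != t' -> cut_size F [set x] = 2%N) ->
  (forall x, link F t x -> x = s) -> (forall x, link F t' x -> x = s') ->
  (forall x, link F s' x -> x = t' \/ x = b') ->
  link F t s -> link F t' s' -> link F s b -> cut_size F [set t; s] = 1%N -> b \notin [set t; s] ->
  changed t s = [set J; K] -> changed t' s' = [set J; K] ->
  J \in changed s b -> K \notin changed s b -> False.
Proof.
move=> JK Ku tt' ts' st' ss' d2 Kkeys cut2 Nt Nt' Ns' lts lt's' lsb cD bD cts ct's' Jsb Ksb.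
have [l [csb lJ]] : exists l, changed s b = [set J; l] /\ l != J.
  have /andP[/cards2P[i [j [ij e]]] _] := link_adjacent lsb.
  move: Jsb; rewrite e !inE => /orP[] /eqP ->; [exists j | exists i]; rewrite // 1?setUC //.
  by rewrite eq_sym.
have lK : l != K by apply: contraNneq Ksb => <-; rewrite csb !inE eqxx orbT.
have lch : l \in changed s b by rewrite csb !inE eqxx orbT.
have lu : l \in used by apply: (subsetP (changed_used s b)).
have dl := d2 l lu lJ lK.
have stD : s \in [set t; s] by rewrite !inE eqxx orbT.
have cst x : x \in [set t; s] -> z x l = z s l.
  rewrite !inE => /orP[] /eqP -> //; have : l \notin changed t s.
    by rewrite cts !inE negb_or lJ.
  by rewrite inE negbK => /eqP.
have nl : z b l != z s l by move: lch; rewrite inE eq_sym.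
have [rl Dl cl] := end_level lu dl lsb stD bD cD cst nl.
pose Q x := (x != t) && (x != s') && (x != t').
pose P := [set x | Q x && (z x K != z s K)].
have exitP a c : a \in P -> c \notin P -> link F a c -> c = s' /\ a = b'.
  rewrite !inE => /andP[/andP[/andP[at_ as_] at'] aK] cP lac.
  have [ect|ct] := eqVneq c t.
    by rewrite ect linkC in lac; rewrite (Nt _ lac) eqxx in aK.
  have [ect'|ct'] := eqVneq c t'.
    by rewrite ect' linkC in lac; rewrite (Nt' _ lac) eqxx in as_.
  have [ecs'|cs'] := eqVneq c s'.
    by rewrite ecs' linkC in lac; case: (Ns' _ lac) => // e; rewrite e eqxx in at'.
  move: cP; rewrite /Q ct ct' cs' /= negbK => /eqP cK.
  have aKc : K \in changed a c by rewrite inE cK.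
  have := Kkeys _ _ lac aKc; rewrite !inE => /or3P[] /eqP/setP e.
  - by have := e t; rewrite !inE eqxx ![t == _]eq_sym (negPf at_) (negPf ct).
  - by have := e t'; rewrite !inE eqxx ![t' == _]eq_sym (negPf at') (negPf ct').
  by have := e s'; rewrite !inE eqxx ![s' == _]eq_sym (negPf as_) (negPf cs').
have sP : s \notin P by rewrite inE eqxx andbF.
(* The only edge leaving [P] could be the one from [b'] to [s'], so [P] together with [s'] and [t']
   would have no exit at all. *)
have P0 x : x \notin P.
  apply/negP => xP; have [a [c [aP cP lac]]] := exit_edge xP sP.
  have [ec ea] := exitP _ _ aP cP lac; rewrite {}ea in aP.
  have b'U : b' \in P :|: [set s'; t'] by rewrite in_setU aP.
  have sU : s \notin P :|: [set s'; t'] by rewrite !(in_setU, in_set1) !negb_or sP ss' st'.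
  have [a' [c' [a'P c'P l']]] := exit_edge b'U sU.
  move: a'P c'P; rewrite !(in_setU, in_set1) !negb_or => + /and3P[c'P c's' c't'].
  case/or3P => [a'P|/eqP e|/eqP e].
  - by have [e _] := exitP a' c' a'P c'P l'; rewrite e eqxx in c's'.
  - rewrite e in l'; case: (Ns' _ l') => e'; first by rewrite e' eqxx in c't'.
    by rewrite e' aP in c'P.
  by rewrite e in l'; rewrite (Nt' _ l') eqxx in c's'.
have same : depth l s b t' = depth l s b s'.
  have : l \notin changed t' s' by rewrite ct's' !inE negb_or lJ.
  by rewrite inE negbK /depth => /eqP ->.
(* Otherwise the set of depth 2 contains no leaf: all its vertices have degree 2, an even degree
   sum, although a single edge leaves the set. *)
have two : depth l s b s' = 2.
  apply/eqP; apply: contraT => n2; have := sum_cut_in [set x | depth l s b x == 2].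
  rewrite cl (eq_bigr (fun=> 2%N)) ?sum_nat_const => [|x].
    by move: #|_| (count _ _); clear=> a c; lia.
  rewrite inE => /eqP x2; apply: cut2; apply/eqP => e; rewrite e in x2; last by rewrite -same x2 in n2.
  by have := Dl t; rewrite x2 !inE eqxx.
have Kt : z t K != z s K.
  by have : K \in changed t s; [rewrite cts !inE eqxx orbT | rewrite inE].
have [s0 s1] := d_rel.
pose u : rat := (z b l - z s l)%:~R.
have : \sum_x d x * ((depth l s b x)%:~R - 2) * ((z x K)%:~R - (z s K)%:~R) = 0.
  rewrite (eq_bigr (fun x => u * (d x * (z x l)%:~R * (z x K)%:~R)
    - (u * (z s l)%:~R + 2) * (d x * (z x K)%:~R)
    - u * (z s K)%:~R * (d x * (z x l)%:~R)
    + (u * (z s l)%:~R + 2) * (z s K)%:~R * d x)) => [|x _]; last first.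
    by rewrite /depth -/u rmorphM /= -/u rmorphB /=; ring.
  by rewrite !(big_split, sumrN) /= -!big_distrr /= (z_diag d_rel lK) !s1 s0; ring.
rewrite (bigD1 t) //= big1 => [|x xt].
  have -> : depth l s b t = 0 by apply/eqP; rewrite -Dl !inE eqxx.
  move/eqP; rewrite addr0 !mulf_eq0 (negPf (d_all t)) /=.
  by rewrite subr_eq0 eqr_int (negPf Kt).
have [->|xs'] := eqVneq x s'; first by rewrite two; ring.
have [->|xt'] := eqVneq x t'; first by rewrite same two; ring.
have := P0 x; rewrite inE /Q xt xs' xt' /= negbK => /eqP ->; ring.
Qed.

(** The three edges changing [J] are the two leaf edges and [(u, v)], so no further edge changes
    both [J] and [K], and by [leaf_big] there is no further leaf: the tree is a path from [t] to
    [t']. The edges next to the two leaf edges change one of [J] and [K] each, and not the same one,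
    which is the situation of [mixed_ends]. *)
Lemma mixed_pair J K t s t' s' : J != K -> J \in used -> K \in used ->
  degree J = 3%N -> degree K = 3%N -> 
  (forall l, l \in used -> l != J -> l != K -> degree l = 2%N) ->
  t != t' -> cut_size F [set t] = 1%N -> cut_size F [set t'] = 1%N ->
  link F t s -> link F t' s' ->
  changed t s = [set J; K] -> changed t' s' = [set J; K] ->
  (exists x y, [/\ link F x y, J \in changed x y & changed x y != [set J; K]]) -> False.
Proof.
move=> JK Ju Ku dJ dK d2 tt' ct ct' lts lt's' cts ct's' [u [v [luv Juv nuv]]].
have KJ : K != J by rewrite eq_sym.
have KJe : [set K; J] = [set J; K] by rewrite setUC.
have U4 : (4 <= #|U|)%N by rewrite -sF ltnS -dJ count_size.
have chC x y : changed x y = changed y x by rewrite /changed; under eq_finset do rewrite eq_sym.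
have Nleaf r q : cut_size F [set r] = 1%N -> link F r q -> forall x, link F r x -> x = q.
  by move=> cr lrq x lrx; have [w [_ _ h]] := leaf_link cr; rewrite (h x lrx) (h q lrq).
have Nt := Nleaf _ _ ct lts; have Nt' := Nleaf _ _ ct' lt's'.
have small (A : {set U}) x : x \in A -> (#|A| < #|U|)%N -> exists a b, [/\ a \in A, b \notin A & link F a b].
  move=> xA; rewrite -cardsT => ltA.
  suff /subsetPn[y _ yA] : ~~ ([set: U] \subset A) by apply: exit_edge xA yA.
  by apply: contraL ltA => /subset_leq_card; rewrite leqNgt.
have not_pair r q : cut_size F [set r] = 1%N -> link F r q -> (forall x, link F q x -> x = r) -> False.
  move=> cr lrq Nq; have Nr := Nleaf _ _ cr lrq.
  have [||a [b [+ bA lab]]] := @small [set r; q] r; first by rewrite !inE eqxx.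
    by apply: leq_trans U4; rewrite cards2; case: (r != q).
  rewrite !inE => /orP[] /eqP e; rewrite e in lab.
    by rewrite (Nr _ lab) !inE eqxx orbT in bA.
  by rewrite (Nq _ lab) !inE eqxx in bA.
have st' : s != t'.
  by apply/eqP => e; apply: (not_pair t s ct lts) => x; rewrite e => /Nt' ->;
    apply/esym/Nt'; rewrite -e linkC.
have ts' : t != s'.
  by apply/eqP => e; apply: (not_pair t' s' ct' lt's') => x; rewrite -e => /Nt ->;
    apply/esym/Nt; rewrite e linkC.
have keys_ne : [set t; s] != [set t'; s'].
  by apply/eqP => /setP/(_ t); rewrite !inE eqxx (negPf tt') (negPf ts').
have key_ch x y x' y' : [set x; y] = [set x'; y'] -> x != y -> changed x y = changed x' y'.
  by move=> e xy; case: (pair_eq e xy) => [][-> ->].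
have lneq x y : link F x y -> x != y by move/link_adjacent/adjacent_neq.
have keys3 i x0 y0 : i \in [set J; K] -> link F x0 y0 -> i \in changed x0 y0 -> changed x0 y0 != [set J; K] ->
    forall x y, link F x y -> i \in changed x y ->
      [set x; y] \in [:: [set t; s]; [set t'; s']; [set x0; y0]].
  move=> iJK l0 i0 n0 x y lxy ixy; apply: contraT => nk.
  have := @degree_keys i [:: [set x; y]; [set t; s]; [set t'; s']; [set x0; y0]].
  have -> : degree i = 3%N by move: iJK; rewrite !inE => /orP[] /eqP ->.
  move=> h; suff: (4 <= 3)%N by []; apply: h.
    rewrite /= nk !inE negb_or keys_ne !andbT /=; apply/andP; split;
      apply: contraNneq n0 => e; rewrite -(key_ch _ _ _ _ e) ?lneq // ?cts ?ct's' //.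
  move=> k; rewrite !inE => /or4P[] /eqP ->; [exists x, y | exists t, s | exists t', s' | exists x0, y0];
    by rewrite ?cts ?ct's'.
have Jin : J \in [set J; K] by rewrite !inE eqxx.
have Kin : K \in [set J; K] by rewrite !inE eqxx orbT.
have pair_link x y : link F x y -> changed x y = [set J; K] ->
    [set x; y] = [set t; s] \/ [set x; y] = [set t'; s'].
  move=> lxy cxy; have := keys3 J u v Jin luv Juv nuv x y lxy; rewrite cxy => /(_ Jin).
  rewrite !inE => /or3P[] /eqP e; [by left | by right |].
  by case/negP: nuv; rewrite -(key_ch _ _ _ _ e) ?lneq // cxy.
have no_leaf r : r != t -> r != t' -> cut_size F [set r] != 1%N.
  move=> rt rt'; apply/eqP => cr; have [q [rq lrq Nr]] := leaf_link cr.
  have [i [j [e ij iu ju [di dj]]]] := leaf_big cr lrq.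
  have mem k : k \in used -> (2 < degree k)%N -> k \in [set J; K].
    move=> ku dk; rewrite !inE; apply: contraLR dk; rewrite negb_or => /andP[kJ kK].
    by rewrite d2.
  have {}e : changed r q = [set J; K].
    apply/eqP; rewrite eqEcard e subUset !sub1set !mem //= !cards2 ij; by case: (J != K).
  have aux w w' : cut_size F [set w] = 1%N -> link F w w' -> r != w -> [set r; q] = [set w; w'] -> False.
    move=> cw lw rw er; case: (pair_eq er rq) => [[e' _]|[e1 e2]].
      by rewrite e' eqxx in rw.
    by apply: (not_pair w w' cw lw) => x; rewrite -e1 => /Nr ->.
  by case: (pair_link _ _ lrq e); apply: aux.
have cut2 x : x != t -> x != t' -> cut_size F [set x] = 2%N.
  have pos y : (0 < cut_size F [set y])%N.
    by apply: spF => [a b ->//|]; apply: proper_part1; apply: leq_trans U4.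
  (* Degrees raised by 1 at the two leaves: they are at least 2 and have average 2, hence all equal
     2. *)
  pose g y := (cut_size F [set y] + ((y == t) + (y == t')))%N.
  have g2 y : (2 <= g y)%N.
    rewrite /g; have [->|yt] := eqVneq y t; first by rewrite ct.
    have [->|yt'] := eqVneq y t'; first by rewrite ct'.
    by have := no_leaf y yt yt'; have := pos y; case: (cut_size _ _) => [|[|]].
  have ind q : (\sum_(y : U) (y == q) = 1)%N.
    by rewrite (bigD1 q) //= eqxx big1 // => y /negPf ->.
  have sg : (\sum_y g y = \sum_(y : U) 2)%N.
    have ne : all (fun e => e.1 != e.2) F by apply: sub_all aF => e; apply: adjacent_neq.
    rewrite sum_nat_const big_split /= sum_cut1 // big_split /= !ind.
    by rewrite -sF muln2 doubleS addn2.
  move=> xt xt'; have : g x = 2%N.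
    apply/eqP; rewrite eqn_leq g2 andbT; rewrite (bigD1 x) //= [RHS](bigD1 x) //= in sg.
    have : (\sum_(i | i != x) 2 <= \sum_(i | i != x) g i)%N by apply: leq_sum.
    by move: sg; move: (\sum_(i | _) _)%N (\sum_(i | _) _)%N (g x); clear=> a1 a2 a3; lia.
  by rewrite /g (negPf xt) (negPf xt') !addn0.
have nst : s != t by rewrite eq_sym lneq.
have ns't' : s' != t' by rewrite eq_sym lneq.
have s't : s' != t by rewrite eq_sym.
have cD := leaf_pair_cut ct (cut2 s nst st') lts (ltnW U4).
have cD' := leaf_pair_cut ct' (cut2 s' s't ns't') lt's' (ltnW U4).
have next r q : cut_size F [set r; q] = 1%N -> (forall x, link F r x -> x = q) ->
    exists b, [/\ b \notin [set r; q], link F q b & forall x, link F q x -> x = r \/ x = b].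
  move=> crq Nr; have [||a [b [+ bA lab]]] := @small [set r; q] r; first by rewrite !inE eqxx.
    by apply: leq_trans U4; rewrite cards2; case: (r != q).
  rewrite !inE => /orP[] /eqP e; rewrite e in lab.
    by rewrite (Nr _ lab) !inE eqxx orbT in bA.
  exists b; split=> // x lqx; have [xr|xr] := eqVneq x r; [by left | right].
  have qA : q \in [set r; q] by rewrite !inE eqxx orbT.
  have xA : x \notin [set r; q] by rewrite !inE negb_or xr eq_sym lneq.
  by have [_ ->] := cut1_uniq crq qA bA lab qA xA lqx.
have [b [bD lsb Ns]] := next t s cD Nt.
have [b' [bD' lsb' Ns']] := next t' s' cD' Nt'.
have ss' : s != s'.
  apply/eqP => e; have eb : b = t'.
    by case: (Ns t') => // [|e']; [rewrite e linkC | rewrite e' eqxx in tt'].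
  have [||a [c [+ cA lac]]] := @small [set t; s; t'] t; first by rewrite !inE eqxx.
    apply: leq_trans U4; rewrite ltnS; apply: leq_trans (leq_card_setU _ _) _.
    by rewrite cards1 cards2 addn1; case: (t != s).
  rewrite !inE -orbA => /or3P[] /eqP e'; rewrite e' in lac; move: cA.
  - by rewrite (Nt _ lac) !inE eqxx orbT.
  - by case: (Ns _ lac) => ->; rewrite !inE ?eb !eqxx ?orbT.
  by rewrite (Nt' _ lac) -e !inE eqxx orbT.
(* Otherwise both coordinates changed by this edge have degree 2 and are constant on [[set r; q]],
   which [no_joint_end] excludes. *)
have one r q c : cut_size F [set r; q] = 1%N -> changed r q = [set J; K] ->
    link F q c -> c \notin [set r; q] -> J \notin changed q c -> K \in changed q c.
  move=> crq chrq lqc cA nJ; apply: contraT => nK.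
  have /andP[/cards2P[i [l [il e]]] _] := link_adjacent lqc.
  have prop k : k \in changed q c -> [/\ k \in used, degree k = 2%N, z c k != z q k &
      forall x, x \in [set r; q] -> z x k = z q k].
    move=> kq; have ku := subsetP (changed_used q c) _ kq.
    have kJ : k != J by apply: contraNneq nJ => <-.
    have kK : k != K by apply: contraNneq nK => <-.
    split=> //; [exact: d2 | by move: kq; rewrite inE eq_sym|].
    move=> x; rewrite !inE => /orP[] /eqP -> //; have : k \notin changed r q.
      by rewrite chrq !inE negb_or kJ.
    by rewrite inE negbK => /eqP.
  have [|iu di ni hi] := prop i; first by rewrite e !inE eqxx.
  have [|lu dl nl hl] := prop l; first by rewrite e !inE eqxx orbT.
  have qA : q \in [set r; q] by rewrite !inE eqxx orbT.
  by have := no_joint_end il iu lu di dl lqc qA cA crq hi hl ni nl.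
have not_both q c : link F q c -> [set q; c] != [set t; s] -> [set q; c] != [set t'; s'] ->
    J \in changed q c -> K \notin changed q c.
  move=> lqc n1 n2 Jq; apply/negP => Kq; have e : changed q c = [set J; K].
    apply/esym/eqP; rewrite eqEcard subUset !sub1set Jq Kq /= cards2 JK.
    by have /andP[/eqP -> _] := link_adjacent lqc.
  by case: (pair_link _ _ lqc e) => e'; rewrite e' eqxx in n1 n2.
have k1 : [set s; b] != [set t; s].
  by apply/eqP => /setP/(_ b); rewrite !inE eqxx orbT; move: bD; rewrite !inE => /negPf ->.
have k2 : [set s; b] != [set t'; s'].
  by apply/eqP => /setP/(_ s); rewrite !inE eqxx (negPf st') (negPf ss').
have k3 : [set s'; b'] != [set t'; s'].
  by apply/eqP => /setP/(_ b'); rewrite !inE eqxx orbT; move: bD'; rewrite !inE => /negPf ->.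
have k4 : [set s'; b'] != [set t; s].
  by apply/eqP => /setP/(_ s'); rewrite !inE eqxx [s' == t]eq_sym (negPf ts') [s' == s]eq_sym (negPf ss').
have not_both' q c : link F q c -> [set q; c] != [set t; s] -> [set q; c] != [set t'; s'] ->
    ~~ ((J \in changed q c) && (K \in changed q c)).
  move=> l1 n1 n2; apply/negP => /andP[Jq Kq]; case/negP: (not_both q c l1 n1 n2 Jq); exact: Kq.
have nch q c i : i \in [set J; K] -> ~~ ((J \in changed q c) && (K \in changed q c)) ->
   i \in changed q c -> changed q c != [set J; K].
  by move=> _ h _; apply: contraNneq h => ->; rewrite !inE !eqxx orbT.
(* Besides the leaf edges only one edge changes [i], so [(s, b)] and [(s', b')] would coincide. The
   tree would have at most four vertices, and [k], of degree 3, would change along every edge,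
   including this one. *)
have same i k : i \in [set J; K] -> k \in [set J; K] -> i != k ->
    i \in changed s b -> i \in changed s' b' -> False.
  move=> iin kin ik is_ is'.
  have n0 := nch _ _ i iin (not_both' _ _ lsb k1 k2) is_.
  have := keys3 i s b iin lsb is_ n0 s' b' lsb' is'; rewrite !inE (negPf k3) (negPf k4) /=.
  move/eqP/setP => E; have := E s; rewrite !inE eqxx (negPf ss') /= => /eqP eb'.
  have := E s'; rewrite !inE eqxx [s' == s]eq_sym (negPf ss') /= => /esym/eqP eb.
  have T : (#|U| <= 4)%N.
    rewrite leqNgt; apply/negP => U5.
    have [||a [c [+ cA lac]]] := @small ([set t; s] :|: [set t'; s']) t; first by rewrite !inE eqxx.
      apply: leq_trans U5; rewrite ltnS; apply: leq_trans (leq_card_setU _ _) _.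
      by rewrite !cards2; case: (t != s); case: (t' != s').
    rewrite !inE -orbA => /or4P[] /eqP e'; rewrite e' in lac; move: cA.
    - by rewrite (Nt _ lac) !inE eqxx orbT.
    - by case: (Ns _ lac) => ->; rewrite !inE -?eb ?eqxx ?orbT.
    - by rewrite (Nt' _ lac) !inE eqxx !orbT.
    by case: (Ns' _ lac) => ->; rewrite !inE -?eb' ?eqxx ?orbT.
  have dk : degree k = 3%N by move: kin; rewrite !inE => /orP[] /eqP ->.
  have /allP ak : all (fun e => z e.1 k != z e.2 k) F.
    by rewrite all_count -/(degree k) dk; apply/eqP; move: sF T U4; clear; lia.
  have ksb : k \in changed s b.
    by rewrite inE; case/orP: lsb => /ak //=; rewrite eq_sym.
  case/negP: (not_both' _ _ lsb k1 k2).
  move: iin kin ik is_ ksb; rewrite !inE => /orP[] /eqP -> /orP[] /eqP -> ; rewrite ?eqxx // => _ -> -> //.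
have t't : t' != t by rewrite eq_sym.
have s's : s' != s by rewrite eq_sym.
have t's : t' != s by rewrite eq_sym.
have nb1 := not_both' _ _ lsb k1 k2; have nb2 := not_both' _ _ lsb' k4 k3.
case Jsb : (J \in changed s b).
  have nJ' : J \notin changed s' b' by apply/negP => h; apply: (@same J K).
  have K' := one _ _ _ cD' ct's' lsb' bD' nJ'.
  have Ksb : K \notin changed s b by move: nb1; rewrite Jsb.
  apply: (@mixed_ends J K t s b t' s' b') => //.
  by apply: keys3 => //; apply: nch nb2 K'.
have Ksb := one _ _ _ cD cts lsb bD (negbT Jsb).
have nK' : K \notin changed s' b' by apply/negP => h; apply: (@same K J).
have J' : J \in changed s' b' by apply: contraT => nJ'; have := one _ _ _ cD' ct's' lsb' bD' nJ'; rewrite (negPf nK').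
apply: (@mixed_ends K J t s b t' s' b') => //; rewrite ?KJe ?Jsb //.
  by move=> l lu l1 l2; apply: d2.
by apply: keys3 => //; apply: nch nb2 J'.
Qed.

Lemma tree_contradiction : False.
Proof.
have ne : all (fun e => e.1 != e.2) F by apply: sub_all aF => e; apply: adjacent_neq.
have [t [t' [tt' ct ct']]] := two_leaves ne sF spF card_gt1.
have [s [_ lts _]] := leaf_link ct; have [s' [_ lt's' _]] := leaf_link ct'.
have [J [K [cts JK Ju Ku [dJ dK]]]] := leaf_big ct lts.
have [i [j [ct's' ij iu ju [di dj]]]] := leaf_big ct' lt's'.
have {dJ dK} [dJ dK d2] := two_big_degrees JK Ju Ku dJ dK.
have mem k : k \in used -> (2 < degree k)%N -> k \in [set J; K].
  move=> ku dk; rewrite !inE; apply: contraLR dk; rewrite negb_or => /andP[kJ kK].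
  by rewrite d2.
have {}ct's' : changed t' s' = [set J; K].
  apply/eqP; rewrite eqEcard ct's' subUset !sub1set !mem //= !cards2 ij; by case: (J != K).
have [h|] := boolP [forall x, forall y, link F x y && ((J \in changed x y) || (K \in changed x y)) ==>
    (changed x y == [set J; K])].
  apply: (not_only_pair JK Ju (only_pair d2 _)) => x y lxy h'.
  by have /forallP/(_ x)/forallP/(_ y) := h; rewrite lxy h' => /eqP.
rewrite negb_forall => /existsP[x]; rewrite negb_forall => /existsP[y].
rewrite negb_imply => /andP[/andP[lxy /orP[h|h]] n].
  by apply: (mixed_pair JK Ju Ku dJ dK d2 tt' ct ct' lts lt's' cts ct's'); exists x, y.
have e : [set K; J] = [set J; K] by rewrite setUC.
have KJ : K != J by rewrite eq_sym.
apply: (@mixed_pair K J t s t' s'); rewrite ?e //; last by exists x, y.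
by move=> l lu l1 l2; apply: d2.
Qed.

End Tree.

Lemma minimal_contradiction : False.
Proof. by have [F [sF aF spF]] := ex_spanning; apply: (tree_contradiction sF aF spF). Qed.

End Moments.

(* A minimal configuration carrying a relation is ruled out by
   [minimal_contradiction]; here one passes to a smallest connected subset. *)
Lemma diagonal_moments_independent (U I : finType) (z : U -> I -> int) :
  (forall x y, (forall i, z x i = z y i) -> x = y) -> connected z [set: U] ->
  (forall x, exists k, \sum_i z x i = 2 * k) ->
  (forall x y i, changed z x y = [set i] -> (`|z x i - z y i| != 2)%N) ->
  diagonal_moments z -> forall d, affine_relation z d -> forall x, d x = 0.
Proof.
have [k] := ubnP #|U|; elim: k U z => // k IH U z ltU inj conn even no2 diag d rel.
suff min A : connected z A -> A != [set: U] -> forall d, affine_relation z d ->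
    (forall x, x \notin A -> d x = 0) -> forall x, d x = 0.
  move=> x; apply/eqP; apply: contraT => dx.
  by case: (minimal_contradiction inj conn diag min rel (ex_intro _ x dx) even no2).
move=> cA nA d1 rel1 d1A.
pose T : finType := {x in A}; pose zT (x : T) := z (val x).
have sumT (f : U -> rat) : (forall x, x \notin A -> f x = 0) -> \sum_(x : T) f (val x) = \sum_x f x.
  move=> h; rewrite [RHS](bigID (mem A)) /= [X in _ + X]big1 ?addr0 => [|x /h//].
  by rewrite [RHS]big_sub.
pose ext (e : T -> rat) x := if insub x is Some u then e u else 0.
have extA e x : x \notin A -> ext e x = 0 by move=> xA; rewrite /ext insubN.
have extE e u : ext e (val u) = e u by rewrite /ext valK.
have extR e : affine_relation zT e -> affine_relation z (ext e).
  move=> [s0 s1]; split.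
    by rewrite -sumT; [under eq_bigr do rewrite extE | apply: extA].
  move=> i; rewrite -sumT => [|x xA]; last by rewrite extA // mul0r.
  by under eq_bigr do rewrite extE; exact: s1.
have rT : affine_relation zT (fun u => d1 (val u)).
  case: rel1 => s0 s1; split; first by rewrite sumT.
  by move=> i; rewrite (sumT (fun x => d1 x * (z x i)%:~R)) // => x xA; rewrite d1A // mul0r.
have hT : forall u : T, d1 (val u) = 0.
  apply: (IH T zT _ _ _ _ _ _ _ rT).
  - rewrite card_sub; apply: (@leq_trans #|U|); last by rewrite -ltnS.
    rewrite -cardsT; apply: proper_card.
    rewrite properE subsetT /=; apply: contra nA => /subsetP h.
    by apply/eqP/setP => x; rewrite [RHS]inE; apply: h.
  - by move=> x y h; apply/val_inj/inj.
  - move=> P _ P0 PT; have [|||x [y [xP yP xy]]] := cA (val @: P).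
    + by apply/subsetP => _ /imsetP[u _ ->]; apply: valP.
    + by case/set0Pn: P0 => u uP; apply/set0Pn; exists (val u); apply: imset_f.
    + apply: contra PT => /eqP e; apply/eqP/setP => u; rewrite inE.
      have : val u \in val @: P by rewrite e; apply: valP.
      by case/imsetP => w wP /val_inj ->.
    case/imsetP: xP => u uP eu; subst x; move: yP; rewrite inE => /andP[yP yA].
    exists u, (Sub y yA); split=> //.
    rewrite !inE andbT; apply: contra yP => h; apply/imsetP.
    by exists (Sub y yA); rewrite ?SubK.
  - by move=> x; apply: even.
  - by move=> x y i e; apply: no2.
  move=> e re i j ij; have := diag _ (extR e re) i j ij.
  rewrite -sumT => [|x xA]; last by rewrite extA // !mul0r.
  by under eq_bigr do rewrite !extE; exact.
move=> x; case xA: (x \in A); last by rewrite d1A ?xA.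
exact: (hT (Sub x xA)).
Qed.

(** In the Smith normal form of [D^T] no diagonal entry vanishes, because [D] has full rank. For [l]
    in the kernel, [l *m P] is therefore supported on the last [r] coordinates, and [l] is an
    integral combination of the last [r] rows of the inverse of [P]. *)
Lemma kernel_lattice n k r (D : 'M[int]_(k, n)) : n = (k + r)%N ->
  row_free (map_mx intr D : 'M[rat]_(k, n)) ->
  exists2 B : 'M[int]_(r, n), row_free (map_mx intr B : 'M[rat]_(r, n)) &
    forall l : 'rV[int]_n, l *m D^T = 0 -> exists a, l = a *m B.
Proof.
move=> en; subst n => fD.
have [P uP [Q uQ [d _ eD]]] := int_Smith_normal_form D^T.
have d0 (j : 'I_k) : d`_j != 0.
  apply/eqP => dj.
  have h : D^T *m (invmx Q *m delta_mx j 0) = 0 :> 'cV_(k + r).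
    rewrite eD -!mulmxA [Q *m _]mulmxA mulmxV // mul1mx -colE.
    suff -> : col j (\matrix_(i, j0) (d`_i *+ (i == j0 :> nat)) : 'M_(k + r, k)) = 0 by rewrite mulmx0.
    by apply/colP => i; rewrite !mxE; case: eqP => [->|_]; rewrite ?dj.
  have h' : (invmx Q *m delta_mx j 0 : 'cV_k)^T *m D = 0.
    by apply: trmx_inj; rewrite trmx_mul trmxK h trmx0.
  have : map_mx intr (invmx Q *m delta_mx j 0 : 'cV_k)^T == 0 :> 'rV[rat]_k.
    by rewrite -(mulmx_free_eq0 _ fD) -map_mxM h' map_mx0.
  move=> /eqP/rowP e0.
  have z : invmx Q *m delta_mx j 0 = 0 :> 'cV_k.
    by apply/colP => i; have := e0 i; rewrite !mxE => /eqP; rewrite intr_eq0 => /eqP.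
  have : Q *m (invmx Q *m delta_mx j 0) = 0 :> 'cV_k by rewrite z mulmx0.
  by rewrite mulmxA mulmxV // mul1mx => /matrixP/(_ j 0); rewrite !mxE !eqxx.
exists (dsubmx (invmx P)).
  rewrite -kermx_eq0; apply/rowV0P => c /sub_kermxP hc.
  have e : row_mx 0 c *m map_mx intr (invmx P) = 0 :> 'rV[rat]_(k + r).
    by rewrite -[map_mx _ _]vsubmxK mul_row_col mul0mx add0r -map_dsubmx hc.
  have := congr1 (fun A => A *m map_mx intr P) e.
  rewrite mul0mx -mulmxA -map_mxM mulVmx // map_mx1 mulmx1 => /(congr1 rsubmx).
  by rewrite row_mxKr raddf0.
move=> l hl; exists (rsubmx (l *m P)).
have zero : lsubmx (l *m P) = 0.
  apply/rowP => j; have h : l *m P *m (\matrix_(i, j0) (d`_i *+ (i == j0 :> nat))) = 0 :> 'rV_k.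
    have := congr1 (fun A => A *m invmx Q) hl.
    by rewrite eD !mulmxA mulmxK // mul0mx.
  have /rowP/(_ j) := h; rewrite mxE (bigD1 (lshift r j)) //= big1 => [|i ij].
    rewrite addr0 [X in _ * X]mxE /= eqxx mulr1n [RHS]mxE => /eqP.
    rewrite mulf_eq0 (negPf (d0 j)) orbF => /eqP e.
    by rewrite [RHS]mxE -[RHS]e mxE.
  rewrite [X in _ * X]mxE; case: eqP => e; last by rewrite mulr0n mulr0.
  by case/eqP: ij; apply: val_inj.
rewrite -[LHS]mulmx1 -(mulmxV uP) mulmxA -{1}[l *m P]hsubmxK zero.
by rewrite -{1}[invmx P]vsubmxK mul_row_col mul0mx add0r.
Qed.

(** Passage to the limit [h = 0], made explicit over the rationals: if the constant term [d0] of the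
    difference were positive, it would still dominate at [h = d0 / (d0 + s)], where [s] is the sum
    of the absolute values of the other coefficients. *)
Lemma quartic_limit (a0 a1 a2 b0 b1 b2 c0 c1 c2 : rat) :
  (forall h, h != 0 -> (a0 + h * a1 + h ^+ 2 * a2) ^+ 2 <=
     (b0 + h * b1 + h ^+ 2 * b2) * (c0 + h * c1 + h ^+ 2 * c2)) ->
  a0 ^+ 2 <= b0 * c0.
Proof.
move=> hyp; rewrite leNgt; apply/negP; rewrite -subr_gt0.
pose d1 := 2 * a0 * a1 - b0 * c1 - b1 * c0.
pose d2 := a1 ^+ 2 + 2 * a0 * a2 - b0 * c2 - b2 * c0 - b1 * c1.
pose d3 := 2 * a1 * a2 - b1 * c2 - b2 * c1.
pose d4 := a2 ^+ 2 - b2 * c2.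
set d0 := a0 ^+ 2 - b0 * c0 => d0_gt0.
pose s := `|d1| + `|d2| + `|d3| + `|d4|.
have s0 : 0 <= s by rewrite !addr_ge0.
have t0 : 0 < d0 + s by rewrite ltr_wpDr.
pose h := d0 / (d0 + s).
have h0 : 0 < h by rewrite divr_gt0.
have h1 : h <= 1 by rewrite ler_pdivrMr // mul1r lerDl.
have hs : h * s < d0.
  rewrite /h mulrAC ltr_pdivrMr // ltr_pM2l //; by rewrite ltrDr.
have := hyp h (lt0r_neq0 h0); rewrite -subr_le0.
have -> : (a0 + h * a1 + h ^+ 2 * a2) ^+ 2 -
     (b0 + h * b1 + h ^+ 2 * b2) * (c0 + h * c1 + h ^+ 2 * c2) =
  d0 + h * (d1 + h * d2 + h ^+ 2 * d3 + h ^+ 3 * d4).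
  by rewrite /d0 /d1 /d2 /d3 /d4; ring.
set t := d1 + _ + _ + _; rewrite leNgt => /negP; apply.
suff tb : `|t| <= s.
  have : - (h * t) <= h * s.
    rewrite -mulrN ler_pM2l //; apply: le_trans tb; rewrite -normrN; exact: ler_norm.
  by move: hs; move: (h * t) (h * s) => x y; lra.
have hk k (x : rat) : `|h ^+ k * x| <= `|x|.
  rewrite normrM (ger0_norm (exprn_ge0 k (ltW h0))); apply: ler_piMl => //.
  by apply: exprn_ile1 => //; apply: ltW.
rewrite /t; do 2 (apply: le_trans (ler_normD _ _) _; apply: lerD; last by apply: hk).
by apply: le_trans (ler_normD _ _) _; apply: lerD => //; apply: (hk 1%N).
Qed.

(** * Integer vectors forced to be roots of type A by a quadratic inequality *)

Section ForcedRoot.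
Variables (I : finType) (mu : I -> int) (al be : I).
Implicit Types (phi : I -> rat) (i j : I).

Definition lin_form phi := \sum_i (mu i)%:~R * phi i.
(** The value of [root_level] below, up to its sign, when all [v_i] lie on a line with abscissas
    [phi]. *)
Definition line_form phi := 2^-1 * (\sum_i (mu i)%:~R * phi i ^+ 2
  - lin_form phi ^+ 2 - lin_form phi * (phi al + phi be)).

Lemma sum_ind i (f : I -> rat) : \sum_k f k * (k == i)%:R = f i.
Proof.
by rewrite (bigD1 i) //= eqxx mulr1 big1 ?addr0 // => k /negPf ->; rewrite mulr0.
Qed.

Definition two_points i j (x y : rat) k : rat := x * (k == i)%:R + y * (k == j)%:R.

Lemma lin_two i j x y : lin_form (two_points i j x y) =
  (mu i)%:~R * x + (mu j)%:~R * y.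
Proof.
rewrite /lin_form (eq_bigr (fun k => (mu k)%:~R * x * (k == i)%:R +
  (mu k)%:~R * y * (k == j)%:R)) => [|k _]; last by rewrite /two_points; ring.
by rewrite big_split /= (sum_ind i (fun k => (mu k)%:~R * x)) (sum_ind j (fun k => (mu k)%:~R * y)).
Qed.

Lemma sqr_two i j x y : i != j -> \sum_k (mu k)%:~R * two_points i j x y k ^+ 2 =
  (mu i)%:~R * x ^+ 2 + (mu j)%:~R * y ^+ 2.
Proof.
move=> ij; rewrite -(lin_two i j); apply: eq_bigr => k _; congr (_ * _).
rewrite /two_points; have [->|ki] := eqVneq k i; first by rewrite (negPf ij) /=; ring.
by case: (k == j) => /=; ring.
Qed.

Hypothesis albe : al != be.
Hypothesis mu0 : \sum_i mu i = 0.
Hypothesis mu_neq0 : exists i, mu i != 0.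
Hypothesis bound : forall phi,
  line_form phi ^+ 2 <= 4^-1 * (phi al - phi be) ^+ 2 * lin_form phi ^+ 2.

(** The test function is the combination of the indicators of [a] and [b] that kills [lin_form]; the
    bound then reads [mu a * mu b * (mu a + mu b) = 0]. *)
Lemma forced_opposite a b : a != b -> mu a != 0 -> mu b != 0 -> mu b = - mu a.
Proof.
move=> ab ma mb; pose phi := two_points a b (mu b)%:~R (- (mu a)%:~R).
have l0 : lin_form phi = 0 by rewrite lin_two; ring.
have := bound phi; rewrite l0 expr0n mulr0 => h.
have {h} : line_form phi == 0 by rewrite -sqrf_eq0 eq_le h sqr_ge0.
rewrite /line_form l0 sqr_two // !mul0r expr0n !subr0 mulf_eq0 invr_eq0 /=.
have -> : (mu a)%:~R * (mu b)%:~R ^+ 2 + (mu b)%:~R * (- (mu a)%:~R) ^+ 2 =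
  (mu a)%:~R * (mu b)%:~R * (mu a + mu b)%:~R :> rat by rewrite rmorphD /=; ring.
by rewrite !mulf_eq0 !intr_eq0 (negPf ma) (negPf mb) /=; lia.
Qed.

(** Nonzero entries are pairwise opposite, so there are exactly two of them, [c] and [-c]. After
    cancelling [lin_form], the bound is tested on the indicators of [i] and [j]; this puts [i] in
    [[set al; be]] and gives [c = 1]. *)
Lemma forced_root : exists i j, [/\ i != j, i \in [set al; be] &
  forall k, mu k = (k == j)%:R - (k == i)%:R].
Proof.
have [j mj] : exists j, 0 < mu j.
  case: (mu_neq0) => i mi; have [|m0] := ltP 0 (mu i); first by exists i.
  have [/existsP//|] := boolP [exists j, 0 < mu j]; rewrite negb_exists => /forallP h.
  have : \sum_i mu i < 0.
    rewrite (bigD1 i) //= -[X in _ < X]addr0 ltr_leD //; first by rewrite lt_neqAle mi.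
    by apply: sumr_le0 => k _; rewrite leNgt.
  by rewrite mu0.
have [i [ij mi]] : exists i, i != j /\ mu i != 0.
  have [/existsP[i /andP[h1 h2]]|] := boolP [exists i, (i != j) && (mu i != 0)]; first by exists i.
  rewrite negb_exists => /forallP h; have := mu0; rewrite (bigD1 j) //= big1.
    by rewrite addr0 => e; rewrite e in mj.
  by move=> k kj; apply/eqP; have := h k; rewrite kj /= negbK.
have mj0 : mu j != 0 by rewrite gt_eqF.
have emi : mu i = - mu j by apply: forced_opposite; rewrite // eq_sym.
have m0 k : k != i -> k != j -> mu k = 0.
  move=> ki kj; apply/eqP; apply: contraT => mk.
  have h1 := forced_opposite kj mk mj0; have h2 := forced_opposite ki mk mi.
  by move: mj0 h1 h2 emi; clear; lia.
have muE k : mu k = mu j * ((k == j)%:R - (k == i)%:R).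
  have [->|kj] := eqVneq k j; first by rewrite [j == i]eq_sym (negPf ij) /=; ring.
  have [->|ki] := eqVneq k i; first by rewrite emi /=; ring.
  by rewrite m0 //=; ring.
pose c : rat := (mu j)%:~R.
have c0 : 0 < c by rewrite ltr0z.
have linE phi : lin_form phi = c * (phi j - phi i).
  rewrite /lin_form (eq_bigr (fun k => c * phi k * (k == j)%:R - c * phi k * (k == i)%:R)).
    by rewrite sumrB !sum_ind; ring.
  by move=> k _; rewrite muE rmorphM rmorphB /= -/c; case: (k == j); case: (k == i) => /=; ring.
have lineE phi : line_form phi = 2^-1 * c * (phi j - phi i) *
    ((1 - c) * phi j + (1 + c) * phi i - phi al - phi be).
  rewrite /line_form linE.
  have -> : \sum_k (mu k)%:~R * phi k ^+ 2 = c * (phi j ^+ 2 - phi i ^+ 2).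
    exact: linE (fun k => phi k ^+ 2).
  by ring.
have key phi : phi j != phi i ->
    ((1 - c) * phi j + (1 + c) * phi i - phi al - phi be) ^+ 2 <= (phi al - phi be) ^+ 2.
  have aux (d x y : rat) : d != 0 ->
      (2^-1 * c * d * x) ^+ 2 <= 4^-1 * y ^+ 2 * (c * d) ^+ 2 -> x ^+ 2 <= y ^+ 2.
    move=> d0; rewrite (_ : (_ * x) ^+ 2 = 4^-1 * (c * d) ^+ 2 * x ^+ 2); last by field.
    rewrite [X in _ <= X]mulrAC ler_pM2l // mulr_gt0 // exprn_even_gt0 //=.
    by rewrite mulf_neq0 ?d0 ?(lt0r_neq0 c0).
  by rewrite -subr_eq0 => ne; have := bound phi; rewrite lineE linE => /(aux _ _ _ ne).
pose ind a (k : I) : rat := (k == a)%:R.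
have iab : i \in [set al; be].
  rewrite !inE; apply: contraT; rewrite negb_or => /andP[ia ib].
  have := key (ind i); rewrite /ind !eqxx (eq_sym j) (negPf ij) (eq_sym al) (negPf ia) (eq_sym be) (negPf ib).
  move=> /(_ isT); rewrite !subr0 expr0n /= mulr0 mulr1 add0r.
  rewrite leNgt => /negP[]; rewrite exprn_even_gt0 //=; apply: lt0r_neq0; exact: addr_gt0.
have c1 : c = 1.
  have [jab|jab] := boolP (j \in [set al; be]).
    have : c <= 1.
      have h x : (1 + c - x) ^+ 2 <= 1 -> x = 1 -> c <= 1.
        by move=> hh e; move: hh; rewrite e addrC addKr expr_le1 // ltW.
      have := key (ind i); rewrite /ind eqxx (eq_sym j) (negPf ij) => /(_ isT).
      move: iab jab ij; rewrite !inE => /orP[]/eqP -> /orP[]/eqP ->; rewrite ?eqxx // => ne.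
        rewrite ?eqxx (eq_sym be) (negPf albe) /= !(subr0, mulr0, mulr1, add0r) expr1n => hh.
        exact: h hh erefl.
      rewrite ?eqxx (negPf albe) /= !(subr0, sub0r, mulr0, mulr1, add0r) sqrrN expr1n => hh.
      exact: h hh erefl.
    by rewrite /c -[1]/(1%:~R) ler_int => le1; apply/eqP; rewrite eqr_int; move: mj le1; clear; lia.
  move: jab; rewrite !inE negb_or => /andP[ja jb].
  have := key (ind j); rewrite /ind eqxx (negPf ij) (eq_sym al) (negPf ja) (eq_sym be) (negPf jb) => /(_ isT).
  rewrite !(subr0, mulr0, mulr1, addr0) expr0n /= => h; apply/eqP.
  by rewrite -subr_eq0 -oppr_eq0 opprB -sqrf_eq0 eq_le h sqr_ge0.
exists i, j; split=> // k; rewrite muE.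
have -> : mu j = 1 by apply/eqP; rewrite -(eqr_int rat) -/c c1.
by rewrite mul1r.
Qed.

End ForcedRoot.

From mathcomp Require Import boolp perm mpoly.

(** * Thin sets of parameters *)

Section Thin.
Variables m n : nat.
Implicit Types (V : 'M[rat]_(m, n)) (v : 'I_m -> 'rV[int]_n).

Definition rat_mx v : 'M[rat]_(m, n) := \matrix_(i, c) (v i 0 c)%:~R.

Definition polynomial (f : 'M[rat]_(m, n) -> rat) :=
  exists p : {mpoly rat[m * n]}, forall V, p.@[mxvec V 0] = f V.

Lemma polynomial_ext f g : f =1 g -> polynomial f -> polynomial g.
Proof. by move=> fg [p hp]; exists p => V; rewrite hp fg. Qed.

Lemma polynomial_const c : polynomial (fun=> c).
Proof. by exists c%:MP => V; rewrite mevalC. Qed.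

Lemma polynomial_entry i c : polynomial (fun V => V i c).
Proof. by exists 'X_(mxvec_index i c) => V; rewrite mevalXU mxvecE. Qed.

Lemma polynomialD f g : polynomial f -> polynomial g -> polynomial (fun V => f V + g V).
Proof. by move=> [p hp] [q hq]; exists (p + q) => V; rewrite mevalD hp hq. Qed.

Lemma polynomialM f g : polynomial f -> polynomial g -> polynomial (fun V => f V * g V).
Proof. by move=> [p hp] [q hq]; exists (p * q) => V; rewrite mevalM hp hq. Qed.

Lemma polynomialZ a f : polynomial f -> polynomial (fun V => a * f V).
Proof. by apply: polynomialM; apply: polynomial_const. Qed.

Lemma polynomialB f g : polynomial f -> polynomial g -> polynomial (fun V => f V - g V).
Proof.
move=> pf /(polynomialZ (-1)) pg.
by apply: polynomial_ext (polynomialD pf pg) => V; rewrite mulN1r.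
Qed.

Lemma polynomial_sum I (r : seq I) (P : pred I) (F : I -> 'M[rat]_(m, n) -> rat) :
  (forall i, polynomial (F i)) -> polynomial (fun V => \sum_(i <- r | P i) F i V).
Proof.
move=> h; elim: r => [|i r IH].
  by apply: polynomial_ext (polynomial_const 0) => V; rewrite big_nil.
case Pi: (P i).
  by apply: polynomial_ext (polynomialD (h i) IH) => V; rewrite big_cons Pi.
by apply: polynomial_ext IH => V; rewrite big_cons Pi.
Qed.

Lemma polynomial_prod I (r : seq I) (P : pred I) (F : I -> 'M[rat]_(m, n) -> rat) :
  (forall i, polynomial (F i)) -> polynomial (fun V => \prod_(i <- r | P i) F i V).
Proof.
move=> h; elim: r => [|i r IH].
  by apply: polynomial_ext (polynomial_const 1) => V; rewrite big_nil.
case Pi: (P i).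
  by apply: polynomial_ext (polynomialM (h i) IH) => V; rewrite big_cons Pi.
by apply: polynomial_ext IH => V; rewrite big_cons Pi.
Qed.

Lemma polynomial_det r (A : 'M[rat]_(m, n) -> 'M[rat]_r) :
  (forall i j, polynomial (fun V => A V i j)) -> polynomial (fun V => \det (A V)).
Proof.
move=> h; rewrite /determinant; apply: polynomial_sum => s.
by apply: polynomialZ; apply: polynomial_prod => i.
Qed.

(** Bad parameters confined to a hypersurface with an integer equation; finite unions stay thin
    because the equations can be multiplied. *)
Definition thin (bad : ('I_m -> 'rV[int]_n) -> Prop) :=
  exists2 R : {mpoly int[m * n]}, R != 0 & forall v, bad v -> R.@[coordinates v] = 0.

Lemma thin_sub (bad bad' : ('I_m -> 'rV[int]_n) -> Prop) :
  (forall v, bad v -> bad' v) -> thin bad' -> thin bad.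
Proof. by move=> h [R R0 hR]; exists R => // v /h/hR. Qed.

Lemma thin_none (bad : ('I_m -> 'rV[int]_n) -> Prop) : (forall v, ~ bad v) -> thin bad.
Proof. by move=> h; exists 1; [apply: oner_neq0 | move=> v /h]. Qed.

Lemma thin_or bad1 bad2 : thin bad1 -> thin bad2 -> thin (fun v => bad1 v \/ bad2 v).
Proof.
move=> [R R0 hR] [S S0 hS]; exists (R * S); first by rewrite mulf_neq0.
by move=> v [/hR|/hS] h; rewrite mevalM h ?mul0r ?mulr0.
Qed.

Lemma thin_exists (T : finType) (bad : T -> ('I_m -> 'rV[int]_n) -> Prop) :
  (forall t, thin (bad t)) -> thin (fun v => exists t, bad t v).
Proof.
move=> h; suff aux (r : seq T) : thin (fun v => exists2 t, t \in r & bad t v).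
  by apply: thin_sub (aux (enum T)) => v [t bt]; exists t; rewrite ?mem_enum.
elim: r => [|t r IH]; first by apply: thin_none => v [].
apply: thin_sub (thin_or (h t) IH) => v [t' + bt].
by rewrite inE => /predU1P[<-|t'r]; [left | right; exists t'].
Qed.

Lemma clear_denominators N (p : {mpoly rat[N]}) : p != 0 ->
  exists2 R : {mpoly int[N]}, R != 0 &
    exists2 D : rat, D != 0 & forall x : 'I_N -> int,
      (R.@[x])%:~R = D * p.@[fun k => (x k)%:~R].
Proof.
move=> p0; pose D : int := \prod_(k <- msupp p) denq p@_k.
have D0 : D != 0 by rewrite prodf_seq_neq0; apply/allP => k _; apply: denq_neq0.
have int_coef k : k \in msupp p -> exists c : int, c%:~R = D%:~R * p@_k.
  move=> kp; rewrite /D (bigD1_seq k) ?msupp_uniq //=.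
  exists (numq p@_k * \prod_(i <- msupp p | i != k) denq p@_i).
  by rewrite !intrM numqE; ring.
have /choice[c hc] : forall k, exists c : int, k \in msupp p -> c%:~R = D%:~R * p@_k.
  move=> k; case kp: (k \in msupp p); last by exists 0.
  by have [c hc] := int_coef k kp; exists c.
exists (\sum_(k <- msupp p) c k *: 'X_[k]).
  have [k kp] : exists k, k \in msupp p.
    by move: p0; rewrite -msupp_eq0; case: (msupp p) => // k r _; exists k; rewrite inE eqxx.
  apply/negP => /eqP/(congr1 (mcoeff k)); rewrite raddf_sum mcoeff0 /=.
  rewrite (bigD1_seq k) ?msupp_uniq //= big1 => [|l lk].
    rewrite addr0 mcoeffZ mcoeffX eqxx mulr1 => ck.
    have := hc k kp; rewrite ck => /esym/eqP; rewrite mulf_eq0 intr_eq0 (negPf D0) /=.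
    by move: kp; rewrite mcoeff_msupp => /negPf ->.
  by rewrite mcoeffZ mcoeffX (negPf lk) mulr0.
exists D%:~R => [|x]; first by rewrite intr_eq0.
rewrite [in RHS]mevalE (raddf_sum (meval x)) /= rmorph_sum mulr_sumr /= !big_seq; apply: eq_bigr => k kp.
rewrite mevalZ mevalX rmorphM /= hc // -mulrA; congr (_ * (_ * _)).
by rewrite rmorph_prod; apply: eq_bigr => i _; rewrite rmorphXn.
Qed.

Lemma coordinates_rat v k : mxvec (rat_mx v) 0 k = (coordinates v k)%:~R.
Proof. by case/mxvec_indexP: k => i c; rewrite /coordinates !mxvecE !mxE. Qed.

Lemma thin_polynomial f V0 : polynomial f -> f V0 != 0 -> thin (fun v => f (rat_mx v) = 0).
Proof.
move=> [p hp] f0; have p0 : p != 0.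
  by apply: contraNneq f0 => e; rewrite -hp e meval0.
have [R R0 [D D0 hR]] := clear_denominators p0.
exists R => // v fv; apply/eqP; rewrite -(intr_eq0 rat) hR mulf_eq0 (negPf D0) /=.
by rewrite -fv -hp; apply/eqP/meval_eq => k; rewrite coordinates_rat.
Qed.

End Thin.

(** * The dot product over the rationals *)

Section Dot.
Variable n : nat.
Implicit Types x y w : 'rV[rat]_n.

Definition dot x y := \sum_c x 0 c * y 0 c.

Lemma dotC x y : dot x y = dot y x.
Proof. by apply: eq_bigr => c _; rewrite mulrC. Qed.

Lemma dotDl x y w : dot (x + y) w = dot x w + dot y w.
Proof. by rewrite -big_split; apply: eq_bigr => c _; rewrite mxE mulrDl. Qed.

Lemma dotDr w x y : dot w (x + y) = dot w x + dot w y.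
Proof. by rewrite dotC dotDl !(dotC w). Qed.

Lemma dotZl a x y : dot (a *: x) y = a * dot x y.
Proof. by rewrite mulr_sumr; apply: eq_bigr => c _; rewrite mxE mulrA. Qed.

Lemma dotZr a x y : dot y (a *: x) = a * dot y x.
Proof. by rewrite dotC dotZl dotC. Qed.

Lemma dotNl x y : dot (- x) y = - dot x y.
Proof. by rewrite -scaleN1r dotZl mulN1r. Qed.

Lemma dotNr x y : dot y (- x) = - dot y x.
Proof. by rewrite dotC dotNl dotC. Qed.

Lemma dot0l x : dot 0 x = 0.
Proof. by rewrite -[0](scale0r 0) dotZl mul0r. Qed.

Definition dotE := (dotDl, dotDr, dotNl, dotNr, dotZl, dotZr).

Lemma dot_suml (J : Type) (r : seq J) (Q : pred J) (F : J -> 'rV[rat]_n) y :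
  dot (\sum_(j <- r | Q j) F j) y = \sum_(j <- r | Q j) dot (F j) y.
Proof.
elim/big_rec2: _ => [|j u w _ <-]; [exact: dot0l | exact: dotDl].
Qed.

Lemma dot_mulmx r (a : 'rV[rat]_r) (A : 'M[rat]_(r, n)) y :
  dot (a *m A) y = \sum_u a 0 u * dot (row u A) y.
Proof. by rewrite mulmx_sum_row dot_suml; apply: eq_bigr => u _; rewrite dotZl. Qed.

Lemma dot_ge0 x : 0 <= dot x x.
Proof. by apply: sumr_ge0 => c _; rewrite -expr2 sqr_ge0. Qed.

Lemma dot_eq0 x : (dot x x == 0) = (x == 0).
Proof.
apply/idP/eqP => [|->]; last by rewrite dot0l.
rewrite psumr_eq0 => [/allP h|c _]; last by rewrite -expr2 sqr_ge0.
apply/rowP => c; have := h c (mem_index_enum c); rewrite mulf_eq0 orbb mxE.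
by move/eqP.
Qed.

Lemma cauchy_schwarz x y : dot x y ^+ 2 <= dot x x * dot y y.
Proof.
have [/eqP|y0] := eqVneq (dot y y) 0.
  by rewrite dot_eq0 => /eqP ->; rewrite dotC !dot0l expr0n mulr0.
have yy : 0 < dot y y by rewrite lt_neqAle eq_sym y0 dot_ge0.
rewrite -subr_ge0 -(pmulr_rge0 _ yy).
suff <- : dot (dot y y *: x - dot x y *: y) (dot y y *: x - dot x y *: y) =
  dot y y * (dot x x * dot y y - dot x y ^+ 2) by apply: dot_ge0.
by rewrite !dotE (dotC y x); ring.
Qed.

Lemma gram_unit r (A : 'M[rat]_(r, n)) : row_free A -> \det (A *m A^T) != 0.
Proof.
move=> fA; apply/negP => /det0P[a a0 h]; case/negP: a0.
suff : a *m A = 0 by move/eqP; rewrite mulmx_free_eq0.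
apply/eqP; rewrite -dot_eq0; apply/eqP.
have -> : dot (a *m A) (a *m A) = (a *m (A *m A^T) *m a^T) 0 0.
  rewrite mulmxA -[a *m A *m A^T *m a^T]mulmxA -trmx_mul mxE.
  by apply: eq_bigr => c _; congr (_ * _); rewrite [RHS]mxE.
by rewrite h mul0mx mxE.
Qed.

Lemma mulmxT_dot r s (A : 'M[rat]_(r, n)) (B : 'M[rat]_(s, n)) u t :
  (A *m B^T) u t = dot (row u A) (row t B).
Proof. by rewrite mxE; apply: eq_bigr => c _; rewrite !mxE. Qed.

End Dot.

(** * Homogeneous quadratic functions of the parameters *)

Section Quadratic.
Variables m n : nat.
Implicit Types (V : 'M[rat]_(m, n)) (a b : 'rV[rat]_m).

(** The expansion along a line, with leading coefficient [f V1], is the form in which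
    [quartic_limit] is applied. *)
Definition quadratic (f : 'M[rat]_(m, n) -> rat) := polynomial f /\
  forall V0 V1, exists c, forall h, f (V0 + h *: V1) = f V0 + h * c + h ^+ 2 * f V1.

Lemma quadratic_dot a b : quadratic (fun V => dot (a *m V) (b *m V)).
Proof.
have lin c k : polynomial (fun V => (c *m V) (0 : 'I_1) k).
  apply: (@polynomial_ext _ _ (fun V => \sum_i c 0 i * V i k)).
    by move=> V; rewrite mxE.
  by apply: polynomial_sum => i; apply: polynomialZ; apply: polynomial_entry.
split; first by apply: polynomial_sum => k; apply: polynomialM; apply: lin.
move=> V0 V1; exists (dot (a *m V0) (b *m V1) + dot (a *m V1) (b *m V0)) => h.
by rewrite !mulmxDr -!scalemxAr !dotE; ring.
Qed.

Lemma quadratic_ext f g : f =1 g -> quadratic f -> quadratic g.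
Proof.
move=> fg [pf hf]; split; first exact: polynomial_ext pf.
by move=> V0 V1; have [c hc] := hf V0 V1; exists c => h; rewrite -!fg hc.
Qed.

Lemma quadraticD f g : quadratic f -> quadratic g -> quadratic (fun V => f V + g V).
Proof.
move=> [pf hf] [pg hg]; split; first exact: polynomialD.
move=> V0 V1; have [c hc] := hf V0 V1; have [d hd] := hg V0 V1.
by exists (c + d) => h; rewrite hc hd; ring.
Qed.

Lemma quadraticZ k f : quadratic f -> quadratic (fun V => k * f V).
Proof.
move=> [pf hf]; split; first exact: polynomialZ.
by move=> V0 V1; have [c hc] := hf V0 V1; exists (k * c) => h; rewrite hc; ring.
Qed.

Lemma quadraticB f g : quadratic f -> quadratic g -> quadratic (fun V => f V - g V).
Proof.
move=> qf /(quadraticZ (-1)) qg; apply: quadratic_ext (quadraticD qf qg) => V.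
by rewrite mulN1r.
Qed.

Lemma quadratic_sum I (r : seq I) (F : I -> 'M[rat]_(m, n) -> rat) :
  (forall i, quadratic (F i)) -> quadratic (fun V => \sum_(i <- r) F i V).
Proof.
move=> h; elim: r => [|i r IH].
  apply: (@quadratic_ext (fun V => 0 * dot (0 *m V) (0 *m V))).
    by move=> V; rewrite mul0r big_nil.
  by apply: quadraticZ; apply: quadratic_dot.
by apply: quadratic_ext (quadraticD (h i) IH) => V; rewrite big_cons.
Qed.

Definition weight (r : nat) (A : 'M[rat]_(r, m)) u V :=
  \sum_i A u i * dot (row i V) (row i V).

Lemma quadratic_weight r (A : 'M[rat]_(r, m)) u : quadratic (weight A u).
Proof.
apply: quadratic_sum => i; apply: quadraticZ.
apply: quadratic_ext (quadratic_dot (delta_mx 0 i) (delta_mx 0 i)) => V.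
by rewrite -rowE.
Qed.

End Quadratic.

(** Parameters of rank one: all [v_i] on the first coordinate axis, with abscissas [f]. *)
Lemma dot_line m n (a b : 'rV[rat]_m) (f : 'cV[rat]_m) :
  let V := f *m delta_mx 0 0 : 'M[rat]_(m, n.+1) in
  dot (a *m V) (b *m V) = (a *m f) 0 0 * (b *m f) 0 0.
Proof.
rewrite /= !mulmxA [a *m f]mx11_scalar [b *m f]mx11_scalar !mul_scalar_mx !dotZl !dotZr.
rewrite !mxE eqxx !mulr1n mulrA -[RHS]mulr1; congr (_ * _).
rewrite /dot (bigD1 0) //= big1 => [|c c0]; first by rewrite !mxE !eqxx mulr1 addr0.
by rewrite !mxE (negPf c0) andbF mul0r.
Qed.

(** * Configurations with two layers *)

Section Mixed.
Variables (m n r : nat) (M : 'M[int]_(r, m)) (eps : 'I_r -> rat) (al be : 'I_m).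
Implicit Types (V : 'M[rat]_(m, n.+1)).
Let N : 'M[rat]_(r, m) := map_mx intr M.

Definition root_gap V := row al V - row be V.
(** The value that the norm conditions prescribe for the product of [y] with row [u]; [eps u] is the
    sign attached to the layer of the vertex. *)
Definition root_level u V := eps u * (2^-1 * (weight N u V -
  dot (row u N *m V) (row u N *m V) - dot (row u N *m V) (row al V + row be V))).

(* For a vertex [p] in layer 0 joined by a red edge marked [(al, be)] to
   [v_al + v_be - p], the vector [y] is [p] minus the midpoint of [v_al] and
   [v_be]; the excluded values of [y] are those for which [p] is special. *)
Definition mixed_constraint V (y : 'rV_n.+1) :=
  [/\ exists c : 'rV_r, y = c *m (N *m V),
      forall u, dot y (row u (N *m V)) = root_level u V,
      dot y y = 4^-1 * dot (root_gap V) (root_gap V),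
      y != 2^-1 *: root_gap V & y != - 2^-1 *: root_gap V].

Hypothesis rn : (r <= n.+1)%N.
Hypothesis freeN : row_free N.
Hypothesis sumM : forall u, \sum_i M u i = 0.
Hypothesis eps1 : forall u, eps u = 1 \/ eps u = -1.
Hypothesis albe : al != be.

Lemma quadratic_root_level u : quadratic (root_level u).
Proof.
have q2 : quadratic (fun V => dot (row u N *m V) (row al V + row be V)).
  apply: quadratic_ext (quadratic_dot n.+1 (row u N) (delta_mx 0 al + delta_mx 0 be)) => V.
  by rewrite mulmxDl -!rowE.
have q1 := quadraticB (quadraticB (quadratic_weight n.+1 N u)
  (quadratic_dot n.+1 (row u N) (row u N))) q2.
exact (quadraticZ (eps u) (quadraticZ 2^-1 q1)).
Qed.

Lemma quadratic_root_gap : quadratic (fun V => 4^-1 * dot (root_gap V) (root_gap V)).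
Proof.
apply: quadraticZ.
apply: quadratic_ext (quadratic_dot n.+1 (delta_mx 0 al - delta_mx 0 be) (delta_mx 0 al - delta_mx 0 be)) => V.
by rewrite mulmxBl -!rowE.
Qed.

(** The Gram matrix of the rows of [N *m V] followed by [y], each entry involving [y] being replaced
    by its prescribed value, so that it depends on [V] alone. It is singular when [y] exists, since
    [y] is in the span of the rows. *)
Definition mixed_gram V := block_mx ((N *m V) *m (N *m V)^T) (\col_u root_level u V)
  (\row_u root_level u V) (4^-1 * dot (root_gap V) (root_gap V))%:M.

Lemma polynomial_mixed_gram : polynomial (fun V => \det (mixed_gram V)).
Proof.
apply: polynomial_det => i j; have [u ->|u ->] := split_ordP i; have [t ->|t ->] := split_ordP j.
- apply: polynomial_ext (proj1 (quadratic_dot n.+1 (row u N) (row t N))) => V.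
  by rewrite /mixed_gram block_mxEul mulmxT_dot !row_mul.
- apply: polynomial_ext (proj1 (quadratic_root_level u)) => V.
  by rewrite /mixed_gram block_mxEur mxE.
- apply: polynomial_ext (proj1 (quadratic_root_level t)) => V.
  by rewrite /mixed_gram block_mxEdl mxE.
apply: polynomial_ext (proj1 quadratic_root_gap) => V.
by rewrite /mixed_gram block_mxEdr !ord1 mxE mulr1n.
Qed.

Lemma dot_row V (y : 'rV_n.+1) u : (y *m (N *m V)^T) 0 u = dot y (row u (N *m V)).
Proof.
by rewrite mulmxT_dot; congr (dot _ _); apply/rowP => c; rewrite mxE.
Qed.

Lemma mixed_gram0 V y : mixed_constraint V y -> \det (mixed_gram V) = 0.
Proof.
move=> [[c yc] hy yy _ _]; apply/eqP/det0P; exists (row_mx c (-1)%:M).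
  apply/eqP => /(congr1 rsubmx); rewrite row_mxKr => /matrixP/(_ 0 0).
  by rewrite !mxE eqxx.
rewrite /mixed_gram mul_row_block mulmxA -yc.
have -> : y *m (N *m V)^T = \row_u root_level u V.
  by apply/rowP => u; rewrite dot_row hy mxE.
rewrite mul_scalar_mx scaleN1r subrr.
have -> : c *m \col_u root_level u V = (4^-1 * dot (root_gap V) (root_gap V))%:M.
  apply/matrixP => i j; rewrite !ord1 [LHS]mxE [RHS]mxE mulr1n -yy {1}yc dot_mulmx.
  by apply: eq_bigr => u _; rewrite mxE -hy dotC.
by rewrite mul_scalar_mx scaleN1r subrr row_mx0.
Qed.

(** For independent rows, a vanishing determinant produces a vector [y] in their span with the
    prescribed products; the inequality is Cauchy-Schwarz for [y] and [a *m (N *m V)]. *)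
Lemma mixed_cauchy V : \det (mixed_gram V) = 0 -> row_free (N *m V) ->
  forall a : 'rV_r, (\sum_u a 0 u * root_level u V) ^+ 2 <=
    4^-1 * dot (root_gap V) (root_gap V) * dot (a *m (N *m V)) (a *m (N *m V)).
Proof.
move=> /eqP/det0P[x x0 hx] fr a.
move: x0 hx; rewrite -[x]hsubmxK; set c := lsubmx x; set e := rsubmx x => x0.
rewrite /mixed_gram mul_row_block -[0 in RHS](row_mx0 _ _ r 1) => /eq_row_mx[].
rewrite [e]mx11_scalar !mul_scalar_mx; set k := e 0 0.
set ww := 4^-1 * _ => h1 h2.
have k0 : k != 0.
  apply: contraNneq x0 => k0; rewrite k0 scale0r addr0 in h1.
  have -> : c = 0.
    apply/eqP; rewrite -(@mulmx_free_eq0 _ _ _ _ c ((N *m V) *m (N *m V)^T)) ?h1 //.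
    by rewrite row_free_unit unitmxE unitfE gram_unit.
  by rewrite [e]mx11_scalar -/k k0 raddf0 row_mx0.
pose y := (- k^-1 *: c) *m (N *m V).
have hy u : dot y (row u (N *m V)) = root_level u V.
  rewrite -dot_row /y -mulmxA -scalemxAl.
  have -> : c *m ((N *m V) *m (N *m V)^T) = - (k *: \row_u root_level u V).
    by apply/eqP; rewrite -addr_eq0 h1.
  by rewrite scalerN scalerA mulNr mulVf // scaleN1r opprK mxE.
have yy : dot y y = ww.
  rewrite {1}/y dot_mulmx.
  have e1 : c *m \col_u root_level u V = - (k *: ww%:M).
    by apply/eqP; rewrite -addr_eq0 h2.
  have /matrixP/(_ 0 0) := congr1 (fun A => - k^-1 *: A) e1.
  rewrite scalemxAl scalerN scalerA mulNr mulVf // scaleN1r opprK [RHS]mxE mulr1n => <-.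
  by rewrite [RHS]mxE; apply: eq_bigr => u _; rewrite [X in _ = _ * X]mxE -hy dotC.
rewrite -yy; suff -> : \sum_u a 0 u * root_level u V = dot y (a *m (N *m V)).
  exact: cauchy_schwarz.
by rewrite dotC dot_mulmx; apply: eq_bigr => u _; rewrite -hy dotC.
Qed.

Lemma lin_row u (phi : 'I_m -> rat) :
  (row u N *m \col_i phi i) 0 0 = lin_form (M u) phi.
Proof. by rewrite mxE; apply: eq_bigr => i _; rewrite !mxE. Qed.

Definition line_mx (phi : 'I_m -> rat) : 'M[rat]_(m, n.+1) := (\col_i phi i) *m delta_mx 0 0.

Lemma delta_line i (phi : 'I_m -> rat) : (delta_mx 0 i *m \col_i phi i : 'M_1) 0 0 = phi i.
Proof. by rewrite -rowE !mxE. Qed.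

Lemma root_level_line u phi : root_level u (line_mx phi) = eps u * line_form (M u) al be phi.
Proof.
congr (_ * (_ * _)); rewrite /line_form; congr (_ - _ - _).
- apply: eq_bigr => i _; rewrite mxE; congr (_ * _).
  by rewrite rowE /line_mx dot_line delta_line -expr2.
- by rewrite /line_mx dot_line -(lin_row u phi) expr2.
rewrite !rowE -mulmxDl /line_mx dot_line -(lin_row u phi) mulmxDl.
by congr (_ * _); [rewrite -rowE | rewrite [LHS]mxE !delta_line].
Qed.

Lemma root_gap_line phi :
  4^-1 * dot (root_gap (line_mx phi)) (root_gap (line_mx phi)) = 4^-1 * (phi al - phi be) ^+ 2.
Proof.
congr (_ * _); rewrite /root_gap !rowE -mulmxBl /line_mx dot_line mulmxBl.
have -> : (delta_mx 0 al *m (\col_i phi i) - delta_mx 0 be *m (\col_i phi i) : 'M_1) 0 0 = phi al - phi be.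
  by rewrite mxE [X in _ + X]mxE !delta_line.
by rewrite expr2.
Qed.

(* Perturbing the rank one matrix [line_mx phi] by [h *: X] makes the rows
   of [N *m V] independent for every [h != 0]. *)
Lemma line_perturbation (phi : 'I_m -> rat) (u0 : 'I_r) : exists X : 'M[rat]_(m, n.+1),
  forall h, h != 0 -> row_free (N *m (line_mx phi + h *: X)).
Proof.
pose s (u : 'I_r) : 'I_n.+1 := tperm (widen_ord rn u0) 0 (widen_ord rn u).
have s_inj : injective s by move=> u t /perm_inj/(congr1 val) /= e; apply: val_inj.
have s0 : s u0 = 0 by rewrite /s tpermL.
pose b := lin_form (M u0) phi == 0.
(* Row [u0] is left to the rank one part, which occupies column 0 only, unless [lin_form (M u0) phi]
   vanishes; in that case [W] fills this column for it. *)
pose W : 'M[rat]_(r, n.+1) := \matrix_(u, c) (((u != u0) || b) && (s u == c))%:R.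
exists (pinvmx N *m W) => h h0.
have -> : N *m (line_mx phi + h *: (pinvmx N *m W)) = N *m line_mx phi + h *: W.
  rewrite mulmxDr -scalemxAr; congr (_ + _ *: _).
  by rewrite mulmxA mulmxVp // mul1mx.
apply/row_freeP; apply/row_freeP; rewrite -kermx_eq0; apply/rowV0P => a /sub_kermxP.
rewrite mulmxDr -scalemxAr => /rowP ha.
have lineE c : (a *m (N *m line_mx phi)) 0 c = (\sum_u a 0 u * lin_form (M u) phi) * (c == 0)%:R.
  rewrite /line_mx !mulmxA mxE big_ord1 [X in _ * X]mxE eqxx /=; congr (_ * _).
  rewrite -mulmxA mxE; apply: eq_bigr => u _; congr (_ * _).
  by rewrite -lin_row !mxE; apply: eq_bigr => i _; rewrite !mxE.
have WE u : (a *m W) 0 (s u) = a 0 u * ((u != u0) || b)%:R.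
  rewrite mxE (bigD1 u) //= big1 => [|t tu]; first by rewrite addr0 mxE eqxx andbT.
  by rewrite mxE (inj_eq s_inj) (negPf tu) andbF mulr0.
have a0 u : u != u0 -> a 0 u = 0.
  move=> uu0; have := ha (s u); rewrite mxE lineE [X in _ + X = _]mxE WE uu0 mulr1.
  rewrite -s0 (inj_eq s_inj) (negPf uu0) mulr0 add0r mxE => /eqP.
  by rewrite mulf_eq0 (negPf h0) => /eqP.
apply/rowP => u; rewrite [RHS]mxE; have [->|/a0//] := eqVneq u u0.
have := ha (s u0); rewrite mxE lineE [X in _ + X = _]mxE WE s0 !eqxx /= mulr1 mxE.
rewrite (bigD1 u0) //= big1 ?addr0 => [|t /a0 ->]; last by rewrite mul0r.
rewrite /b; case: eqVneq => [->|l0] /=; rewrite ?mulr0 ?addr0 ?add0r ?mulr1 => /eqP.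
  by rewrite mulf_eq0 (negPf h0) => /eqP.
by rewrite mulf_eq0 (negPf l0) orbF => /eqP.
Qed.

(** Limit at [h = 0] of [mixed_cauchy] for the perturbed parameters, whose rows are independent. *)
Lemma line_cauchy : (forall V, \det (mixed_gram V) = 0) -> forall (u0 : 'I_r) phi (a : 'rV_r),
  (\sum_u a 0 u * (eps u * line_form (M u) al be phi)) ^+ 2 <=
    4^-1 * (phi al - phi be) ^+ 2 * (\sum_u a 0 u * lin_form (M u) phi) ^+ 2.
Proof.
move=> det0 u0 phi a; have [X hX] := line_perturbation phi u0.
have qA : quadratic (fun V => \sum_u a 0 u * root_level u V).
  by apply: quadratic_sum => u; apply: quadraticZ; apply: quadratic_root_level.
have qC : quadratic (fun V => dot (a *m (N *m V)) (a *m (N *m V))).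
  by apply: quadratic_ext (quadratic_dot n.+1 (a *m N) (a *m N)) => V; rewrite !mulmxA.
have [_ /(_ (line_mx phi) X)[a1 ha]] := qA.
have [_ /(_ (line_mx phi) X)[b1 hb]] := quadratic_root_gap.
have [_ /(_ (line_mx phi) X)[c1 hc]] := qC.
pose A V := \sum_u a 0 u * root_level u V.
pose B V := 4^-1 * dot (root_gap V) (root_gap V).
pose C V := dot (a *m (N *m V)) (a *m (N *m V)).
have key h : h != 0 ->
    (A (line_mx phi) + h * a1 + h ^+ 2 * A X) ^+ 2 <=
    (B (line_mx phi) + h * b1 + h ^+ 2 * B X) * (C (line_mx phi) + h * c1 + h ^+ 2 * C X).
  by move=> h0; rewrite -ha -hb -hc; exact: mixed_cauchy (det0 _) (hX h h0) a.
have := quartic_limit key; rewrite /A /B /C {key ha hb hc}.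
rewrite root_gap_line.
have -> : dot (a *m (N *m line_mx phi)) (a *m (N *m line_mx phi)) =
    (\sum_u a 0 u * lin_form (M u) phi) ^+ 2.
  rewrite /line_mx !mulmxA -[a *m N *m _ *m _]mulmxA dot_line -expr2 -mulmxA; congr (_ ^+ 2).
  rewrite mxE; apply: eq_bigr => u _; congr (_ * _).
  by rewrite -lin_row !mxE; apply: eq_bigr => i _; rewrite !mxE.
by under eq_bigr do rewrite root_level_line.
Qed.

Lemma line_roots : (forall V, \det (mixed_gram V) = 0) -> forall u,
  exists i j, [/\ i != j, i \in [set al; be] & forall k, M u k = (k == j)%:R - (k == i)%:R].
Proof.
move=> det0 u; apply: forced_root => //.
  have [/existsP//|] := boolP [exists i, M u i != 0]; rewrite negb_exists => /forallP h.
  have : delta_mx 0 u *m N == 0 :> 'rV_m.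
    apply/eqP/rowP => i; rewrite -rowE !mxE; have := h i; rewrite negbK => /eqP ->.
    by rewrite rmorph0.
  rewrite mulmx_free_eq0 // => /eqP/rowP/(_ u); rewrite !mxE !eqxx => /eqP.
  by rewrite oner_eq0.
move=> phi; have := line_cauchy det0 u phi (delta_mx 0 u).
have pick (f : 'I_r -> rat) : \sum_t (delta_mx 0 u : 'rV_r) 0 t * f t = f u.
  rewrite (bigD1 u) //= mxE !eqxx mul1r big1 ?addr0 // => t tu.
  by rewrite mxE (negPf tu) andbF mul0r.
by rewrite !pick exprMn; case: (eps1 u) => ->; rewrite ?sqrrN expr1n mul1r.
Qed.

(** Each row of [M] is a root involving [al] or [be], and for such a root [root_level] factors, up
    to a sign. The signs agree because a combination of two rows with vanishing [lin_form] must also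
    annihilate the levels. *)
Lemma mixed_identity : (forall V, \det (mixed_gram V) = 0) ->
  exists2 ze : rat, ze = 1 \/ ze = -1 & forall u V,
    root_level u V = 2^-1 * ze * dot (row u (N *m V)) (root_gap V).
Proof.
move=> det0.
have ind i (f : 'I_m -> rat) : \sum_k (k == i)%:R * f k = f i.
  by rewrite (bigD1 i) //= eqxx mul1r big1 ?addr0 // => k /negPf ->; rewrite mul0r.
have roots u : exists p : 'I_m * 'I_m * rat, [/\ p.1.1 != p.1.2, p.2 = 1 \/ p.2 = -1,
    forall phi, lin_form (M u) phi = phi p.1.2 - phi p.1.1 & forall V,
    root_level u V = 2^-1 * p.2 * dot (row u (N *m V)) (root_gap V)].
  have [i [j [ij iab hM]]] := line_roots det0 u.
  have NE k : N u k = (k == j)%:R - (k == i)%:R.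
    by rewrite mxE hM rmorphB /=; case: (k == j); case: (k == i).
  pose s : rat := if i == al then 1 else -1.
  exists (i, j, eps u * s); split => //=.
  - by rewrite /s; case: (eps1 u) => ->; case: ifP; rewrite ?mulr1 ?mulN1r ?opprK; auto.
  - move=> phi; rewrite /lin_form; under eq_bigr do [rewrite hM rmorphB mulrBl /=].
    rewrite sumrB -[X in _ = X - _](ind j phi) -[X in _ = _ - X](ind i phi).
    by congr (_ - _); apply: eq_bigr => k _; case: (k == _).
  move=> V; have rowV : row u N *m V = row j V - row i V.
    rewrite mulmx_sum_row (eq_bigr (fun k => (k == j)%:R *: row k V - (k == i)%:R *: row k V)).
      have indV l : \sum_k (k == l)%:R *: row k V = row l V.
        by rewrite (bigD1 l) //= eqxx scale1r big1 ?addr0 // => k /negPf ->; rewrite scale0r.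
      by rewrite sumrB !indV.
    by move=> k _; rewrite mxE NE scalerBl.
  have wE : weight N u V = dot (row j V) (row j V) - dot (row i V) (row i V).
    rewrite /weight; under eq_bigr do rewrite NE mulrBl.
    by rewrite sumrB !ind.
  rewrite /root_level row_mul rowV wE /root_gap /s.
  move: iab; rewrite !inE => /orP[]/eqP ->.
    by rewrite eqxx !dotE (dotC (row al V) (row j V)); ring.
  rewrite (eq_sym be) (negPf albe) !dotE (dotC (row be V) (row j V)).
  by rewrite (dotC (row be V) (row al V)); ring.
have /choice[p hp] := roots.
suff const u t : (p u).2 = (p t).2.
  case: (pickP (fun u : 'I_r => true)) => [u0 _|none].
    exists (p u0).2 => [|u V]; first by case: (hp u0).
    by case: (hp u) => _ _ _ ->; rewrite (const u u0).
  by exists 1; [left | move=> u; have := none u].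
(* Pairwise distinct abscissas: neither a root nor [phi al - phi be] vanishes on them. *)
pose phi (k : 'I_m) : rat := (k : nat)%:R.
have phi_inj i j : i != j -> phi i - phi j != 0.
  by move=> ij; rewrite subr_eq0 /phi eqr_nat; apply: contra ij => /eqP/val_inj ->.
have levelE w : eps w * line_form (M w) al be phi =
    2^-1 * (p w).2 * (lin_form (M w) phi * (phi al - phi be)).
  have [_ _ _ h] := hp w; rewrite -root_level_line h; congr (_ * _).
  rewrite row_mul /root_gap !rowE -mulmxBl -rowE /line_mx dot_line lin_row mulmxBl.
  by congr (_ * _); rewrite [LHS]mxE [X in _ + X]mxE !delta_line.
have ln w : lin_form (M w) phi != 0.
  by have [n12 _ -> _] := hp w; apply: phi_inj; rewrite eq_sym.
have := line_cauchy det0 u phi (lin_form (M t) phi *: delta_mx 0 u - lin_form (M u) phi *: delta_mx 0 t).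
have pick2 x y (f : 'I_r -> rat) :
    \sum_w (x *: delta_mx 0 u - y *: delta_mx 0 t : 'rV_r) 0 w * f w = x * f u - y * f t.
  have pick l : \sum_w (delta_mx 0 l : 'rV_r) 0 w * f w = f l.
    rewrite (bigD1 l) //= mxE !eqxx mul1r big1 ?addr0 // => w tu.
    by rewrite mxE (negPf tu) andbF mul0r.
  rewrite -(pick u) -(pick t) !mulr_sumr -sumrB; apply: eq_bigr => w _.
  by rewrite mxE [X in _ + X]mxE mxE [X in _ - X]mxE; ring.
rewrite !pick2 !levelE [X in _ <= _ * X ^+ 2](_ : _ = 0); last by ring.
rewrite expr0n mulr0 => h.
have : (lin_form (M t) phi * lin_form (M u) phi * (phi al - phi be) * 2^-1 * ((p u).2 - (p t).2)) ^+ 2 == 0.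
  rewrite eq_le sqr_ge0 andbT; apply: le_trans h.
  by rewrite le_eqVlt; apply/orP; left; apply/eqP; congr (_ ^+ 2); ring.
rewrite sqrf_eq0 !mulf_eq0 !(negPf (ln _)) (negPf (phi_inj _ _ albe)) /= subr_eq0.
by move/eqP.
Qed.

(** When the determinant vanishes identically, pairing the identity with [c] gives
    [dot y y = 2^-1 * ze * dot y w]. With the prescribed value of [dot y y] this makes
    [y - (2^-1 * ze) *: w] a vector of norm 0, so [y] is one of the two excluded values. *)
Lemma thin_mixed : thin (fun v => exists y, mixed_constraint (rat_mx v) y).
Proof.
have [[V0 hV0]|det0] := pselect (exists V, \det (mixed_gram V) != 0).
  apply: thin_sub (thin_polynomial polynomial_mixed_gram hV0) => v [y].
  exact: mixed_gram0.
have {}det0 V : \det (mixed_gram V) = 0.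
  by apply/eqP; apply: contraT => h; case: det0; exists V.
have [ze ze1 hze] := mixed_identity det0.
apply: thin_none => v [y [[c yc] hy yy y1 y2]].
set V := rat_mx v in yc hy yy y1 y2; set w := root_gap V in yy y1 y2.
have ze2 : ze ^+ 2 = 1 by case: ze1 => ->; rewrite ?sqrrN expr1n.
have yw : dot y y = 2^-1 * ze * dot y w.
  rewrite {1}yc dot_mulmx {2}yc dot_mulmx mulr_sumr; apply: eq_bigr => u _.
  by rewrite dotC hy hze; ring.
clearbody w; have : dot (y - (2^-1 * ze) *: w) (y - (2^-1 * ze) *: w) == 0.
  rewrite !dotE (dotC w y); apply/eqP.
  transitivity (dot y y - 2 * (2^-1 * ze * dot y w) + ze ^+ 2 * (4^-1 * dot w w)); first by field.
  by rewrite -yw -yy ze2; ring.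
rewrite dot_eq0 subr_eq0; case: ze1 => ->; rewrite ?mulr1 ?mulrN1 => e.
  by rewrite e in y1.
by rewrite e in y2.
Qed.

End Mixed.

(** * Flat configurations *)

Section Flat.
Variables (m n : nat) (M : 'M[int]_(n.+2, m)) (u1 : 'I_n.+2) (i j : 'I_m).
Implicit Types (V : 'M[rat]_(m, n.+1)) (u t : 'I_n.+2).
Let N : 'M[rat]_(n.+2, m) := map_mx intr M.
Hypothesis freeN : row_free N.
Hypothesis ij : i != j.
Hypothesis Mu1 : forall k, M u1 k = (k == j)%:R - (k == i)%:R.

Definition flat_level u V := weight N u V - dot (row u N *m V) (row u N *m V).

(** The norms of [x] and [x + row u (N *m V)] prescribe the product of [x] with that row. These are
    [n.+2] linear equations for [n.+1] unknowns, and [flat_mx] is their augmented matrix. *)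
Definition flat_constraint V (x : 'rV_n.+1) :=
  (forall u, 2 * dot x (row u (N *m V)) = flat_level u V) /\ forall k, x != row k V.

Definition flat_mx V : 'M[rat]_n.+2 := row_mx (\col_u flat_level u V) (N *m V).

Lemma quadratic_flat_level u : quadratic (flat_level u).
Proof. exact (quadraticB (quadratic_weight n.+1 N u) (quadratic_dot n.+1 (row u N) (row u N))). Qed.

Lemma polynomial_mulN u c : polynomial (fun V => (N *m V) u c).
Proof.
apply: (@polynomial_ext _ _ (fun V => \sum_k N u k * V k c)) => [V|]; first by rewrite mxE.
by apply: polynomial_sum => k; apply: polynomialZ; apply: polynomial_entry.
Qed.

Lemma polynomial_flat_mx : polynomial (fun V => \det (flat_mx V)).
Proof.
apply: polynomial_det => u t; rewrite /flat_mx; have [c e|c e] := @split_ordP 1 n.+1 t.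
  apply: polynomial_ext (proj1 (quadratic_flat_level u)) => V.
  by rewrite e (@row_mxEl _ _ 1 n.+1) mxE.
by apply: polynomial_ext (polynomial_mulN u c) => V; rewrite e (@row_mxEr _ _ 1 n.+1).
Qed.

Lemma flat_mx0 V x : flat_constraint V x -> \det (flat_mx V) = 0.
Proof.
move=> [hx _]; apply/eqP; rewrite -det_tr; apply/det0P.
exists (row_mx (-1)%:M (2 *: x) : 'rV_(1 + n.+1)).
  apply/eqP => /(congr1 (@lsubmx _ 1 1 n.+1)); rewrite row_mxKl => /matrixP/(_ 0 0).
  by rewrite !mxE eqxx.
rewrite /flat_mx (@tr_row_mx _ n.+2 1 n.+1) (@mul_row_col _ 1 1 n.+1 n.+2) mul_scalar_mx scaleN1r -scalemxAl.
apply/rowP => u; rewrite mxE [X in X + _]mxE [X in - X]mxE mxE [X in _ + X]mxE.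
have -> : (x *m (N *m V)^T) 0 u = dot x (row u (N *m V)).
  by rewrite mulmxT_dot; congr (dot _ _); apply/rowP => c; rewrite mxE.
by rewrite hx mxE addNr.
Qed.

Definition flat_form u (phi : 'I_m -> rat) :=
  \sum_k (M u k)%:~R * phi k ^+ 2 - lin_form (M u) phi ^+ 2.

Lemma lin_rowN u phi : (row u N *m \col_k phi k) 0 0 = lin_form (M u) phi.
Proof. by rewrite mxE; apply: eq_bigr => k _; rewrite !mxE. Qed.

Lemma flat_level_line u phi : flat_level u (line_mx n phi) = flat_form u phi.
Proof.
congr (_ - _); last by rewrite /line_mx dot_line -(lin_rowN u phi) expr2.
apply: eq_bigr => k _; rewrite mxE; congr (_ * _).
by rewrite rowE /line_mx dot_line delta_line -expr2.
Qed.

(* The columns of [V] other than the first are chosen so that a row vector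
   killing [flat_mx V] is supported on [u] and [u1]. *)
Lemma flat_proportional : (forall V, \det (flat_mx V) = 0) -> forall u phi,
  lin_form (M u1) phi * flat_form u phi = lin_form (M u) phi * flat_form u1 phi.
Proof.
move=> det0 u phi; have [->//|uu1] := eqVneq u u1.
(* [s] sends [u1] to 0 and [u] to the last index: the rows other than [u] get distinct columns, and
   column 0 is reserved for [u1]. *)
pose s := (tperm ord0 u1 * tperm (tperm ord0 u1 u) ord_max)%g.
have u0 : tperm ord0 u1 u != ord0.
  by rewrite -(inj_eq (@perm_inj _ (tperm ord0 u1))) tpermK tpermL.
have s1 : s u1 = ord0.
  by rewrite permM tpermR tpermD // eq_sym; apply/eqP => /(congr1 val).
have su : s u = ord_max by rewrite permM tpermL.
pose col t : 'I_n.+1 := inord (s t).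
have st t : t != u -> (s t < n.+1)%N.
  move=> tu; have : s t != ord_max by rewrite -su (inj_eq perm_inj).
  by rewrite -val_eqE /= ltn_neqAle -ltnS ltn_ord andbT.
have col_inj t t' : t != u -> t' != u -> col t = col t' -> t = t'.
  move=> tu t'u /(congr1 val); rewrite /= !inordK ?st // => e.
  by apply: (@perm_inj _ s); apply: val_inj.
have col0 t : t != u -> t != u1 -> col t != 0.
  move=> tu tu1; apply: contraNneq tu1 => /(congr1 val); rewrite /= inordK ?st // => e.
  by rewrite -(inj_eq (@perm_inj _ s)) s1 -val_eqE /= e.
pose W : 'M[rat]_(n.+2, n.+1) := \matrix_(t, c) ((t != u) && (t != u1) && (col t == c))%:R.
pose X := pinvmx N *m W.
have NV h : N *m (line_mx n phi + h *: X) = N *m line_mx n phi + h *: W.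
  rewrite mulmxDr -scalemxAr; congr (_ + _ *: _).
  by rewrite mulmxA mulmxVp // mul1mx.
pose F V := lin_form (M u1) phi * flat_level u V - lin_form (M u) phi * flat_level u1 V.
have qF : quadratic F.
  by apply: quadraticB; apply: quadraticZ; apply: quadratic_flat_level.
have Fh h : h != 0 -> F (line_mx n phi + h *: X) = 0.
  move=> h0; set V := _ + _; have /eqP/det0P[a a0] := det0 V.
  rewrite /flat_mx (@mul_mx_row _ 1 n.+2 1 n.+1).
  rewrite -[0 in RHS](@row_mx0 _ 1 1 n.+1) => /(@eq_row_mx _ 1 1 n.+1)[hK].
  rewrite NV mulmxDr -scalemxAr => /rowP hN.
  have lineE c : (a *m (N *m line_mx n phi)) 0 c = (\sum_t a 0 t * lin_form (M t) phi) * (c == 0)%:R.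
    rewrite /line_mx !mulmxA mxE big_ord1 [X in _ * X]mxE eqxx /=; congr (_ * _).
    rewrite -mulmxA mxE; apply: eq_bigr => t _; congr (_ * _).
    by rewrite -lin_rowN !mxE; apply: eq_bigr => k _; rewrite !mxE.
  have at0 t : t != u -> t != u1 -> a 0 t = 0.
    move=> tu tu1; have := hN (col t); rewrite mxE lineE (negPf (col0 _ tu tu1)) mulr0 add0r.
    rewrite mxE mxE (bigD1 t) //= big1 => [|t' t't]; last first.
      rewrite mxE; case t'u: (t' == u); rewrite ?mulr0 //; case: (t' == u1); rewrite ?mulr0 //.
      case: eqVneq => [/col_inj e|_]; last by rewrite mulr0.
      by rewrite e ?t'u ?eqxx // in t't.
    by rewrite addr0 mxE tu tu1 eqxx mulr1 mxE => /eqP; rewrite mulf_eq0 (negPf h0) => /eqP.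
  have sum2 (f : 'I_n.+2 -> rat) : \sum_t a 0 t * f t = a 0 u * f u + a 0 u1 * f u1.
    rewrite (bigD1 u) //= (bigD1 u1) 1?eq_sym //= big1 ?addr0 // => t /andP[tu tu1].
    by rewrite at0 // mul0r.
  have hl : a 0 u * lin_form (M u) phi + a 0 u1 * lin_form (M u1) phi = 0.
    have W0 : (a *m W) 0 0 = 0.
      rewrite mxE big1 // => t _; rewrite mxE.
      case: eqVneq => [|tu]; rewrite ?mulr0 //=; case: eqVneq => [|tu1]; rewrite ?mulr0 //=.
      by rewrite (negPf (col0 _ tu tu1)) mulr0.
    have e0 := hN 0; rewrite mxE lineE [X in _ + X]mxE W0 eqxx mulr1 mulr0 addr0 sum2 in e0.
    by rewrite e0 mxE.
  have hk : a 0 u * flat_level u V + a 0 u1 * flat_level u1 V = 0.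
    rewrite -(sum2 (fun t => flat_level t V)); have /matrixP/(_ 0 0) := hK.
    rewrite mxE [RHS]mxE => e1; rewrite -[RHS]e1.
    by apply: eq_bigr => t _; rewrite [X in _ = _ * X]mxE.
  rewrite /F; move: hl hk; move: (flat_level u V) (flat_level u1 V) => ku k1.
  move: (lin_form (M u) _) (lin_form (M u1) _) => lu l1 hl hk.
  have [au0|au0] := eqVneq (a 0 u) 0; last first.
    apply: (mulfI au0); rewrite mulr0.
    transitivity (l1 * (a 0 u * ku + a 0 u1 * k1) - (a 0 u * lu + a 0 u1 * l1) * k1); first by ring.
    by rewrite hl hk; ring.
  have au1 : a 0 u1 != 0.
    apply: contraNneq a0 => a1; apply/eqP/rowP => t; rewrite [RHS]mxE.
    have [->//|tu] := eqVneq t u; have [->//|tu1] := eqVneq t u1; exact: at0.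
  move: hl hk; rewrite au0 !mul0r !add0r => /eqP; rewrite mulf_eq0 (negPf au1) => /eqP ->.
  by move=> /eqP; rewrite mulf_eq0 (negPf au1) => /eqP ->; ring.
have [_ /(_ (line_mx n phi) X)[c1 hc]] := qF.
have key h : h != 0 -> (F (line_mx n phi) + h * c1 + h ^+ 2 * F X) ^+ 2 <=
    (0 + h * 0 + h ^+ 2 * 0) * (0 + h * 0 + h ^+ 2 * 0).
  by move=> h0; rewrite -hc Fh // expr0n !mulr0 ?addr0.
have := quartic_limit key; rewrite mulr0 => le0.
have /eqP : F (line_mx n phi) == 0 by rewrite -sqrf_eq0 eq_le le0 sqr_ge0.
by rewrite /F !flat_level_line => /eqP; rewrite subr_eq0 => /eqP.
Qed.

(** Where [phi j] and [phi i] differ, the factor [phi j - phi i] cancels from the proportionality.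
    The other [phi] are reached by the parallelogram identity for [phi + g] and [phi - g], with [g]
    the indicator of [j]. *)
Lemma flat_form_root : (forall V, \det (flat_mx V) = 0) -> forall u phi,
  flat_form u phi = 2 * phi i * lin_form (M u) phi.
Proof.
move=> det0 u phi.
have ind k (f : 'I_m -> rat) : \sum_l (l == k)%:R * f l = f k.
  by rewrite (bigD1 k) //= eqxx mul1r big1 ?addr0 // => l /negPf ->; rewrite mul0r.
have diffE f : \sum_k (M u1 k)%:~R * f k = f j - f i :> rat.
  under eq_bigr do [rewrite Mu1 rmorphB mulrBl /=].
  rewrite sumrB -[X in _ = X - _](ind j f) -[X in _ = _ - X](ind i f).
  by congr (_ - _); apply: eq_bigr => k _; case: (k == _).
have off f : f j != f i -> flat_form u f = 2 * f i * lin_form (M u) f.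
  rewrite -subr_eq0 => ne; apply: (mulfI ne).
  have := flat_proportional det0 u f; rewrite {1}/lin_form diffE => ->.
  by rewrite {1}/flat_form (diffE (fun k => f k ^+ 2)) /lin_form diffE; ring.
have [e|/off//] := eqVneq (phi j) (phi i).
pose g (k : 'I_m) : rat := (k == j)%:R.
have gj : g j = 1 by rewrite /g eqxx.
have gi : g i = 0 by rewrite /g (negPf ij).
have e1 := off g; have e2 := off (fun k => phi k + g k); have e3 := off (fun k => phi k - g k).
have {}e1 : flat_form u g = 0 by rewrite e1 ?gj gi ?oner_eq0 // !(mulr0, mul0r).
rewrite /= gj gi e in e2 e3.
have {}e2 := e2 _; have {}e3 := e3 _.
have linD : lin_form (M u) (fun k => phi k + g k) = lin_form (M u) phi + lin_form (M u) g.
  by rewrite -big_split; apply: eq_bigr => k _; rewrite mulrDr.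
have linB : lin_form (M u) (fun k => phi k - g k) = lin_form (M u) phi - lin_form (M u) g.
  by rewrite -sumrB; apply: eq_bigr => k _; rewrite mulrBr.
have par : flat_form u (fun k => phi k + g k) + flat_form u (fun k => phi k - g k) =
    2 * flat_form u phi + 2 * flat_form u g.
  rewrite /flat_form linD linB.
  have : \sum_k (M u k)%:~R * (phi k + g k) ^+ 2 + \sum_k (M u k)%:~R * (phi k - g k) ^+ 2 =
      2 * \sum_k (M u k)%:~R * phi k ^+ 2 + 2 * \sum_k (M u k)%:~R * g k ^+ 2 :> rat.
    by rewrite !mulr_sumr -!big_split; apply: eq_bigr => k _ /=; ring.
  move: (lin_form _ phi) (lin_form _ g) => x y; set A := \sum_k _; set B := \sum_k _.
  set C := \sum_k _; set D := \sum_k _ => h.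
  transitivity (A + B - 2 * x ^+ 2 - 2 * y ^+ 2); first by ring.
  by rewrite h; ring.
move: par; rewrite e1 e2 ?e3 ?linD ?linB.
- by move=> h; apply: (@mulfI _ 2) => //; rewrite -[LHS]addr0 -[X in _ + X](mulr0 2) -h; ring.
- by rewrite subr0 -subr_eq0 addrAC subrr add0r oppr_eq0 oner_eq0.
by rewrite addr0 -subr_eq0 addrAC subrr add0r oner_eq0.
Qed.

Lemma flat_level_root : (forall V, \det (flat_mx V) = 0) -> forall u V,
  flat_level u V = 2 * dot (row i V) (row u (N *m V)).
Proof.
move=> det0 u V; rewrite row_mul.
have linE c : (row u N *m V) 0 c = lin_form (M u) (fun k => V k c).
  by rewrite mxE; apply: eq_bigr => k _; rewrite !mxE.
transitivity (\sum_c flat_form u (fun k => V k c)).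
  rewrite /flat_form sumrB; congr (_ - _); last by apply: eq_bigr => c _; rewrite linE.
  rewrite exchange_big /=; apply: eq_bigr => k _; rewrite mxE mulr_sumr.
  by apply: eq_bigr => c _; rewrite !mxE.
rewrite mulr_sumr; apply: eq_bigr => c _.
by rewrite flat_form_root // linE mxE mulrA.
Qed.

(** When the determinant vanishes identically, [v_i] solves the same equations as [x]. Outside a
    thin set the rows of [N *m V] span the space, so [x] would be [v_i]. *)
Lemma thin_flat : thin (fun v => exists x, flat_constraint (rat_mx v) x).
Proof.
have [[V0 hV0]|det0] := pselect (exists V, \det (flat_mx V) != 0).
  apply: thin_sub (thin_polynomial polynomial_flat_mx hV0) => v [x].
  exact: flat_mx0.
have {}det0 V : \det (flat_mx V) = 0.
  by apply/eqP; apply: contraT => h; case: det0; exists V.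
pose g V := \det ((N *m V)^T *m (N *m V)).
have pg : polynomial g.
  apply: polynomial_det => c c'.
  apply: (@polynomial_ext _ _ (fun V => \sum_u (N *m V) u c * (N *m V) u c')) => [V|].
    by rewrite [RHS]mxE; apply: eq_bigr => u _; rewrite [X in _ = X * _]mxE.
  by apply: polynomial_sum => u; apply: polynomialM; apply: polynomial_mulN.
have g0 : g (pinvmx N *m pid_mx n.+1) != 0.
  have e : N *m (pinvmx N *m pid_mx n.+1) = pid_mx n.+1 :> 'M_(n.+2, n.+1).
    by rewrite mulmxA mulmxVp // mul1mx.
  rewrite /g e tr_pid_mx mul_pid_mx (_ : minn _ _ = n.+1); last by lia.
  by rewrite pid_mx_1 det1 oner_eq0.
apply: thin_sub (thin_polynomial pg g0) => v [x [hx xi]].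
apply/eqP/det0P; exists (x - row i (rat_mx v)); first by rewrite subr_eq0.
rewrite [LHS]mulmxA; suff -> : (x - row i (rat_mx v)) *m (N *m rat_mx v)^T = 0 by rewrite mul0mx.
apply/rowP => u; rewrite [RHS]mxE.
have -> : ((x - row i (rat_mx v)) *m (N *m rat_mx v)^T) 0 u =
    dot (x - row i (rat_mx v)) (row u (N *m rat_mx v)).
  by rewrite mulmxT_dot; congr (dot _ _); apply/rowP => c; rewrite mxE.
rewrite dotDl dotNl; apply: (@mulfI _ 2) => //.
by rewrite mulrBr hx flat_level_root // subrr mulr0.
Qed.

End Flat.

(** * Dependent configurations are thin *)

Lemma thin_rank m n r (N : 'M[rat]_(r, m)) : (r <= n)%N -> row_free N ->
  thin (fun v : 'I_m -> 'rV[int]_n => exists2 c : 'rV_r, c != 0 & c *m (N *m rat_mx v) = 0).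
Proof.
move=> rn freeN; pose g (V : 'M[rat]_(m, n)) := \det ((N *m V) *m (N *m V)^T).
have pg : polynomial g.
  apply: polynomial_det => u t.
  apply: polynomial_ext (proj1 (quadratic_dot n (row u N) (row t N))) => V.
  by rewrite mulmxT_dot !row_mul.
have g0 : g (pinvmx N *m pid_mx r) != 0.
  have e : N *m (pinvmx N *m pid_mx r) = pid_mx r :> 'M_(r, n).
    by rewrite mulmxA mulmxVp // mul1mx.
  rewrite /g e tr_pid_mx mul_pid_mx (_ : minn _ _ = r); last by lia.
  by rewrite pid_mx_1 det1 oner_eq0.
apply: thin_sub (thin_polynomial pg g0) => v [c c0 h].
by apply/eqP/det0P; exists c => //; rewrite mulmxA h mul0mx.
Qed.

(** * Configurations placed at a root *)

Section Config.
Variables m n : nat.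
Implicit Types (z : 'I_m -> int) (V : 'M[rat]_(m, n)) (x p : 'rV[rat]_n).

Definition zrow z : 'rV[rat]_m := \row_i (z i)%:~R.
Definition energy V z := \sum_i (z i)%:~R * dot (row i V) (row i V).
Definition layer z := \sum_i z i.

(* A vertex reached from the root [x] is encoded by the integer vector [z]
   such that it equals [x + sum_i z_i v_i] (layer 0, an even number of red
   edges was used) or the opposite of it (layer -2). *)
Definition placed V x z p :=
  (layer z = 0 /\ p = x + zrow z *m V /\ dot p p = dot x x + energy V z) \/
  (layer z = -2 /\ p = - (x + zrow z *m V) /\ dot p p = - (dot x x + energy V z)).

(** It is 1 in layer 0 and -1 in layer -2, and being affine in [z] it is killed by every affine
    relation. *)
Definition sgn z : rat := 1 + (layer z)%:~R.

Lemma placedE V x z p : placed V x z p ->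
  [/\ layer z = 0 \/ layer z = -2, p = sgn z *: (x + zrow z *m V),
      dot p p = sgn z * (dot x x + energy V z) & sgn z ^+ 2 = 1].
Proof.
have m1 : 1 + (-2)%:~R = -1 :> rat by [].
rewrite /sgn => -[[-> [-> ->]]|[-> [-> ->]]]; rewrite ?m1; split; try by [left|right].
- by rewrite addr0 scale1r.
- by rewrite addr0 mul1r.
- by rewrite addr0 expr1n.
- by rewrite scaleN1r.
- by rewrite mulN1r.
- by rewrite sqrrN expr1n.
Qed.

Lemma zrow_unit z z' i c : (forall k, z k - z' k = c * (k == i)%:R) ->
  zrow z - zrow z' = c%:~R *: delta_mx 0 i.
Proof.
by move=> h; apply/rowP => k; rewrite !mxE -rmorphB /= h rmorphM /=; case: (k == i).
Qed.

Lemma energyB V z z' : energy V z - energy V z' =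
  \sum_i (z i - z' i)%:~R * dot (row i V) (row i V).
Proof. by rewrite /energy -sumrB; apply: eq_bigr => i _; rewrite rmorphB mulrBl. Qed.

(** The layers differ by 2, so [p] and [p'] have sum [2 v_i] and their squared norms sum to twice
    that of [v_i]. By the parallelogram identity [p - v_i] has norm 0. *)
Lemma no_double_step V x z z' p p' i : placed V x z p -> placed V x z' p' ->
  (forall k, k != i -> z k = z' k) -> z i - z' i = 2 -> p = row i V.
Proof.
move=> hp hp' off e.
have dz k : z k - z' k = 2 * (k == i)%:R.
  by have [->|/off ->] := eqVneq k i; rewrite ?e ?subrr ?mulr0 ?mulr1.
have dl : layer z - layer z' = 2.
  rewrite /layer -sumrB (bigD1 i) //= dz eqxx big1 => [|k ki]; first by lia.
  by rewrite dz (negPf ki) mulr0.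
have hr := zrow_unit dz.
have he : energy V z - energy V z' = 2 * dot (row i V) (row i V).
  rewrite energyB (bigD1 i) //= big1 ?addr0 ?e // => k ki.
  by rewrite dz (negPf ki) mulr0 mul0r.
case: hp => [[l [pE pp]]|[l [pE pp]]]; case: hp' => [[l' [pE' pp']]|[l' [pE' pp']]];
  try by move: dl; rewrite l l'.
have sumE : p + p' = 2 *: row i V.
  rewrite pE pE' opprD addrACA subrr add0r -mulmxBl hr -scalemxAl -rowE //.
have {}pE' : p' = 2 *: row i V - p by rewrite -sumE addrC addKr.
apply/eqP; rewrite -subr_eq0 -dot_eq0; apply/eqP.
have : dot p p + dot p' p' = 2 * dot (row i V) (row i V) by rewrite pp pp' -he; ring.
rewrite pE' !dotE (dotC (row i V) p).
by move: (dot p p) (dot p (row i V)) (dot (row i V) (row i V)); clear=> A B C; lra.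
Qed.

Section Family.
Variables (U : finType) (z : U -> 'I_m -> int).

(** The root [x] is an arbitrary rational point, so that only the vectors [z] have to be
    enumerated. *)
Definition bad_config (v : 'I_m -> 'rV[int]_n) := exists x (p : U -> 'rV[rat]_n),
  [/\ forall u, placed (rat_mx v) x (z u) (p u), injective p,
      forall u k, p u != row k (rat_mx v) &
      exists a : U -> rat, [/\ \sum_u a u = 0, \sum_u a u *: p u = 0 & exists u, a u != 0]].

Lemma bad_no2 v u w i : bad_config v -> changed z u w = [set i] ->
  (`|z u i - z w i| != 2)%N.
Proof.
move=> [x0 [p [hp _ hs _]]] /setP ch; apply/eqP => e.
have off k : k != i -> z u k = z w k.
  by move=> ki; apply/eqP; have := ch k; rewrite !inE (negPf ki) => /negbFE.
have [d|d] : z u i - z w i = 2 \/ z w i - z u i = 2 by lia.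
  by have := hs u i; rewrite (no_double_step (hp u) (hp w) off d) eqxx.
have off' k : k != i -> z w k = z u k by move=> /off ->.
by have := hs w i; rewrite (no_double_step (hp w) (hp u) off' d) eqxx.
Qed.

Lemma bad_inj v u w : bad_config v -> (forall i, z u i = z w i) -> u = w.
Proof.
move=> [x0 [p [hp pi _ _]]] e; apply: pi.
have [_ -> _ _] := placedE (hp u); have [_ -> _ _] := placedE (hp w).
have -> : zrow (z u) = zrow (z w) by apply/rowP => i; rewrite !mxE e.
by rewrite /sgn /layer (eq_bigr (z w)).
Qed.

Lemma bad_even v u : bad_config v -> exists k, \sum_i z u i = 2 * k.
Proof.
move=> [x0 [p [/(_ u)/placedE[h _ _ _] _ _ _]]].
by case: h => e; [exists 0 | exists (-1)]; rewrite -/(layer (z u)) e.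
Qed.

End Family.
End Config.

(* Summing the norm conditions with the weights [d] eliminates [x]; in the
   resulting equation the coefficient of [(v_i, v_j)] is twice the mixed moment. *)
Lemma thin_moments m n (U : finType) (z : U -> 'I_m -> int) :
  ~ diagonal_moments z -> thin (@bad_config m n.+1 U z).
Proof.
move=> nd; have [d [rel [i [j [ij mij]]]]] : exists d, affine_relation z d /\
    exists i j, i != j /\ \sum_x d x * (z x i)%:~R * (z x j)%:~R != 0.
  apply: contrapT => h; apply: nd => d rel i j ij; apply/eqP; apply: contraT => mij.
  by case: h; exists d; split=> //; exists i, j.
pose f (V : 'M[rat]_(m, n.+1)) := \sum_u d u * dot (zrow (z u) *m V) (zrow (z u) *m V) -
  \sum_u d u * sgn (z u) * energy V (z u).
have qf : quadratic f.
  apply: quadraticB; apply: quadratic_sum => u; apply: quadraticZ; first exact: quadratic_dot.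
  apply: quadratic_ext (quadratic_weight n.+1 (zrow (z u)) 0) => V.
  by apply: eq_bigr => k _; rewrite mxE.
have [s0 s1] := rel.
have [[V0 hV0]|f0] := pselect (exists V, f V != 0); last first.
  have {}f0 V : f V = 0 by apply/eqP; apply: contraT => h; case: f0; exists V.
  have fE a b : f (line_mx n (two_points i j a b)) =
      \sum_u d u * ((z u i)%:~R * a + (z u j)%:~R * b) ^+ 2 -
      \sum_u d u * sgn (z u) * ((z u i)%:~R * a ^+ 2 + (z u j)%:~R * b ^+ 2).
    congr (_ - _); apply: eq_bigr => u _; congr (_ * _).
      rewrite /line_mx dot_line -expr2 -(lin_two (z u)); congr (_ ^+ 2).
      by rewrite mxE; apply: eq_bigr => k _; rewrite !mxE.
    rewrite -(sqr_two (z u) a b ij); apply: eq_bigr => k _; congr (_ * _).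
    by rewrite rowE /line_mx dot_line delta_line -expr2.
  case/negP: mij; apply/eqP/(@mulfI _ 2) => //; rewrite mulr0.
  (* Polarization isolates the coefficient of [a * b]; the part with [sgn] contains only squares and
     cancels. *)
  have : f (line_mx n (two_points i j 1 1)) - f (line_mx n (two_points i j 1 0)) -
     f (line_mx n (two_points i j 0 1)) = 0 by rewrite !f0 !subr0.
  rewrite !fE => h; rewrite -[RHS]h mulr_sumr.
  rewrite (_ : forall a b c a' b' c' : rat, a - a' - (b - b') - (c - c') = (a - b - c) - (a' - b' - c')); last by move=> *; ring.
  rewrite -!sumrB; apply: eq_bigr => u _; ring.
apply: thin_sub (thin_polynomial (proj1 qf) hV0) => v [x [p [hp _ _ _]]].
set V := rat_mx v in hp *.
have key u : dot (zrow (z u) *m V) (zrow (z u) *m V) - sgn (z u) * energy V (z u) =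
    sgn (z u) * dot x x - dot x x - 2 * dot x (zrow (z u) *m V).
  have [_ pE pp s2] := placedE (hp u); move: pp; rewrite pE dotZl dotZr mulrA -expr2 s2 mul1r.
  rewrite !dotE (dotC _ x) => h.
  have -> : sgn (z u) * energy V (z u) = sgn (z u) * (dot x x + energy V (z u)) - sgn (z u) * dot x x by ring.
  by rewrite -h; ring.
have ssum : \sum_u d u * sgn (z u) = 0.
  rewrite /sgn; under eq_bigr do rewrite mulrDr mulr1 /layer rmorph_sum mulr_sumr.
  rewrite big_split /= s0 add0r exchange_big /= big1 // => k _; exact: s1.
have zsum : \sum_u d u *: zrow (z u) = 0.
  apply/rowP => k; rewrite summxE [RHS]mxE -[RHS](s1 k).
  by apply: eq_bigr => u _; rewrite !mxE.
rewrite /f -sumrB.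
rewrite (eq_bigr (fun u => d u * sgn (z u) * dot x x - d u * dot x x - 2 * dot (d u *: zrow (z u) *m V) x)); last first.
  move=> u _; transitivity (d u * (dot (zrow (z u) *m V) (zrow (z u) *m V) - sgn (z u) * energy V (z u))); first by ring.
  by rewrite key -scalemxAl dotZl (dotC _ x); ring.
rewrite !sumrB -!mulr_suml -mulr_sumr ssum s0 !mul0r subrr sub0r.
by rewrite -dot_suml -mulmx_suml zsum mul0mx dot0l mulr0 oppr0.
Qed.

Definition independent (U I : finType) (z : U -> I -> int) :=
  forall d, affine_relation z d -> forall u, d u = 0.

Lemma adjacent_form (U I : finType) (z : U -> I -> int) u w : adjacent z u w ->
  exists i j (a b : int), [/\ i != j, `|a|%N = 1%N, `|b|%N = 1%N &
    forall k, z w k - z u k = a * (k == i)%:R + b * (k == j)%:R].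
Proof.
move=> /andP[/cards2P[i [j [ij ch]]] /forallP le1].
exists i, j, (z w i - z u i), (z w j - z u j).
have h k : (z u k != z w k) = (k == i) || (k == j).
  by have /setP/(_ k) := ch; rewrite !inE.
split=> //.
- by have := h i; have := le1 i; rewrite eqxx; lia.
- by have := h j; have := le1 j; rewrite eqxx orbT; lia.
move=> k; have := h k; have [->|ki] := eqVneq k i; first by rewrite (negPf ij); lia.
by have [->|kj] := eqVneq k j => /=; lia.
Qed.

Lemma sum_form (I : finType) (i j : I) (a b : int) :
  \sum_k (a * (k == i)%:R + b * (k == j)%:R) = a + b.
Proof.
have ind (c : int) l : \sum_k c * (k == l)%:R = c.
  by rewrite (bigD1 l) //= eqxx mulr1 big1 ?addr0 // => k /negPf ->; rewrite mulr0.
by rewrite big_split /= !ind.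
Qed.

(** * Configurations in a single layer *)

Section Ordinals.
Variables (m n k : nat).

Section OneLayer.
Variable z : 'I_k.+1 -> 'I_m -> int.
Hypothesis zA : forall u, layer (z u) = 0.
Hypothesis ind : independent z.
Definition steps : 'M[int]_(k, m) := \matrix_(t, c) (z (lift ord0 t) c - z ord0 c).

Lemma steps_free : row_free (map_mx intr steps : 'M[rat]_(k, m)).
Proof.
rewrite -kermx_eq0; apply/rowV0P => c /sub_kermxP/rowP hc.
pose d u := if unlift ord0 u is Some t then c 0 t else - \sum_t c 0 t.
have d0 : d ord0 = - \sum_t c 0 t by rewrite /d unlift_none.
have dS t : d (lift ord0 t) = c 0 t by rewrite /d liftK.
have rel : affine_relation z d.
  split; first by rewrite big_ord_recl d0; under [X in _ + X]eq_bigr do rewrite dS; rewrite addNr.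
  move=> i; rewrite big_ord_recl d0 mulNr mulr_suml.
  rewrite [X in _ + X](eq_bigr (fun t => c 0 t * (z ord0 i)%:~R + c 0 t * (steps t i)%:~R)).
    rewrite big_split addrA addNr add0r; have := hc i; rewrite !mxE => e; rewrite -[RHS]e.
    by apply: eq_bigr => t _; rewrite [X in _ = _ * X]mxE.
  by move=> t _; rewrite dS mxE rmorphB /=; ring.
by apply/rowP => t; rewrite mxE -dS (ind rel).
Qed.

Lemma row_steps (V : 'M[rat]_(m, n)) t :
  row t (map_mx intr steps *m V) = zrow (z (lift ord0 t)) *m V - zrow (z ord0) *m V.
Proof.
by rewrite row_mul -mulmxBl; congr (_ *m _); apply/rowP => c; rewrite !mxE rmorphB.
Qed.

Lemma steps_relation v : bad_config (n := n) z v ->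
  exists2 c : 'rV_k, c != 0 & c *m ((map_mx intr steps : 'M[rat]_(k, m)) *m rat_mx v) = 0.
Proof.
move=> [x [p [hp _ _ [a [s0 s1 [u au]]]]]]; exists (\row_t a (lift ord0 t)).
  apply/eqP => /rowP h; have a0 t : a (lift ord0 t) = 0 by have := h t; rewrite !mxE.
  move: au s0; case: (unliftP ord0 u) => [t ->|->]; first by rewrite a0 eqxx.
  by rewrite big_ord_recl big1 ?addr0 // => au e; rewrite e eqxx in au.
have pE w : p w = x + zrow (z w) *m rat_mx v.
  by case: (hp w) => [[_ [->]]//|[l _]]; have := zA w; rewrite l.
rewrite mulmx_sum_row; under eq_bigr do rewrite row_steps mxE.
have s2 : \sum_w a w *: (zrow (z w) *m rat_mx v - zrow (z ord0) *m rat_mx v) = 0.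
  rewrite -[RHS]s1 -[RHS]subr0 -[X in _ - X](scale0r (x + zrow (z ord0) *m rat_mx v)) -s0.
  rewrite scaler_suml -sumrB; apply: eq_bigr => w _.
  by rewrite pE -scalerBr opprD addrACA subrr add0r.
by rewrite big_ord_recl subrr scaler0 add0r in s2.
Qed.

End OneLayer.
End Ordinals.

(** Up to [n.+2] points, the steps from the root are independent outside a thin set. With one point
    more, dependence is automatic in dimension [n.+1] and the norms have to be used; a neighbour of
    [z ord0] supplies the root required by [thin_flat]. *)
Lemma thin_one_layer m n k (z : 'I_k.+1 -> 'I_m -> int) : (k <= n.+2)%N ->
  connected z [set: 'I_k.+1] -> (forall u, layer (z u) = 0) -> independent z ->
  thin (bad_config (n := n.+1) z).
Proof.
move=> kn conn zA ind; move: kn; rewrite leq_eqVlt => /orP[/eqP ek|kn]; last first.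
  have {}kn : (k <= n.+1)%N by [].
  by apply: thin_sub (thin_rank kn (steps_free ind)) => v; apply: steps_relation.
subst k; have [t0 [i [j [ij hM]]]] : exists t i j, i != j /\
    forall c, steps z t c = (c == j)%:R - (c == i)%:R.
  have [||x [y [xP yP xy]]] := conn [set ord0] (subsetT _).
  - by apply/set0Pn; exists ord0; rewrite inE.
  - by apply/eqP => /setP/(_ ord_max); rewrite !inE.
  move: xP yP; rewrite !inE andbT => /eqP ex; rewrite {}ex in xy => y0.
  have [t yt|/eqP] := unliftP ord0 y; last by rewrite (negPf y0).
  have [i [j [a [b [ij a1 b1 h]]]]] := adjacent_form xy.
  have ab : a + b = 0.
    rewrite -(sum_form i j); under eq_bigr do rewrite -h.
    by rewrite sumrB; have := zA y; have := zA ord0; rewrite /layer => -> ->.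
  have [e|e] : a = -1 /\ b = 1 \/ a = 1 /\ b = -1 by lia.
    exists t, i, j; split=> // c; rewrite mxE -yt h e.1 e.2; ring.
  exists t, j, i; split; first by rewrite eq_sym.
  by move=> c; rewrite mxE -yt h e.1 e.2; ring.
apply: thin_sub (thin_flat (steps_free ind) ij hM) => v [x [p [hp _ hs _]]].
exists (p ord0); split; last by move=> c; apply: hs.
have pE w : p w = x + zrow (z w) *m rat_mx v /\ dot (p w) (p w) = dot x x + energy (rat_mx v) (z w).
  by case: (hp w) => [[_ [->]]//|[l _]]; have := zA w; rewrite l.
move=> t; have [eu pu] := pE (lift ord0 t); have [e0 p0] := pE ord0.
rewrite /flat_level -row_mul; set r := row t _.
have pr : p (lift ord0 t) = p ord0 + r by rewrite /r row_steps eu e0 -addrA [X in _ = _ + X]addrC subrK.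
have : dot (p (lift ord0 t)) (p (lift ord0 t)) - dot (p ord0) (p ord0) = weight (map_mx intr (steps z)) t (rat_mx v).
  rewrite pu p0 opprD addrACA subrr add0r energyB; apply: eq_bigr => c _.
  by rewrite !mxE.
by rewrite pr !dotE (dotC r) => <-; ring.
Qed.

(** * Configurations meeting both layers *)

Section TwoLayers.
Variables (m n k : nat) (z : 'I_k.+2 -> 'I_m -> int) (t : 'I_k.+2) (s : 'I_k.+1).
Variables (al be : 'I_m).
Hypothesis zl : forall u, layer (z u) = 0 \/ layer (z u) = -2.
Hypothesis ind : independent z.
Hypothesis tA : layer (z t) = 0.
Hypothesis sB : layer (z (lift t s)) = -2.
Hypothesis zts : forall c, z (lift t s) c - z t c = - (c == al)%:R - (c == be)%:R.

Definition other (i : 'I_k) := lift t (lift s i).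
(** Every vertex is compared with the end of the red edge in its own layer, so each row sums to 0.
    The difference is reversed in layer -2, where vertices are opposites; thus the rows of [N *m V]
    are differences of actual points. *)
Definition mixed_steps : 'M[int]_(k, m) := \matrix_(i, c)
  (if layer (z (other i)) == 0 then z (other i) c - z t c else z (lift t s) c - z (other i) c).
Definition side (i : 'I_k) : rat := if layer (z (other i)) == 0 then 1 else -1.
Let N : 'M[rat]_(k, m) := map_mx intr mixed_steps.

Lemma sum_other (A : nmodType) (F : 'I_k.+2 -> A) :
  \sum_u F u = F t + (F (lift t s) + \sum_i F (other i)).
Proof. by rewrite (bigD1_ord t) //= (bigD1_ord s). Qed.

Lemma side1 i : side i = 1 \/ side i = -1.
Proof. by rewrite /side; case: ifP; auto. Qed.

Lemma mixed_steps_sum i : \sum_c mixed_steps i c = 0.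
Proof.
rewrite (eq_bigr (fun c => if layer (z (other i)) == 0 then z (other i) c - z t c
  else z (lift t s) c - z (other i) c)) => [|c _]; last by rewrite mxE.
case: (zl (other i)) => e; rewrite e /= sumrB -!/(layer _) e ?tA ?sB //.
Qed.

(** A combination killing the rows becomes an affine relation of [z] once [t] and [lift t s] receive
    the coefficients that make each layer sum to 0. *)
Lemma mixed_steps_free : row_free N.
Proof.
rewrite -kermx_eq0; apply/rowV0P => c /sub_kermxP/rowP hc.
pose d u := if unlift t u is Some w then
    if unlift s w is Some i then side i * c 0 i
    else \sum_(i | layer (z (other i)) != 0) c 0 i
  else - \sum_(i | layer (z (other i)) == 0) c 0 i.
have dt : d t = - \sum_(i | layer (z (other i)) == 0) c 0 i by rewrite /d unlift_none.
have ds : d (lift t s) = \sum_(i | layer (z (other i)) != 0) c 0 i by rewrite /d liftK unlift_none.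
have dO i : d (other i) = side i * c 0 i by rewrite /d !liftK.
have rel : affine_relation z d.
  have main (f : 'I_k.+2 -> rat) : \sum_i c 0 i *
      (if layer (z (other i)) == 0 then f (other i) - f t else f (lift t s) - f (other i)) = 0 ->
      \sum_u d u * f u = 0.
    move=> e; rewrite -[RHS]e sum_other dt ds mulNr !mulr_suml.
    rewrite -sumrN [X in X + _]big_mkcond [X in _ + (X + _)]big_mkcond -!big_split /=; apply: eq_bigr => i _.
    by rewrite dO /side; case: ifP => _ /=; ring.
  split.
    transitivity (\sum_u d u * 1); first by apply: eq_bigr => u _; rewrite mulr1.
    by apply: (main (fun=> 1)); rewrite big1 // => i _; case: ifP; rewrite subrr mulr0.
  move=> j; apply: main; have := hc j; rewrite !mxE => e; rewrite -[RHS]e.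
  by apply: eq_bigr => i _; rewrite !mxE; case: ifP; rewrite rmorphB.
apply/rowP => i; rewrite mxE; have := ind rel (other i); rewrite dO => /eqP.
by rewrite mulf_eq0; case: (side1 i) => -> /=; rewrite ?oppr_eq0 ?oner_eq0 => /eqP.
Qed.

Section Points.
Variables (v : 'I_m -> 'rV[int]_n.+1) (x : 'rV[rat]_n.+1) (p : 'I_k.+2 -> 'rV[rat]_n.+1).
Let V := rat_mx v.
Hypothesis hp : forall u, placed V x (z u) (p u).

Lemma placed_layer0 u : layer (z u) == 0 ->
  p u = x + zrow (z u) *m V /\ dot (p u) (p u) = dot x x + energy V (z u).
Proof. by case: (hp u) => [[_ [->]]//|[-> _]]. Qed.

Lemma placed_layer2 u : layer (z u) != 0 ->
  p u = - (x + zrow (z u) *m V) /\ dot (p u) (p u) = - (dot x x + energy V (z u)).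
Proof. by case: (hp u) => [[-> _]//|[_ [->]]]. Qed.

Lemma row_mixed i : row i (N *m V) = p (other i) -
  (if layer (z (other i)) == 0 then p t else p (lift t s)).
Proof.
have sB' : layer (z (lift t s)) != 0 by rewrite sB.
have tA' : layer (z t) == 0 by rewrite tA.
rewrite row_mul (_ : row i N = if layer (z (other i)) == 0 then zrow (z (other i)) - zrow (z t)
  else zrow (z (lift t s)) - zrow (z (other i))); last first.
  by apply/rowP => c; rewrite !mxE; case: ifP => _; rewrite !mxE rmorphB.
case: ifP => h; rewrite mulmxBl.
  have [-> _] := placed_layer0 h; have [-> _] := placed_layer0 tA'.
  by rewrite opprD addrACA subrr add0r.
have [-> _] := placed_layer2 (negbT h); have [-> _] := placed_layer2 sB'.
by rewrite opprK opprD addrACA addNr add0r addrC.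
Qed.

Lemma zts_rat c : (z t c - z (lift t s) c)%:~R = (c == al)%:R + (c == be)%:R :> rat.
Proof.
rewrite (_ : z t c - z (lift t s) c = (c == al)%:R + (c == be)%:R); last first.
  by rewrite -opprB zts opprB opprK addrC.
by case: (c == al); case: (c == be).
Qed.

Lemma pair_sum : p t + p (lift t s) = row al V + row be V.
Proof.
have sB' : layer (z (lift t s)) != 0 by rewrite sB.
have tA' : layer (z t) == 0 by rewrite tA.
have [-> _] := placed_layer0 tA'; have [-> _] := placed_layer2 sB'.
rewrite opprD addrACA subrr add0r -mulmxBl !rowE -mulmxDl; congr (_ *m _).
by apply/rowP => c; rewrite !mxE eqxx /= -zts_rat rmorphB.
Qed.

Lemma pair_energy : dot (p t) (p t) + dot (p (lift t s)) (p (lift t s)) =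
  dot (row al V) (row al V) + dot (row be V) (row be V).
Proof.
have sB' : layer (z (lift t s)) != 0 by rewrite sB.
have tA' : layer (z t) == 0 by rewrite tA.
have [_ ->] := placed_layer0 tA'; have [_ ->] := placed_layer2 sB'.
rewrite opprD addrACA subrr add0r energyB.
have ind2 l (f : 'I_m -> rat) : \sum_c (c == l)%:R * f c = f l.
  by rewrite (bigD1 l) //= eqxx mul1r big1 ?addr0 // => c /negPf ->; rewrite mul0r.
rewrite -(ind2 al (fun c => dot (row c V) (row c V))) -(ind2 be (fun c => dot (row c V) (row c V))).
rewrite -big_split /=; apply: eq_bigr => c _; rewrite -mulrDl; congr (_ * _).
exact: zts_rat.
Qed.

Lemma other_energy i : dot (p (other i)) (p (other i)) -
  (if layer (z (other i)) == 0 then dot (p t) (p t) else dot (p (lift t s)) (p (lift t s))) =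
  weight N i V.
Proof.
have sB' : layer (z (lift t s)) != 0 by rewrite sB.
have tA' : layer (z t) == 0 by rewrite tA.
have wE : weight N i V = if layer (z (other i)) == 0 then energy V (z (other i)) - energy V (z t)
    else energy V (z (lift t s)) - energy V (z (other i)).
  by case: ifP => h; rewrite energyB; apply: eq_bigr => c _; rewrite !mxE h.
rewrite wE; case: ifP => h.
  have [_ ->] := placed_layer0 h; have [_ ->] := placed_layer0 tA'; ring.
have [_ ->] := placed_layer2 (negbT h); have [_ ->] := placed_layer2 sB'; ring.
Qed.

(** Let [b] be the total coefficient of layer 0, so that layer -2 has [- b]. Measured from the
    midpoint, the relation reads [c *m (N *m V) = - (2 * b) *: y]: either [b = 0] and the rows are
    dependent, or [y] lies in their span. *)
Lemma mixed_relation (a : 'I_k.+2 -> rat) : \sum_u a u = 0 -> \sum_u a u *: p u = 0 ->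
  (exists u, a u != 0) -> (forall l, p t != row l V) ->
  (exists2 c : 'rV_k, c != 0 & c *m (N *m V) = 0) \/
  mixed_constraint mixed_steps side al be V (p t - 2^-1 *: (row al V + row be V)).
Proof.
move=> s0 s1 [u0 au0] hs; set mid := 2^-1 *: _.
have pt : p t = (p t - mid) + mid by rewrite subrK.
have ps : p (lift t s) = mid - (p t - mid).
  apply/eqP; rewrite opprB addrA -mulr2n -scaler_nat /mid scalerA mulfV // scale1r.
  by rewrite -pair_sum addrAC subrr add0r.
have mE : mid = 2^-1 *: (row al V + row be V) by [].
set y := p t - mid in pt ps *; clearbody y; clearbody mid.
have m2 : row al V + row be V = 2 *: mid by rewrite mE scalerA mulfV // scale1r.
pose b := a t + \sum_(i | layer (z (other i)) == 0) a (other i).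
pose c : 'rV[rat]_k := \row_i a (other i).
have cE : c *m (N *m V) = - (2 * b) *: y.
  have sb : a (lift t s) + \sum_(i | layer (z (other i)) != 0) a (other i) = - b.
    have e := s0; rewrite sum_other (bigID (fun i => layer (z (other i)) == 0)) /= in e.
    by apply/eqP; rewrite -addr_eq0 -[X in _ == X]e /b; apply/eqP; ring.
  have : \sum_u a u *: p u = b *: p t - b *: p (lift t s) + c *m (N *m V).
    rewrite sum_other mulmx_sum_row.
    rewrite (eq_bigr (fun i => c 0 i *: row i (N *m V) + a (other i) *:
       (if layer (z (other i)) == 0 then p t else p (lift t s)))); last first.
      by move=> i _; rewrite row_mixed mxE -scalerDr subrK.
    rewrite big_split /= [X in _ + (_ + (_ + X))](bigID (fun i => layer (z (other i)) == 0)) /=.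
    rewrite [X in _ + (_ + (_ + (X + _)))](eq_bigr (fun i => a (other i) *: p t)) => [|i ->//].
    rewrite [X in _ + (_ + (_ + (_ + X)))](eq_bigr (fun i => a (other i) *: p (lift t s))).
      rewrite -!scaler_suml -scaleNr -sb /b !scalerDl.
      set A := a t *: _; set B := a (lift t s) *: _; set C := \sum_i _; set D := _ *: p t.
      set E := _ *: p _; rewrite addrA [C + _]addrC addrA; congr (_ + _).
      by rewrite addrACA.
    by move=> i /negPf ->.
  rewrite s1 => /esym/eqP; rewrite addrC addr_eq0 => /eqP ->.
  rewrite -scalerBr ps pt [y + mid]addrC opprD opprK addrACA subrr add0r.
  by rewrite -mulr2n -scaler_nat scalerA -scaleNr mulrC.
have [b0|b0] := eqVneq b 0.
  left; exists c; last by rewrite cE b0 mulr0 oppr0 scale0r.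
  apply: contraNneq au0 => /rowP c0; apply/eqP.
  have a0 i : a (other i) = 0 by have := c0 i; rewrite !mxE.
  have at0 : a t = 0 by rewrite -b0 /b big1 ?addr0.
  have as0 : a (lift t s) = 0 by move: s0; rewrite sum_other at0 big1 // add0r addr0.
  have [w ->|->//] := unliftP t u0; have [i ->|->//] := unliftP s w; exact: a0.
right; split.
- exists (- (2 * b)^-1 *: c); rewrite -scalemxAl cE scalerA mulrNN mulVf ?scale1r //.
  by rewrite mulf_neq0.
- move=> i; rewrite /root_level -/V -row_mul; set r := row i _.
  have := other_energy i; have := row_mixed i; rewrite -/r /side; case: ifP => h.
    move=> e; rewrite (_ : p (other i) = y + mid + r); last by rewrite -pt e addrC subrK.
    rewrite pt => <-; rewrite m2.
    by rewrite !dotE (dotC r y) (dotC r mid) (dotC mid y); field.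
  move=> e; rewrite (_ : p (other i) = mid - y + r); last by rewrite -ps e addrC subrK.
  rewrite ps => <-; rewrite m2.
  by rewrite !dotE (dotC r y) (dotC r mid) (dotC mid y); field.
- have := pair_energy; rewrite ps pt mE /root_gap; set A := row al V; set B := row be V.
  rewrite !dotE (dotC A y) (dotC B y) (dotC B A); move: (dot y y) (dot A A) (dot A B) (dot B B).
  by move: (dot y A) (dot y B) => *; lra.
- apply: contraNneq (hs al) => e; apply/eqP; rewrite pt e mE /root_gap -scalerDr.
  rewrite addrC addrACA subrr addr0 -mulr2n -scaler_nat scalerA mulVf // scale1r //.
apply: contraNneq (hs be) => e; apply/eqP; rewrite pt e mE /root_gap scaleNr -scalerN -scalerDr.
by rewrite opprB [row al V + _]addrC addrACA addNr addr0 -mulr2n -scaler_nat scalerA mulVf // scale1r.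
Qed.

End Points.
End TwoLayers.

Lemma thin_config m n k (z : 'I_k.+1 -> 'I_m -> int) : (k <= n.+2)%N ->
  connected z [set: 'I_k.+1] -> (exists u, layer (z u) = 0) ->
  thin (bad_config (n := n.+1) z).
Proof.
move=> kn conn [ur zr].
have [diag|] := pselect (diagonal_moments z); last exact: thin_moments.
(* One bad parameter suffices to give injectivity, parity and the absence of double steps, since
   these are properties of [z] alone. *)
have [[v0 bad0]|none] := pselect (exists v, bad_config (n := n.+1) z v); last first.
  by apply: thin_none => v bv; apply: none; exists v.
have ind : independent z.
  move=> d rel u; apply: (diagonal_moments_independent _ conn _ _ diag rel).
  - by move=> x y; apply: bad_inj bad0.
  - by move=> x; apply: bad_even bad0.
  - by move=> x y i; apply: bad_no2 bad0.
have zl u : layer (z u) = 0 \/ layer (z u) = -2.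
  by have [x [p [/(_ u)/placedE[h _ _ _] _ _ _]]] := bad0.
have [/forallP zA|] := boolP [forall u, layer (z u) == 0].
  by apply: thin_one_layer => // u; apply/eqP.
rewrite negb_forall => /existsP[us us2].
(* Connectedness gives an adjacent pair across the layers. Its two unit changes sum to -2, so both
   are -1, as for a red edge. *)
have [|||t [s' [tA]]] := conn [set u | layer (z u) == 0].
- exact: subsetT.
- by apply/set0Pn; exists ur; rewrite inE zr.
- by apply: contraNneq us2 => /setP/(_ us); rewrite !inE => ->.
rewrite !inE andbT in tA *; move/eqP: tA => tA sB ts.
have {}sB : layer (z s') = -2 by case: (zl s') sB => ->.
have nts : t != s' by apply/eqP => e; rewrite e sB in tA.
have [w es _] := unlift_some nts; subst s'.
clear ur zr us us2 v0 bad0 diag conn.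
case: k z kn ind zl t tA w sB ts nts => [|k] z kn ind zl t tA w sB ts nts; first by have := ltn_ord w.
have [al [be [a [b [albe a1 b1 h]]]]] := adjacent_form ts.
have ab : a + b = -2.
  rewrite -(sum_form al be); under eq_bigr do rewrite -h.
  by rewrite sumrB -!/(layer _) tA sB.
have zts c : z (lift t w) c - z t c = - (c == al)%:R - (c == be)%:R.
  by rewrite h; have [-> ->] : a = -1 /\ b = -1; [lia | rewrite !mulN1r].
have {}kn : (k <= n.+1)%N by [].
have free := mixed_steps_free t w ind.
have thin1 := thin_rank kn free.
have thin2 := thin_mixed kn free (mixed_steps_sum zl tA sB) (side1 z t w) albe.
apply: thin_sub (thin_or thin1 thin2).
move=> v [x [p [hp _ hs [c [s0 s1 c0]]]]].
have := mixed_relation tA sB zts hp s0 s1 c0 (hs t).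
by case=> h'; [left | right; exists (p t - 2^-1 *: (row al (rat_mx v) + row be (rat_mx v)))].
Qed.

(** * Growing a component *)

Section Growth.
Variables (m n : nat) (v : 'I_m -> 'rV[int]_n.+1).
Implicit Types h : 'rV[int]_n.+1.
Let V := rat_mx v.
Notation rat_row := (map_mx (intr : int -> rat)).

Lemma sqnorm_dot h : (sqnorm h)%:~R = dot (rat_row h) (rat_row h).
Proof. by rewrite rmorph_sum; apply: eq_bigr => c _; rewrite rmorphXn /= !mxE expr2. Qed.

Lemma rat_row_inj : injective (fun h => rat_row h).
Proof. by move=> a b /rowP e; apply/rowP => c; have := e c; rewrite !mxE => /eqP; rewrite eqr_int => /eqP. Qed.

Lemma row_rat i : row i V = rat_row (v i).
Proof. by apply/rowP => c; rewrite !mxE. Qed.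

(** The four choices of signs correspond to the two colors of the edge and the two layers of its
    starting vertex. *)
Definition root_step (z z' : 'I_m -> int) := exists i j (a b : int),
  [/\ i != j, `|a|%N = 1%N, `|b|%N = 1%N & forall c, z' c = z c + a * (c == i)%:R + b * (c == j)%:R].

Lemma root_step_adjacent (U : finType) (z : U -> 'I_m -> int) u w :
  root_step (z u) (z w) -> adjacent z u w.
Proof.
move=> [i [j [a [b [ij a1 b1 h]]]]]; have ji : (j == i) = false by rewrite eq_sym (negPf ij).
apply/andP; split.
  suff -> : changed z u w = [set i; j] by rewrite cards2 ij.
  apply/setP => c; rewrite !inE h; have [->|ci] := eqVneq c i.
    by rewrite (negPf ij) /=; lia.
  by have [->|cj] := eqVneq c j => /=; lia.
apply/forallP => c; rewrite h; have [->|ci] := eqVneq c i.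
  by rewrite (negPf ij) /=; lia.
by have [->|cj] := eqVneq c j => /=; lia.
Qed.

Lemma joined_sym h (k : 'rV[int]_n.+1) : joined (gamma_edge v) h k -> joined (gamma_edge v) k h.
Proof.
case/existsP => i /existsP[j]; rewrite /gamma_edge => hij.
apply/existsP; exists j; apply/existsP; exists i; rewrite eq_sym.
case: (i != j) hij => //= /orP[/andP[/eqP e1 /eqP e2]|/andP[/eqP e1 /eqP e2]].
  by rewrite -(opprB k) e1 opprB eqxx -(opprB (sqnorm k)) e2 opprB eqxx.
by rewrite [h + k]addrC [v j + v i]addrC e1 eqxx [sqnorm h + sqnorm k]addrC [sqnorm (v j) + sqnorm (v i)]addrC e2 eqxx orbT.
Qed.

Lemma zrow_step z z' i j (a b : int) :
  (forall c, z' c = z c + a * (c == i)%:R + b * (c == j)%:R) ->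
  zrow z' *m V = zrow z *m V + (a%:~R *: rat_row (v i) + b%:~R *: rat_row (v j)).
Proof.
move=> h; rewrite -!row_rat !rowE !scalemxAl -mulmxDl -mulmxDl; congr (_ *m _).
by apply/rowP => c; rewrite !mxE h !rmorphD !rmorphM /= addrA; case: (c == i); case: (c == j).
Qed.

Lemma energy_step z z' i j (a b : int) :
  (forall c, z' c = z c + a * (c == i)%:R + b * (c == j)%:R) ->
  energy V z' = energy V z + (a * sqnorm (v i) + b * sqnorm (v j))%:~R.
Proof.
move=> h; rewrite rmorphD !rmorphM /= !sqnorm_dot -!row_rat.
have ind l (x : rat) : \sum_c x * (c == l)%:R * dot (row c V) (row c V) = x * dot (row l V) (row l V).
  by rewrite (bigD1 l) //= eqxx mulr1 big1 ?addr0 // => c /negPf ->; rewrite mulr0 mul0r.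
rewrite -(ind i) -(ind j) -!big_split /=; apply: eq_bigr => c _.
by rewrite h !rmorphD !rmorphM /=; case: (c == i); case: (c == j) => /=; ring.
Qed.

Lemma layer_step (z z' : 'I_m -> int) i j (a b : int) :
  (forall c, z' c = z c + a * (c == i)%:R + b * (c == j)%:R) ->
  layer z' = layer z + (a + b).
Proof.
by move=> h; rewrite -(sum_form i j) -big_split; apply: eq_bigr => c _; rewrite h -addrA.
Qed.

Lemma placed_step x z h (k : 'rV[int]_n.+1) : placed V x z (rat_row h) -> joined (gamma_edge v) h k ->
  exists z', placed V x z' (rat_row k) /\ root_step z z'.
Proof.
move=> ph /existsP[i /existsP[j]]; rewrite /gamma_edge; case ij: (i != j) => //=.
pose z' (a b : int) c := z c + a * (c == i)%:R + b * (c == j)%:R.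
have hz a b c : z' a b c = z c + a * (c == i)%:R + b * (c == j)%:R by [].
have rs a b : `|a|%N = 1%N -> `|b|%N = 1%N -> root_step z (z' a b).
  by move=> a1 b1; exists i, j, a, b.
have zs a b := zrow_step (hz a b); have es a b := energy_step (hz a b).
have ls a b := layer_step (hz a b).
case/orP => /andP[/eqP e1 /eqP e2].
  have ek : rat_row k = rat_row h + (rat_row (v j) - rat_row (v i)).
    by rewrite -!raddfB -raddfD /= -e1 addrC subrK.
  have nk : dot (rat_row k) (rat_row k) = dot (rat_row h) (rat_row h) +
      (sqnorm (v j) - sqnorm (v i))%:~R.
    by rewrite -!sqnorm_dot -rmorphD /= -e2 addrC subrK.
  case: ph => [[l0 [pE pp]]|[l2 [pE pp]]].
    exists (z' (-1) 1); split; last exact: rs; left; rewrite ls l0 zs es nk pp ek pE.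
    split=> //; split; first by rewrite mulrN1z mulr1z scaleN1r scale1r -addrA [- _ + _]addrC.
    by rewrite mulN1r mul1r [- _ + sqnorm _]addrC addrA.
  exists (z' 1 (-1)); split; last exact: rs; right; rewrite ls l2 zs es nk pp ek pE.
  split=> //; split; first by rewrite mulrN1z mulr1z scaleN1r scale1r [in RHS]addrA [in RHS]opprD opprB.
  by rewrite mulN1r mul1r [in RHS]addrA [in RHS]opprD -rmorphN opprB.
have ek : rat_row k = rat_row (v i) + rat_row (v j) - rat_row h.
  by rewrite -raddfD -raddfB /= -e1 addrK.
have nk : dot (rat_row k) (rat_row k) = (sqnorm (v i) + sqnorm (v j))%:~R - dot (rat_row h) (rat_row h).
  by rewrite -!sqnorm_dot -rmorphB /= -e2 addrK.
case: ph => [[l0 [pE pp]]|[l2 [pE pp]]].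
  exists (z' (-1) (-1)); split; last exact: rs; right; rewrite ls l0 zs es nk pp ek pE.
  split=> //; split; first by rewrite !mulrN1z !scaleN1r addrA -opprD opprB.
  by rewrite !mulN1r addrA -opprD rmorphN /= opprB.
exists (z' 1 1); split; last exact: rs; left; rewrite ls l2 zs es nk pp ek pE.
split=> //; split; first by rewrite !mulr1z !scale1r addrA opprK addrC.
by rewrite !mul1r addrA opprK addrC.
Qed.

Definition aff_indep k (q : nat -> 'rV[int]_n.+1) := forall a : 'I_k.+1 -> rat,
  \sum_u a u = 0 -> \sum_u a u *: rat_row (q u) = 0 -> forall u, a u = 0.

Lemma aff_indep_bound k q : aff_indep k q -> (k <= n.+1)%N.
Proof.
move=> ind; pose A : 'M[rat]_(k.+1, 1 + n.+1) :=
  row_mx (const_mx 1) (\matrix_(u < k.+1) rat_row (q u)).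
suff fA : row_free A by have := rank_leq_col A; rewrite (eqP fA).
rewrite -kermx_eq0; apply/rowV0P => c /sub_kermxP.
rewrite /A mul_mx_row -[0 in RHS](row_mx0 _ _ 1 n.+1) => /eq_row_mx[h1 h2].
apply/rowP => u; rewrite [RHS]mxE; apply: (ind (c 0)).
  have /matrixP/(_ 0 0) := h1; rewrite mxE [RHS]mxE => e; rewrite -[RHS]e.
  by apply: eq_bigr => w _; rewrite mxE mulr1.
by rewrite -[RHS]h2 mulmx_sum_row; apply: eq_bigr => w _; rewrite rowK.
Qed.

(** Each new vertex is joined to an earlier one, so the entries of [z u] are bounded by [u]; this
    bound leaves finitely many configurations to exclude. *)
Definition grown x k (q : nat -> 'rV[int]_n.+1) (z : nat -> 'I_m -> int) :=
  [/\ forall u, (u <= k)%N -> placed V x (z u) (rat_row (q u)),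
      forall u, (0 < u <= k)%N -> exists2 w, (w < u)%N & root_step (z w) (z u),
      forall u i, (u <= k)%N -> (`|z u i| <= u)%N,
      forall u w, (u <= k)%N -> (w <= k)%N -> q u = q w -> u = w & z 0%N = fun=> 0].

(** A part without [ord0] is left at its earliest vertex, whose parent is older; a part containing
    [ord0] is treated through its complement. *)
Lemma grown_connected x k q z : grown x k q z ->
  connected (fun u : 'I_k.+1 => z u) [set: 'I_k.+1].
Proof.
move=> [_ tr _ _ _] Q _ Q0 QT.
have first (R : {set 'I_k.+1}) : R != set0 -> ord0 \notin R -> exists x y,
    [/\ x \notin R, y \in R & root_step (z x) (z y)].
  case/set0Pn => r0 r0R R0; have [y yR ymin] := @arg_minnP _ r0 (mem R) (@nat_of_ord _) r0R.
  have y0 : (0 < y)%N by rewrite lt0n; apply: contraNneq R0 => e; rewrite (_ : ord0 = y) //; apply: val_inj.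
  have [|w wy st] := tr y; first by rewrite y0 -ltnS ltn_ord.
  have wk : (w < k.+1)%N by apply: ltn_trans wy _.
  exists (Ordinal wk), y; split=> //; apply: contraL wy => wR; rewrite -leqNgt; exact: (ymin _ wR).
have [Q1|Q1] := boolP (ord0 \in Q).
  have [||a [b [aR bR st]]] := first (~: Q); last 1 first.
  - move: aR bR; rewrite !inE negbK => aQ bQ; exists a, b; split=> //; first by rewrite !inE bQ.
    exact: root_step_adjacent.
  - by apply: contra QT => /eqP e; rewrite -[Q]setCK e setC0.
  - by rewrite inE negbK.
have [a [b [aR bR st]]] := first Q Q0 Q1; exists b, a; split=> //; first by rewrite !inE aR.
by rewrite adjacentC; apply: root_step_adjacent.
Qed.

(** The range of [k] comes from the dimension [n.+1]: an independent family has at most [n.+2]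
    points, and one more is added to it before the test. *)
Definition generic_growth := forall k (z : 'I_k.+1 -> 'I_m -> int), (k <= n.+2)%N ->
  (forall u i, (`|z u i| <= k)%N) -> connected z [set: 'I_k.+1] ->
  (exists u, layer (z u) = 0) -> ~ bad_config z v.

Lemma grown_indep x k q z : generic_growth -> (k <= n.+2)%N -> grown x k q z ->
  (forall u i, (u <= k)%N -> q u != v i) -> aff_indep k q.
Proof.
move=> gen kn gr ns a s0 s1 u; apply/eqP; apply: contraT => au.
have [pl tr bd inj z0] := gr.
case: (gen k (fun u => z u)) => //.
- by move=> w i; apply: leq_trans (bd _ _ _) _; rewrite -ltnS.
- exact: grown_connected gr.
- by exists ord0; rewrite /= z0 /layer big1.
exists x, (fun w : 'I_k.+1 => rat_row (q w)); split.
- by move=> w; apply: pl; rewrite -ltnS.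
- move=> w w' e; apply: val_inj.
  exact: inj (ltn_ord w) (ltn_ord w') (rat_row_inj e).
- move=> w i; rewrite row_rat; apply/eqP => /rat_row_inj e.
  by have /eqP := ns w i (ltn_ord w).
by exists a; split=> //; exists u.
Qed.

Lemma path_exit (T : eqType) (e : rel T) (S : T -> Prop) x p : path e x p -> S x ->
  ~ S (last x p) -> exists a b, [/\ S a, ~ S b & e a b].
Proof.
elim: p x => [|y p IH] x //= /andP[xy py] Sx nS.
by have [Sy|nSy] := pselect (S y); [apply: IH py Sy nS | exists x, y].
Qed.

(* Adding neighbours one at a time keeps the points affinely independent, so
   the process ends after at most [n + 2] points, and then [C] is exhausted. *)
Lemma exhaust (C : 'rV[int]_n.+1 -> Prop) h : generic_growth ->
  C h -> (forall a b, C a -> joined (gamma_edge v) a b -> C b) ->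
  (forall k, C k -> linked (gamma_edge v) h k) -> (forall i, ~ C (v i)) ->
  exists k q, [/\ aff_indep k q, forall u w, (u <= k)%N -> (w <= k)%N -> q u = q w -> u = w,
    forall y, C y <-> exists2 u, (u <= k)%N & q u = y & q 0%N = h].
Proof.
move=> gen Ch Cs Cl Cv; apply: contrapT => none.
have ns q k : (forall u, (u <= k)%N -> C (q u)) -> forall u i, (u <= k)%N -> q u != v i.
  by move=> Cq u i uk; apply/eqP => e; apply: (Cv i); rewrite -e; apply: Cq.
have all k : exists q z, [/\ grown (rat_row h) k q z, forall u, (u <= k)%N -> C (q u),
    aff_indep k q & q 0%N = h].
  elim: k => [|k [q [z [gr Cq ind q0]]]].
    exists (fun=> h), (fun _ _ => 0); split=> //; last first.
      by move=> a; rewrite big_ord1 => a0 _ u; rewrite ord1.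
    split=> //; last by move=> [|u] [|w].
      move=> u _; left; rewrite /layer /energy !big1 // => [|i _]; last by rewrite mul0r.
      rewrite addr0 (_ : zrow _ = 0) ?mul0mx ?addr0 //.
      by apply/rowP => i; rewrite !mxE.
    by move=> [|u].
  have [y Cy ny] : exists2 y, C y & ~ exists2 u, (u <= k)%N & q u = y.
    apply: contrapT => nex; apply: none; exists k, q; split=> //; first by case: gr.
    move=> y; split=> [Cy|[u uk <-]]; last exact: Cq.
    by apply: contrapT => ny; apply: nex; exists y.
  have [p hp ly] := Cl y Cy.
  have [||a [b [[u uk qa] nb ab]]] := @path_exit _ _ (fun y => exists2 u, (u <= k)%N & q u = y) h p hp.
  - by exists 0%N.
  - by rewrite ly.
  subst a; have Cb : C b by apply: Cs ab; apply: Cq.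
  have [pl tr bd inj z0] := gr.
  have [z' [pz st]] := placed_step (pl u uk) ab.
  pose q1 w := if w == k.+1 then b else q w.
  pose z1 w := if w == k.+1 then z' else z w.
  have old w : (w <= k)%N -> (w == k.+1) = false by move=> wk; apply/eqP => e; rewrite e ltnn in wk.
  have split_le w : (w <= k.+1)%N -> w = k.+1 \/ (w <= k)%N.
    by rewrite leq_eqVlt => /orP[/eqP|]; auto.
  have gr1 : grown (rat_row h) k.+1 q1 z1.
    split.
    - by move=> w /split_le[->|wk]; rewrite /q1 /z1 ?eqxx // old //; apply: pl.
    - move=> w /andP[w0 /split_le[->|wk]].
        by exists u; rewrite ?ltnS // /z1 eqxx (old u uk).
      have [|w' ww' st'] := tr w; first by rewrite w0.
      exists w' => //; rewrite /z1 (old w wk).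
      by rewrite (old w' (leq_trans (ltnW ww') wk)).
    - move=> w i /split_le[->|wk]; rewrite /z1 ?eqxx ?old //; last exact: bd.
      have [i1 [j1 [a1 [b1 [ij h1 h2 ->]]]]] := st.
      have := bd u i uk; have ji : (j1 == i1) = false by rewrite eq_sym (negPf ij).
      have [->|ci] := eqVneq i i1; first by rewrite (negPf ij) /=; move: uk h1; clear; lia.
      by have [->|cj] := eqVneq i j1 => /=; move: uk h2; clear; lia.
    - move=> w w' /split_le[->|wk] /split_le[->|wk'] //; rewrite /q1 ?eqxx ?old //.
      + by move=> e; case: nb; exists w'.
      + by move=> e; case: nb; exists w.
      exact: inj.
    by rewrite /z1 old.
  have Cq1 w : (w <= k.+1)%N -> C (q1 w).
    by move=> /split_le[->|wk]; rewrite /q1 ?eqxx ?old //; apply: Cq.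
  exists q1, z1; split=> //.
  apply: (grown_indep gen _ gr1); last exact: ns.
  by rewrite ltnS (aff_indep_bound ind).
have [q [z [_ _ /aff_indep_bound + _]]] := all n.+2; by rewrite ltnn.
Qed.

End Growth.

(** * Walks in an edge system *)

Section Linked.
Variables (m : nat) (T : Type) (E : color -> T -> T -> 'I_m -> 'I_m -> bool).
Hypothesis E_sym : forall x y, joined E x y -> joined E y x.

Lemma linked_refl x : linked E x x.
Proof. by exists [::]. Qed.

Lemma linked_step x y w : joined E x y -> linked E y w -> linked E x w.
Proof. by move=> xy [p yp <-]; exists (y :: p); rewrite //= xy. Qed.

Lemma linked_trans x y w : linked E x y -> linked E y w -> linked E x w.
Proof. by move=> [p xp <-] [q pq <-]; exists (p ++ q); rewrite ?cat_path ?xp ?last_cat. Qed.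

Lemma linked1 x y : joined E x y -> linked E x y.
Proof. by move=> xy; apply: linked_step xy (linked_refl y). Qed.

Lemma linked_ind (S : T -> Prop) x y : S x ->
  (forall a b, S a -> joined E a b -> S b) -> linked E x y -> S y.
Proof.
move=> Sx Sj [p + <-]; elim: p x Sx => [|y' p IH] x Sx //= /andP[xy py].
by apply: IH py; apply: Sj xy.
Qed.

Lemma linked_sym x y : linked E x y -> linked E y x.
Proof.
apply: (linked_ind (S := fun y => linked E y x)) => [|a b ax ab]; first exact: linked_refl.
by apply: linked_step ax; apply: E_sym.
Qed.

End Linked.

(** * Generic parameters and the special component *)

Section Generic.
Variables m n : nat.
Implicit Types (v : 'I_m -> 'rV[int]_n.+1).

(** Isolates the special component: an edge leaving it would create a right angle between three of
    the [v_i]. *)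
Definition no_right_angle v := forall i a j, i != a -> i != j ->
  dot (row i (rat_mx v) - row a (rat_mx v)) (row i (rat_mx v) - row j (rat_mx v)) != 0.
(** Makes the marking of a black edge unique, as an abstract marked graph demands. *)
Definition distinct_differences v := forall i j i' j', i != j -> i' != j' ->
  v j - v i = v j' - v i' -> (i, j) = (i', j').
Definition generic v := [/\ generic_growth v, no_right_angle v & distinct_differences v].

Lemma thin_growth : thin (fun v => ~ @generic_growth m n v).
Proof.
(* Entries between [-k] and [k] are shifted by [k] into a finite type, so that [thin_exists]
   applies. *)
pose dec k (c : {ffun 'I_k.+1 -> {ffun 'I_m -> 'I_(2 * k).+1}}) (u : 'I_k.+1) (i : 'I_m) : int :=
  ((c u i : nat)%:Z - k%:Z)%R.
pose bad (k : 'I_n.+3) v := exists c, connected (dec k c) [set: 'I_k.+1] /\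
  (exists u, layer (dec k c u) = 0) /\ bad_config (n := n.+1) (dec k c) v.
have : thin (fun v => exists k, bad k v).
  apply: thin_exists => k; apply: thin_exists => c.
  have [[conn lay]|h] := pselect (connected (dec k c) [set: 'I_k.+1] /\
      exists u, layer (dec k c u) = 0); last by apply: thin_none => v [h1 [h2 _]]; apply: h.
  have kn : (k <= n.+2)%N by rewrite -ltnS.
  by apply: thin_sub (thin_config kn conn lay) => v [_ [_]].
apply: thin_sub => v ng; apply: contrapT => nb; apply: ng => k z kn bd conn lay bc.
apply: nb; have kn' : (k < n.+3)%N by [].
have ok u i : (absz (z u i + k%:Z)%R < (2 * k).+1)%N by have := bd u i; lia.
exists (Ordinal kn'), [ffun u => [ffun i => Ordinal (ok u i)]].
suff -> : dec (Ordinal kn') [ffun u => [ffun i => Ordinal (ok u i)]] = z by [].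
apply/funext => u; apply/funext => i; rewrite /dec !ffunE /=.
by have := bd u i; lia.
Qed.

Lemma thin_right_angle : thin (fun v => ~ no_right_angle v).
Proof.
pose f i a j (V : 'M[rat]_(m, n.+1)) := dot (row i V - row a V) (row i V - row j V).
have : thin (fun v => exists i a j, (i != a) && (i != j) /\ f i a j (@rat_mx m n.+1 v) = 0).
  apply: thin_exists => i; apply: thin_exists => a; apply: thin_exists => j.
  case ia: (i != a); last by apply: thin_none => v [].
  case ij: (i != j); last by apply: thin_none => v [].
  have f0 : f i a j (line_mx n (fun k => (k == i)%:R)) != 0.
    rewrite /f !rowE -!mulmxBl /line_mx dot_line !mulmxBl.
    rewrite mxE [X in _ + X]mxE [X in _ * X]mxE [X in _ * (_ + X)]mxE !delta_line eqxx.
    by rewrite ![_ == i]eq_sym (negPf ia) (negPf ij).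
  have pf : polynomial (f i a j).
    apply: polynomial_ext (proj1 (quadratic_dot n.+1 (delta_mx 0 i - delta_mx 0 a)
      (delta_mx 0 i - delta_mx 0 j))) => V.
    by rewrite !mulmxBl -!rowE.
  by apply: thin_sub (thin_polynomial pf f0) => v [_].
apply: thin_sub => v nr; apply: contrapT => nb; apply: nr => i a j ia ij.
by apply/eqP => e; apply: nb; exists i, a, j; rewrite ia ij.
Qed.

Lemma thin_differences : thin (fun v => ~ distinct_differences v).
Proof.
pose f (i j i' j' : 'I_m) (V : 'M[rat]_(m, n.+1)) := V j 0 - V i 0 - (V j' 0 - V i' 0).
have key i j i' j' : thin (fun v => [&& i != j, i' != j' & (i, j) != (i', j')] /\
    f i j i' j' (@rat_mx m n.+1 v) = 0).
  case h: [&& _, _ & _]; last by apply: thin_none => v [].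
  case/and3P: h => ij ij' ne.
  have pf : polynomial (f i j i' j') by do !(apply: polynomialB); apply: polynomial_entry.
  have lineE (phi : 'I_m -> rat) k : line_mx n phi k 0 = phi k.
    by rewrite /line_mx mxE big_ord1 !mxE eqxx mulr1.
  suff [V0 hV0] : exists V0, f i j i' j' V0 != 0.
    by apply: thin_sub (thin_polynomial pf hV0) => v [_].
  have [e|jj] := eqVneq j j'.
    exists (line_mx n (fun k => (k == i')%:R)); rewrite /f !lineE -e.
    have ii : (i == i') = false.
      by apply: contraNF ne => /eqP e'; rewrite e e'.
    by rewrite ii eqxx e [j' == i']eq_sym (negPf ij').
  exists (line_mx n (fun k => (k == j)%:R)); rewrite /f !lineE eqxx (negPf ij) [j' == j]eq_sym (negPf jj).
  by case: (i' == j).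
have : thin (fun v => exists i j i' j', [&& i != j, i' != j' & (i, j) != (i', j')] /\
    f i j i' j' (@rat_mx m n.+1 v) = 0).
  by do 4 (apply: thin_exists => ?); apply: key.
apply: thin_sub => v nr; apply: contrapT => nb; apply: nr => i j i' j' ij ij' e.
apply/eqP; apply: contraT => ne; case: nb; exists i, j, i', j'; rewrite ij ij' ne; split=> //.
have := congr1 (fun h : 'rV[int]_n.+1 => (h 0 0)%:~R : rat) e.
by rewrite !mxE !rmorphB /= /f !mxE => ->; rewrite subrr.
Qed.

Lemma thin_not_generic : thin (fun v => ~ generic v).
Proof.
apply: thin_sub (thin_or thin_growth (thin_or thin_right_angle thin_differences)) => v ng.
apply: contrapT => h; apply: ng; split; apply: contrapT => h'; apply: h; auto.
Qed.

(** For a black edge at [v_a] with [i != a], the two conditions combine into the orthogonality of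
    [v_i - v_a] and [v_i - v_j]; for a red one with [a] different from [i] and [j], of [v_a - v_i]
    and [v_a - v_j]. In the remaining cases the other end is itself one of the [v_j]. *)
Lemma special_closed v a k : no_right_angle v -> joined (gamma_edge v) (v a) k ->
  exists j, k = v j.
Proof.
move=> nra /existsP[i /existsP[j]]; rewrite /gamma_edge; case ij: (i != j) => //=.
have dotr (x y : 'rV[int]_n.+1) : exists d : int, d%:~R = dot (map_mx intr x : 'rV[rat]_n.+1) (map_mx intr y).
  exists (\sum_c x 0 c * y 0 c); rewrite rmorph_sum; apply: eq_bigr => c _.
  by rewrite rmorphM /= !mxE.
pose r (x : 'rV[int]_n.+1) : 'rV[rat]_n.+1 := map_mx intr x.
have rB x y : r (x - y) = r x - r y by apply: raddfB.
have rD x y : r (x + y) = r x + r y by apply: raddfD.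
have ang b c d : b != c -> b != d -> dot (r (v b) - r (v c)) (r (v b) - r (v d)) != 0.
  by move=> bc bd; have := nra b c d bc bd; rewrite !row_rat.
case/orP => /andP[/eqP e1 /eqP e2].
  have ek : k = v a + (v j - v i) by rewrite -e1 addrC subrK.
  have [ia|ia] := eqVneq i a; first by exists j; rewrite ek ia addrC subrK.
  have := ang i a j ia ij; have := congr1 (intr : int -> rat) e2; rewrite !rmorphB /= !sqnorm_dot.
  rewrite -!/(r _) ek rD rB !dotE.
  rewrite (dotC (r (v j)) (r (v a))) (dotC (r (v i)) (r (v a))) (dotC (r (v j)) (r (v i))).
  by move=> h /eqP[]; lra.
have ek : k = v i + v j - v a by rewrite -e1 addrK.
have [ia|ia] := eqVneq i a; first by exists j; rewrite ek ia addrC addKr.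
have [ja|ja] := eqVneq j a; first by exists i; rewrite ek ja addrK.
have := ang a i j; rewrite !(eq_sym a) ia ja => /(_ isT isT).
have := congr1 (intr : int -> rat) e2; rewrite !rmorphD /= !sqnorm_dot -!/(r _) ek rB rD !dotE.
rewrite (dotC (r (v i)) (r (v a))) (dotC (r (v j)) (r (v a))) (dotC (r (v j)) (r (v i))).
by move=> h /eqP[]; lra.
Qed.

Lemma special_joined v i j : i != j -> joined (gamma_edge v) (v i) (v j).
Proof.
move=> ij; apply/existsP; exists i; apply/existsP; exists j.
by rewrite /gamma_edge ij !eqxx.
Qed.

Lemma special_linked v a k : no_right_angle v ->
  linked (gamma_edge v) (v a) k <-> exists j, v j = k.
Proof.
move=> nra; split.
  apply: (linked_ind (S := fun k => exists j, v j = k)); first by exists a.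
  by move=> x y [j <-] /(special_closed nra)[j' ->]; exists j'.
move=> [j <-]; have [->|aj] := eqVneq a j; first exact: linked_refl.
exact: linked1 (special_joined v aj).
Qed.

End Generic.

From mathcomp Require Import classical_sets cardinality.

(** * Components of a generic graph *)

Section Components.
Variables (m n : nat) (v : 'I_m -> 'rV[int]_n.+1).
Hypothesis gen : generic v.
Implicit Types (C : classical_sets.set 'rV[int]_n.+1).
Notation rat_row := (map_mx (intr : int -> rat)).

Lemma component_linked C h : nonspecial_component v C -> C h ->
  forall k, C k <-> linked (gamma_edge v) h k.
Proof.
move=> [[h0 ->] _] h0h k; rewrite /=; split=> hk; last exact: linked_trans h0h hk.
by apply: linked_trans hk; apply: linked_sym => //; apply: joined_sym.
Qed.

Lemma component_avoids C i : nonspecial_component v C -> ~ C (v i).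
Proof.
move=> nC Cvi; have [_ nra _] := gen; case: (nC) => _; apply; apply/seteqP; split=> k.
  by move=> /(component_linked nC Cvi)/(special_linked _ _ nra)[j <-]; exists j.
by move=> [j _ <-]; apply/(component_linked nC Cvi)/(special_linked _ _ nra); exists j.
Qed.

Lemma component_closed C a b : nonspecial_component v C -> C a ->
  joined (gamma_edge v) a b -> C b.
Proof. by move=> nC Ca ab; apply/(component_linked nC Ca); apply: linked1. Qed.

Lemma component_enum C h : nonspecial_component v C -> C h ->
  exists k q, [/\ aff_indep k q, forall u w, (u <= k)%N -> (w <= k)%N -> q u = q w -> u = w,
    forall y, C y <-> exists2 u, (u <= k)%N & q u = y & q 0%N = h].
Proof.
move=> nC Ch; have [gg _ _] := gen; apply: (exhaust gg Ch).
- by move=> a b; apply: component_closed.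
- by move=> k /(component_linked nC Ch).
by move=> i; apply: component_avoids.
Qed.

Lemma component_nonempty C : nonspecial_component v C -> exists h, C h.
Proof. by move=> [[h ->] _]; exists h; apply: linked_refl. Qed.

Lemma component_indep C : nonspecial_component v C -> affinely_independent C.
Proof.
move=> nC r p a pinj Cp s0 s1 t0.
have [h Ch] := component_nonempty nC; have [k [q [ind _ Cq _]]] := component_enum nC Ch.
have /choice[s hs] : forall t, exists u : 'I_k.+1, q u = p t.
  by move=> t; have /Cq[u uk <-] := Cp t; exists (Ordinal (uk : (u < k.+1)%N)).
have sinj : injective s by move=> t t' e; apply: pinj; rewrite -!hs e.
pose b (u : 'I_k.+1) := \sum_(t | s t == u) a t.
have := ind b; rewrite /b => /(_ _ _ (s t0)).
rewrite (big_pred1 t0) => [|t]; last by rewrite (inj_eq sinj).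
apply.
  by rewrite -[RHS]s0 [RHS](partition_big s predT).
rewrite -[RHS]s1 [RHS](partition_big s predT) //; apply: eq_bigr => u _.
by rewrite scaler_suml; apply: eq_bigr => t /eqP <-; rewrite hs.
Qed.

Lemma component_card C : nonspecial_component v C -> (C #<= `I_n.+2)%card.
Proof.
move=> nC; have [h Ch] := component_nonempty nC.
have [k [q [ind _ Cq _]]] := component_enum nC Ch.
have -> : C = [set q u | u in `I_k.+1]%classic.
  apply/seteqP; split=> y.
    by move=> /Cq[u uk <-]; exists u.
  by move=> [u uk <-]; apply/Cq; exists u.
apply: card_le_trans (card_image_le _ _) _.
by rewrite card_le_II ltnS; apply: aff_indep_bound ind.
Qed.

Lemma finite_ball (B : int) : finite_set [set h : 'rV[int]_n.+1 | (sqnorm h <= B)%R]%classic.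
Proof.
pose b := `|B|%N.
pose dec (f : {ffun 'I_n.+1 -> 'I_(2 * b).+1}) : 'rV[int]_n.+1 := \row_c ((f c : nat)%:Z - b%:Z).
apply: (sub_finite_set _ (finite_image dec (@finite_finset _ [set: _]%classic))) => h /= hB.
have bd c : (absz (h 0 c + b%:Z)%R < (2 * b).+1)%N /\ 0 <= h 0 c + b%:Z.
  have : h 0 c ^+ 2 <= B.
    apply: le_trans hB; rewrite /sqnorm (bigD1 c) //= lerDl.
    by apply: sumr_ge0 => i _; apply: sqr_ge0.
  rewrite expr2 /b; move: (h 0 c) => x x2.
  have x0 : 0 <= x * x by rewrite -expr2 sqr_ge0.
  have le1 : (absz x * absz x <= `|B|)%N.
    by rewrite -abszM; move: (x * x) x0 x2; clear=> y; lia.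
  have le2 : (absz x <= absz x * absz x)%N by case: (absz x) => [|y] //; rewrite leq_pmulr.
  by move: le1 le2; clear; move: (absz x * absz x)%N => y; lia.
exists [ffun c => Ordinal (bd c).1] => //.
by apply/rowP => c; rewrite !mxE ffunE /=; have := (bd c).2; lia.
Qed.

Lemma finite_red : finite_set
  [set C | nonspecial_component v C /\ has_red_edge v C]%classic.
Proof.
pose B := \sum_i sqnorm (v i) + \sum_i sqnorm (v i).
apply: (sub_finite_set _ (finite_image (fun h => [set k | linked (gamma_edge v) h k]%classic)
  (finite_ball B))) => C [nC [k [h [i [j [Ck Ch]]]]]].
rewrite /gamma_edge => /andP[_ /andP[_ /eqP e]].
exists k; last by apply/seteqP; split=> y /=; rewrite (component_linked nC Ck).
have s0 x : 0 <= sqnorm (n := n.+1) x by apply: sumr_ge0 => c _; apply: sqr_ge0.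
have le1 l : sqnorm (v l) <= \sum_i sqnorm (v i).
  by rewrite (bigD1 l) //= lerDl; apply: sumr_ge0 => c _.
rewrite /= /B; apply: le_trans (lerD (le1 i) (le1 j)); rewrite -e; by rewrite lerDr.
Qed.

End Components.

(** * Families of black components *)

Section Families.
Variables (m n : nat) (v : 'I_m -> 'rV[int]_n.+1).
Hypothesis gen : generic v.
Implicit Types (C : classical_sets.set 'rV[int]_n.+1).
Notation rat_row := (map_mx (intr : int -> rat)).

Lemma black_edge_unique (x y : 'rV[int]_n.+1) i j i' j' :
  gamma_edge v Black x y i j -> gamma_edge v Black x y i' j' -> (i, j) = (i', j').
Proof.
have [_ _ dd] := gen; rewrite /gamma_edge => /and3P[ij /eqP e _] /and3P[ij' /eqP e' _].
by apply: dd => //; rewrite -e -e'.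
Qed.

Lemma black_edge_sym (x y : 'rV[int]_n.+1) i j :
  gamma_edge v Black x y i j = gamma_edge v Black y x j i.
Proof.
by rewrite /gamma_edge eq_sym -[y - x]opprB -[sqnorm y - _]opprB -[v j - v i]opprB
  -[sqnorm (v j) - _]opprB !eqr_opp.
Qed.

Lemma black_joined C a b : black_component v C -> C a -> joined (gamma_edge v) a b ->
  C b /\ exists i j, gamma_edge v Black a b i j.
Proof.
move=> [nC nred] Ca ab; have Cb := component_closed nC Ca ab; split=> //.
case/existsP: ab => i /existsP[j /orP[h|h]]; first by exists i, j.
by case: nred; exists a, b, i, j.
Qed.

(* A finite stand-in for the isomorphism classes of black marked graphs on at
   most [n + 2] vertices: the black edges of a graph with vertex set ['I_k.+1]. *)
Definition graph_code := {k : 'I_n.+2 & {ffun 'I_k.+1 * 'I_k.+1 * ('I_m * 'I_m) -> bool}}.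
Definition code_edge (t : graph_code) (x y : 'I_(tag t).+1) (i j : 'I_m) : bool :=
  tagged t (x, y, (i, j)).
Definition code_realizes (t : graph_code) C (phi : 'I_(tag t).+1 -> 'rV[int]_n.+1) :=
  [/\ injective phi, forall p, C p <-> exists x, phi x = p &
      forall x y i j, code_edge x y i j = gamma_edge v Black (phi x) (phi y) i j].
Definition code_of (t : graph_code) C := black_component v C /\ exists phi, @code_realizes t C phi.

Lemma code_exists C : black_component v C -> exists t, code_of t C.
Proof.
move=> bC; have [nC _] := bC; have [h Ch] := component_nonempty nC.
have [k [q [ind inj Cq _]]] := component_enum gen nC Ch.
have kn : (k < n.+2)%N by rewrite ltnS (aff_indep_bound ind).
exists (existT (fun k : 'I_n.+2 => {ffun 'I_k.+1 * 'I_k.+1 * ('I_m * 'I_m) -> bool}) (Ordinal kn)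
  [ffun p : 'I_k.+1 * 'I_k.+1 * ('I_m * 'I_m) => gamma_edge v Black (q p.1.1) (q p.1.2) p.2.1 p.2.2]).
split=> //; exists (fun u => q u); split.
- by move=> u w e; apply: val_inj; apply: inj (ltn_ord u) (ltn_ord w) e.
- move=> p; split; first by move=> /Cq[u uk <-]; exists (Ordinal (uk : (u < k.+1)%N)).
  by move=> [u <-]; apply/Cq; exists (u : nat) => //; exact: (ltn_ord u).
by move=> x y i j; rewrite /code_edge /= ffunE.
Qed.

(** Two codes of the same component differ by a relabelling of vertices, which applies equally to
    any other component having the first code. *)
Lemma code_transfer t t' C C' : code_of t C -> code_of t' C -> code_of t C' -> code_of t' C'.
Proof.
move=> [_ [phi [pinj pC pE]]] [_ [phi' [pinj' pC' pE']]] [bC' [psi [qinj qC qE]]].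
have /choice[s hs] : forall y, exists x, phi x = phi' y.
  by move=> y; apply/pC/pC'; exists y.
split=> //; exists (psi \o s); split.
- by move=> x y /qinj e; apply: pinj'; rewrite -!hs e.
- move=> p; split; last by move=> [y <-]; apply/qC; exists (s y).
  move=> /qC[x <-]; have /pC'[y e] : C (phi x) by apply/pC; exists x.
  by exists y; rewrite /=; congr psi; apply: pinj; rewrite hs.
by move=> x y i j; rewrite pE' -!hs -pE qE.
Qed.

Section Graph.
Variable t : graph_code.
Hypothesis t_real : exists C, code_of t C.

Definition edge_of_code c (x y : 'I_(tag t).+1) i j :=
  if c is Black then code_edge x y i j else false.

Lemma code_marking c x y i j : edge_of_code c x y i j -> i != j.
Proof.
have [C [_ [phi [_ _ E]]]] := t_real.
by case: c => //=; rewrite E /gamma_edge => /andP[].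
Qed.

(** A loop read backwards carries the exchanged marking, and uniqueness of markings would give
    [i = j]. *)
Lemma code_loopless c x y i j : edge_of_code c x y i j -> x != y.
Proof.
have [C [_ [phi [_ _ E]]]] := t_real; case: c => //=; rewrite E => h.
apply/eqP => e; subst y; have h' := h; rewrite black_edge_sym in h'.
have [ij] := black_edge_unique h h'; move: h; rewrite ij /gamma_edge eqxx //.
Qed.

Lemma code_reverse c x y i j : edge_of_code c x y i j = edge_of_code c y x j i.
Proof.
have [C [_ [phi [_ _ E]]]] := t_real.
by case: c => //=; rewrite !E black_edge_sym.
Qed.

Lemma code_red x y i j : edge_of_code Red x y i j = edge_of_code Red y x i j.
Proof. by []. Qed.

Lemma code_no_repeat c c' x y i j i' j' :
  edge_of_code c x y i j -> edge_of_code c' x y i' j' ->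
  c = c' /\ ((i', j') = (i, j) \/ (c = Red /\ (i', j') = (j, i))).
Proof.
have [C [_ [phi [_ _ E]]]] := t_real.
case: c; case: c' => //=; rewrite !E => h h'.
by split=> //; left; rewrite (black_edge_unique h h').
Qed.

Lemma code_connected x y : linked edge_of_code x y.
Proof.
have [C [bC [phi [inj hC E]]]] := t_real; have [nC _] := bC.
have Cphi w : C (phi w) by apply/hC; exists w.
have /(component_linked nC (Cphi x)) := Cphi y.
suff : forall p, linked (gamma_edge v) (phi x) p -> exists2 w, phi w = p & linked edge_of_code x w.
  by move=> h /h[w /inj <-].
move=> p; apply: (linked_ind (S := fun p => exists2 w, phi w = p & linked edge_of_code x w)).
  by exists x => //; apply: linked_refl.
move=> a b [w wa xw] ab; subst a.
have [Cb [i [j hij]]] := black_joined bC (Cphi w) ab.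
have /hC[w' e] := Cb; exists w' => //; apply: linked_trans xw (linked1 _).
apply/existsP; exists i; apply/existsP; exists j; rewrite /= E e hij //.
Qed.

Definition graph_of_code : marked_graph m := @MarkedGraph m (tag t) edge_of_code
  code_marking code_loopless code_reverse code_red code_no_repeat code_connected.

Lemma graph_realizes C phi : black_component v C ->
  realizes v (G := graph_of_code) C phi <-> @code_realizes t C phi.
Proof.
move=> [nC nred]; split=> [[inj rg E]|[inj rg E]].
  split=> //; last by move=> x y i j; rewrite -(E Black).
  by move=> p; rewrite -rg; split=> [[x _ <-]|[x <-]]; exists x.
split=> //.
  by apply/seteqP; split=> p; [move=> [x _ <-]; apply/rg; exists x | move=> /rg[x <-]; exists x].
case=> x y i j /=; first exact: E.
apply/esym/negP => h; apply: nred; exists (phi x), (phi y), i, j.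
by split=> //; apply/rg; [exists x | exists y].
Qed.

(** Both increments are sums of data of the markings along a walk from [r] to [y] in the common
    graph. *)
Lemma same_shape C C' (phi psi : 'I_(tag t).+1 -> 'rV[int]_n.+1) r y :
  @code_realizes t C phi -> @code_realizes t C' psi ->
  phi y - phi r = psi y - psi r /\
  sqnorm (phi y) - sqnorm (phi r) = sqnorm (psi y) - sqnorm (psi r).
Proof.
move=> [_ _ E] [_ _ E']; have := code_connected r y.
apply: (linked_ind (S := fun y => phi y - phi r = psi y - psi r /\
  sqnorm (phi y) - sqnorm (phi r) = sqnorm (psi y) - sqnorm (psi r))).
  by rewrite !subrr.
move=> a b [e1 e2] /existsP[i /existsP[j]]; rewrite /= orbF => h.
have := h; rewrite E /gamma_edge => /and3P[_ /eqP f1 /eqP f2].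
have := h; rewrite E' /gamma_edge => /and3P[_ /eqP g1 /eqP g2].
by split; [rewrite -(subrKA (phi a)) f1 e1 -g1 subrKA |
  rewrite -(subrKA (sqnorm (phi a))) f2 e2 -g2 subrKA].
Qed.

Lemma sqnorm_shift (p d : 'rV[int]_n.+1) :
  sqnorm (p + d) - sqnorm p = 2 * \sum_c p 0 c * d 0 c + sqnorm d.
Proof.
rewrite /sqnorm mulr_sumr -sumrB -big_split /=; apply: eq_bigr => c _.
by rewrite mxE; ring.
Qed.

Lemma roots_in_coset (r : 'I_(tag t).+1) : exists L c, sublattice_of_rank (n.+1 - tag t) L /\
  forall C phi, @code_realizes t C phi -> coset c L (phi r).
Proof.
have [C0 [[nC0 _] [psi real0]]] := t_real; have [inj hC0 E0] := real0.
pose D : 'M[int]_(tag t, n.+1) := \matrix_(u, c) (psi (lift r u) 0 c - psi r 0 c).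
have fD : row_free (map_mx intr D : 'M[rat]_(tag t, n.+1)).
  rewrite -kermx_eq0; apply/rowV0P => c /sub_kermxP hc.
  pose a u := if unlift r u is Some w then c 0 w else - \sum_w c 0 w.
  have aL w : a (lift r w) = c 0 w by rewrite /a liftK.
  have ar : a r = - \sum_w c 0 w by rewrite /a unlift_none.
  have a0 : forall u, a u = 0.
    apply: (component_indep gen nC0 inj).
    - by move=> u; apply/hC0; exists u.
    - by rewrite (bigD1_ord r) //= ar; under [X in _ + X]eq_bigr do rewrite aL; rewrite addNr.
    rewrite (bigD1_ord r) //= ar scaleNr scaler_suml -sumrN -big_split /= -[RHS]hc.
    rewrite mulmx_sum_row; apply: eq_bigr => w _; rewrite aL -scalerN -scalerDr; congr (_ *: _).
    by apply/rowP => k; rewrite !mxE rmorphB addrC.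
  by apply/rowP => w; rewrite mxE -aL a0.
have tn : (tag t <= n.+1)%N by rewrite -ltnS.
have [B fB kerB] := kernel_lattice (esym (subnKC tn)) fD.
exists [set b *m B | b in [set: 'rV[int]_(n.+1 - tag t)]]%classic, (psi r).
split; first by exists B.
move=> C phi real; have orth : (phi r - psi r) *m D^T = 0.
  apply/rowP => u; rewrite !mxE.
  have [e1 e2] := same_shape r (lift r u) real real0.
  pose d := psi (lift r u) - psi r.
  have ep : phi (lift r u) = phi r + d by rewrite /d -e1 addrC subrK.
  have eq : psi (lift r u) = psi r + d by rewrite /d addrC subrK.
  (* Equal increments of the squared norm along the common difference [d] mean equal products with
     [d]. *)
  move: e2; rewrite ep eq !sqnorm_shift => /addIr/(mulfI _) e2.
  have {}e2 : \sum_c phi r 0 c * d 0 c = \sum_c psi r 0 c * d 0 c by apply: e2.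
  rewrite (eq_bigr (fun c => phi r 0 c * d 0 c - psi r 0 c * d 0 c)) => [|c _].
    by rewrite sumrB e2 subrr.
  by rewrite !mxE; ring.
have [b hb] := kerB _ orth.
by exists (b *m B); [exists b | rewrite -hb addrC subrK].
Qed.

End Graph.

Lemma black_families_generic : black_families v.
Proof.
(* One code is kept for each isomorphism class that occurs: the least, in the enumeration, among the
   codes of some component. This makes the family of a component unique. *)
pose canonical (t : graph_code) := `[< exists C, code_of t C /\
  forall t', code_of t' C -> (enum_rank t <= enum_rank t')%N >].
pose S := [pred t | canonical t].
have SE t : (t \in S) = canonical t by [].
have real t : t \in S -> exists C, code_of t C.
  by rewrite SE => /asboolP[C [h _]]; exists C.
pose F (i : 'I_#|S|) := graph_of_code (real _ (enum_valP i)).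
exists #|S|, F; split.
  move=> C bC; have [t0 ht0] := code_exists bC.
  have [t ht tmin] := @arg_minnP _ t0 (fun t => `[< code_of t C >]) (fun t => enum_rank t) (asboolT ht0).
  have {}tmin t' : code_of t' C -> (enum_rank t <= enum_rank t')%N by move=> h; apply/tmin/asboolP.
  move/asboolP: ht => ht.
  have tS : t \in S by rewrite SE; apply/asboolP; exists C.
  (* If [t'] is least for [C'] and is also a code of [C], then [t] is a code of [C'] by
     [code_transfer], so neither of [t] and [t'] precedes the other. *)
  have uniq t' : t' \in S -> code_of t' C -> t' = t.
    rewrite SE => /asboolP[C' [h' min']] h; apply: enum_rank_inj; apply: val_inj.
    apply/eqP; rewrite eqn_leq tmin // andbT; apply: min'.
    exact: code_transfer h ht h'.
  exists (enum_rank_in tS t); split.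
    have [_ [phi hphi]] : code_of (enum_val (enum_rank_in tS t)) C by rewrite enum_rankK_in.
    by exists phi; apply/graph_realizes.
  move=> i [phi /(graph_realizes _ bC) hphi].
  apply: enum_val_inj; rewrite enum_rankK_in //; apply/esym/uniq; first exact: enum_valP.
  by split=> //; exists phi.
move=> i; split; first by rewrite /= -ltnS.
move=> r; have [L [c [rk hL]]] := roots_in_coset (real _ (enum_valP i)) r.
exists L, c; split=> // C phi bC /(graph_realizes _ bC); exact: hL.
Qed.

End Families.

Local Open Scope classical_set_scope.
Local Open Scope card_scope.

Theorem theorem5 (n m : nat) (hn : (2 <= n)%N) :
  exists2 R : {mpoly int[m * n]}, R != 0 &
    forall v : 'I_m -> 'rV[int]_n, R.@[coordinates v] != 0 ->
      [/\ forall C, nonspecial_component v C ->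
            affinely_independent C /\ C #<= `I_n.+1,
          finite_set [set C | nonspecial_component v C /\ has_red_edge v C]
        & black_families v].
Proof.
case: n hn => [//|k] _; have [R R0 hR] := thin_not_generic m k.
exists R => // v hv; have gen : generic v.
  by apply: contrapT => ng; case/eqP: hv; exact: hR ng.
split; last exact: black_families_generic.
  by move=> C nC; split; [exact (component_indep gen nC) | exact (component_card gen nC)].
exact: finite_red.
Qed.
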